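(* Let $\alpha_1,\alpha_2>-1$, $\beta_1<0$ and $\beta_2>0$, and consider the equation $$\frac{dX_t}{dt}=\begin{cases}\beta_1|X_t-B_t|^{\alpha_1}&\text{if }X_t<B_t,\\ \beta_2|X_t-B_t|^{\alpha_2}&\text{if }X_t>B_t,\end{cases}\qquad X_0=0 .$$ Let $$\lambda_j=\frac{(2|\beta_j|)^{1/(\alpha_j+1)}(\alpha_j+1)^{\alpha_j/(\alpha_j+1)}}{\sigma^{2/(\alpha_j+1)}\,\Gamma(1/(\alpha_j+1))},\qquad j=1,2.$$ The probability of a negative bifurcation is equal to $\lambda_1/(\lambda_1+\lambda_2)$. When $\alpha_1=\alpha_2=0$, the formula simplifies to $|\beta_1|/(|\beta_1|+|\beta_2|)$.
   Context: $B_t$ is a Brownian motion with $B_0=0$ and variance $\mathbb{E}B_t^2=\sigma^2t$, $\sigma^2>0$. The equation is understood in the integrated form $X_t=\int_0^t[\beta_1|X_s-B_s|^{\alpha_1}\mathbf 1_{\{X_s-B_s\le0\}}+\beta_2|X_s-B_s|^{\alpha_2}\mathbf 1_{\{X_s-B_s>0\}}]ds$, $t\ge 0$ (up to a possible explosion time); its solution is unique in law. A negative bifurcation occurs if for some $t_1$ we have $X_t<B_t$ for all $t>t_1$ (for all $t>t_1$ before the explosion time, in case of explosion); a positive bifurcation is defined analogously with $X_t>B_t$. $\Gamma$ is the Gamma function. *)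

(* Defs.v *)
From HB Require Import structures.
From mathcomp Require Import all_boot all_order all_algebra.
From mathcomp Require Import all_classical all_reals all_analysis.
Set Implicit Arguments.
Unset Strict Implicit.
Unset Printing Implicit Defensive.
Import Order.TTheory GRing.Theory Num.Theory.
Import numFieldNormedType.Exports.
Local Open Scope classical_set_scope.
Local Open Scope ring_scope.

(* Processes are indexed by a real time t, of which only t >= 0 matters. *)

Definition filtration (d : measure_display) (T : measurableType d)
    (R : realType) (F : R -> set (set T)) : Prop :=
  [/\ forall t, 0 <= t -> sigma_algebra [set: T] (F t),
      forall t, 0 <= t -> F t `<=` measurable &
      forall s t, 0 <= s -> s <= t -> F s `<=` F t].

(* Brownian motion relative to F, with B_0 = 0 and E[B_t ^ 2] = sigma ^ 2 * t;
   the second parameter of normal_prob is the standard deviation. *)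
Definition brownian_motion (d : measure_display) (T : measurableType d)
    (R : realType) (P : probability T R) (F : R -> set (set T)) (sigma : R)
    (B : R -> T -> R) : Prop :=
  [/\ forall (t : R) (C : set R), 0 <= t -> measurable C -> F t (B t @^-1` C),
      {ae P, forall w, B 0 w = 0},
      {ae P, forall w, {within `[0, +oo[, continuous (B ^~ w)}},
      forall (s t : R) (C : set R), 0 <= s -> s < t -> measurable C ->
        P ((B t \- B s) @^-1` C) =
          normal_prob 0 (sigma * Num.sqrt (t - s)) C &
      forall (s t : R) (A : set T) (C : set R),
        0 <= s -> s < t -> F s A -> measurable C ->
        (P (A `&` (B t \- B s)%R @^-1` C) = P A * P ((B t \- B s)%R @^-1` C))%E].

(* y stands for X_s - B_s. MathComp sets 0 `^ a = 0 for a != 0, so for a1 < 0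
   the value at y = 0 is 0 and not -oo; the set of times at which X = B is
   Lebesgue-null almost surely, so this has no influence on solutions. *)
Definition drift (R : realType) (a1 a2 b1 b2 y : R) : R :=
  if y <= 0 then b1 * `|y| `^ a1 else b2 * `|y| `^ a2.

(* Weak solution X of dX_t/dt = drift (X_t - B_t), X_0 = 0, with explosion time
   zeta (+oo when there is no explosion); X t w is irrelevant for t >= zeta w.
   The first clause says that zeta is a stopping time (take C := setT) and that
   X is adapted on [0, zeta[. *)
Definition solution (d : measure_display) (T : measurableType d)
    (R : realType) (P : probability T R) (F : R -> set (set T))
    (B : R -> T -> R) (a1 a2 b1 b2 : R)
    (X : R -> T -> R) (zeta : T -> \bar R) : Prop :=
  [/\ forall (t : R) (C : set R), 0 <= t -> measurable C ->
        F t ([set w | (t%:E < zeta w)%E] `&` X t @^-1` C),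
      {ae P, forall w, (0 < zeta w)%E},
      {ae P, forall w, forall t : R, 0 <= t -> (t%:E < zeta w)%E ->
        lebesgue_measure.-integrable `[0, t]
          (fun s => (drift a1 a2 b1 b2 (X s w - B s w))%:E) /\
        X t w = \int[lebesgue_measure]_(s in `[0, t])
                  drift a1 a2 b1 b2 (X s w - B s w)} &
      {ae P, forall w, (zeta w < +oo)%E ->
        `|X t w| @[t --> (fine (zeta w))^'-] --> +oo}].

Definition negative_bifurcation (T : Type) (R : realType)
    (B X : R -> T -> R) (zeta : T -> \bar R) : set T :=
  [set w | exists t1 : R, [/\ 0 <= t1, (t1%:E < zeta w)%E &
    forall t : R, t1 < t -> (t%:E < zeta w)%E -> X t w < B t w]].

(* E belongs to the P-completion of the sigma-algebra and has probability p.
   Paths are only controlled almost surely, so E itself need not be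
   measurable. *)
Definition has_probability (d : measure_display) (T : measurableType d)
    (R : realType) (P : probability T R) (E : set T) (p : R) : Prop :=
  exists A : set T,
    [/\ measurable A, P.-negligible (A `+` E) & P A = p%:E].

Definition Gamma (R : realType) (x : R) : R :=
  \int[lebesgue_measure]_(t in `]0, +oo[) (t `^ (x - 1) * expR (- t)).

Definition lambda (R : realType) (sigma a b : R) : R :=
  (2 * `|b|) `^ ((a + 1)^-1) * (a + 1) `^ (a / (a + 1)) /
  (sigma `^ (2 / (a + 1)) * Gamma ((a + 1)^-1)).

(* Main.v *)
(* Put Y = X - B and k = sigma^2 / 2, and let S be the scale function: S 0 = 0 and S' = exp (- V / k),
   where V' is the drift. It is bounded, and the substitution in the Gamma integral identifies its limits
   at +oo and -oo with 1 / lambda_2 and - 1 / lambda_1. Morally S(Y) is a bounded martingale. As Y leaves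
   [-K, K] almost surely, optional stopping gives the probabilities of leaving above and below; applied on
   [1, +oo[ from a level K it also shows that Y comes back below 1 with a probability that vanishes as K
   tends to +oo, and symmetrically for the negative side. Hence the sign of Y is eventually constant, and
   negative with probability S(+oo) / (S(+oo) - S(-oo)).

   Ito's formula is replaced by a discretisation. For a bounded C^2 function f, the increments of f(Y)
   along a grid stopped at the first exit are compensated by Gaussian averages, which leaves a discrete
   martingale. The compensated sum converges path by path to the integral of f' drift + k f'' along Y when
   the mesh tends to 0, and it is bounded in L^2, so its expectation converges too. The scale function is
   not C^2 (the drift is discontinuous, or even unbounded, at 0); it is a limit of functions f whose
   generators tend to 0 pointwise with an integrable domination along the path. *)
Require Import Defs.
From mathcomp Require Import all_boot all_order all_algebra.
From mathcomp Require Import all_classical all_reals all_analysis.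
From mathcomp Require Import measurable_realfun ring lra.
Import Order.TTheory GRing.Theory Num.Theory.
Import numFieldNormedType.Exports.
Local Open Scope classical_set_scope.
Local Open Scope ring_scope.
Set Implicit Arguments.
Unset Strict Implicit.
Unset Printing Implicit Defensive.

(** * Calculus on the real line *)

(** Each grid step is split in two: B moves while X is frozen, then X moves while B is frozen. The
    Brownian half-step, compensated by its Gaussian average, is a martingale increment; the other
    one is f' times an integral of the drift, so the drift only has to be integrable along the path,
    which the notion of solution supplies.

    Conditioning is done by freezing: an increment of B is independent of the past, so the joint law
    is a product and Fubini's theorem applies.

    No strong Markov property is involved. Exits are observed on a grid, so an exit event splits
    into finitely many disjoint events, each known at a deterministic time, and the estimate of the
    return probability is applied to each of them separately.

    Explosion is harmless: |X| tends to infinity at a finite explosion time while B stays bounded,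
    so Y has left every bounded interval before, and a fine grid sees it while the path is alive.

    The order of the limits is fixed throughout: time horizon and interval, then the approximating
    function, then the mesh. How fine a mesh must be depends on the path, hence the passage through
    convergence in probability. *)

Section Calculus.
Context {R : realType}.
Implicit Types (f g : R -> R) (a b c x y z C d e : R).

Lemma is_derive_continuous f (df : R -> R) :
  (forall x, is_derive x 1 f (df x)) -> continuous f.
Proof.
move=> fdf x; apply: differentiable_continuous.
by apply/derivable1_diffP; have [] := fdf x.
Qed.

Lemma derivef_eq f g x a b : is_derive x 1 f a -> f =1 g -> a = b ->
  is_derive x 1 g b.
Proof. by move=> + /funext <- <-. Qed.

Lemma derivef_add f g x a b : is_derive x 1 f a -> is_derive x 1 g b ->
  is_derive x 1 (fun t => f t + g t) (a + b).
Proof. by move=> fa gb; exact: is_deriveD. Qed.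

Lemma derivef_sub f g x a b : is_derive x 1 f a -> is_derive x 1 g b ->
  is_derive x 1 (fun t => f t - g t) (a - b).
Proof. by move=> fa gb; exact: is_deriveB. Qed.

Lemma derivef_mul f g x a b : is_derive x 1 f a -> is_derive x 1 g b ->
  is_derive x 1 (fun t => f t * g t) (a * g x + f x * b).
Proof.
move=> fa gb; apply: is_derive_eq (is_deriveM fa gb) _.
by rewrite /GRing.scale /= addrC (mulrC (g x)).
Qed.

Lemma derivef_cst c x : is_derive x 1 (fun=> c) (0 : R).
Proof. exact: is_derive_cst. Qed.

Lemma derivef_id x : is_derive x 1 (fun t : R => t) 1.
Proof. exact: is_derive_id. Qed.

Lemma derivef_comp f g x a b : is_derive (g x) 1 f a -> is_derive x 1 g b ->
  is_derive x 1 (fun t => f (g t)) (a * b).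
Proof. by move=> fa gb; exact: is_derive1_comp. Qed.

Lemma derivef_inv f x a : f x != 0 -> is_derive x 1 f a ->
  is_derive x 1 (fun t => (f t)^-1) (- a / f x ^+ 2).
Proof.
move=> fx0 fa; apply: (derivef_eq (is_deriveV fx0 fa)) => //.
by rewrite /GRing.scale /= mulNr mulrC mulNr.
Qed.

(** The endpoints are unordered, so that increments of unknown sign can be fed to it directly; the
    case b < a follows by exchanging them. *)
Lemma mean_value f (df : R -> R) :
  (forall x, is_derive x 1 f (df x)) ->
  forall a b, exists2 c : R, Num.min a b <= c <= Num.max a b &
                f b - f a = df c * (b - a).
Proof.
move=> fdf a b; have cf : continuous f := is_derive_continuous fdf.
wlog ab : a b / a <= b => [hw|].
  have [ab|] := boolP (a <= b); first exact: hw.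
  rewrite -ltNge => /ltW ba.
  have [c cab fE] := hw _ _ ba; exists c; first by rewrite minC maxC.
  by rewrite -opprB fE; ring.
rewrite (min_idPl ab) (max_idPr ab).
have [c + ->] := @MVT_segment R f df a b ab (fun x _ => fdf x)
  (continuous_subspaceT cf).
by rewrite in_itv /= => cab; exists c.
Qed.

Lemma mean_value_le f (df : R -> R) C :
  (forall x, is_derive x 1 f (df x)) -> (forall x, `|df x| <= C) ->
  forall a b, `|f b - f a| <= C * `|b - a|.
Proof.
move=> fdf dC a b; have [c _ ->] := mean_value fdf a b.
by rewrite normrM ler_wpM2r.
Qed.

(** Two applications of the mean value theorem write the remainder as (f2 (y + d) - f2 y) c z with
    |d| <= |c| <= |z|. The modulus e + C (x - y)^2 is imposed at all x: it combines a small error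
    near y with a crude bound far away, and its Gaussian integral only involves the moments of
    orders 2 and 4. *)
Lemma taylor2_le f (f1 f2 : R -> R) y e C :
  (forall x, is_derive x 1 f (f1 x)) -> (forall x, is_derive x 1 f1 (f2 x)) ->
  0 <= C -> (forall x, `|f2 x - f2 y| <= e + C * (x - y) ^+ 2) ->
  forall z, `|f (y + z) - f y - f1 y * z - f2 y * z ^+ 2 / 2| <=
            (e + C * z ^+ 2) * z ^+ 2.
Proof.
move=> ff1 f12 C0 H z.
have shift (g dg : R -> R) : (forall x, is_derive x 1 g (dg x)) ->
    forall t : R, is_derive t 1 (fun s => g (y + s)) (dg (y + t)).
  move=> gdg t.
  have := derivef_comp (gdg (y + t)) (derivef_add (derivef_cst y t) (derivef_id t)).
  by rewrite add0r mulr1.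
pose phi (t : R) : R := f (y + t) - f y - f1 y * t - f2 y / 2 * (t * t).
have dphi (t : R) : is_derive t 1 phi (f1 (y + t) - f1 y - f2 y * t).
  have ddt (c : R) := derivef_mul (derivef_cst c t) (derivef_id t).
  have d2 := derivef_mul (derivef_cst (f2 y / 2) t)
               (derivef_mul (derivef_id t) (derivef_id t)).
  apply: (derivef_eq (derivef_sub (derivef_sub (derivef_sub (shift _ _ ff1 t)
    (derivef_cst (f y) t)) (ddt (f1 y))) d2)) => //; by field.
have [c cz E] := mean_value dphi 0 z.
have [d dc E'] := mean_value (shift _ _ f12) 0 c.
have phi0 : phi 0 = 0 by rewrite /phi addr0 subrr; ring.
rewrite phi0 !subr0 in E.
have -> : f (y + z) - f y - f1 y * z - f2 y * z ^+ 2 / 2 = phi z.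
  by rewrite /phi; ring.
rewrite E.
rewrite addr0 subr0 in E'.
have -> : f1 (y + c) - f1 y - f2 y * c = (f2 (y + d) - f2 y) * c by rewrite E'; ring.
have cz' : `|c| <= `|z|.
  move: cz; rewrite /Num.min /Num.max; case: ltP => zs /andP[c1 c2].
    by rewrite !ger0_norm //; lra.
  by rewrite !ler0_norm //; lra.
have dz' : `|d| <= `|z|.
  apply: le_trans cz'.
  move: dc; rewrite /Num.min /Num.max; case: ltP => zs /andP[c1 c2].
    by rewrite !ger0_norm //; lra.
  by rewrite !ler0_norm //; lra.
have d2 : d ^+ 2 <= z ^+ 2 by rewrite -(real_normK (num_real d)) -(real_normK (num_real z)) lerXn2r ?nnegrE.
have e0 : 0 <= e.
  by have := H y; rewrite !subrr normr0 expr0n mulr0 addr0.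
rewrite 2!normrM -mulrA; apply: ler_pM => //.
  by apply: le_trans (H _) _; rewrite lerD2l ler_wpM2l // (_ : y + d - y = d) //; ring.
by rewrite -(real_normK (num_real z)) expr2 ler_wpM2r.
Qed.

(** Heine-Cantor. The covering form of compactness makes a property that holds near each point for
    all small d hold on the whole segment for a single d. *)
Lemma uniform_continuity f a b : {within `[a, b], continuous f} ->
  forall e, 0 < e -> exists2 d : R, 0 < d &
  forall x y, a <= x <= b -> a <= y <= b -> `|x - y| < d -> `|f x - f y| < e.
Proof.
move=> cf e e0.
have : near_covering [set` `[a, b]] by apply/compact_near_coveringP; exact: segment_compact.
rewrite -near_covering_withinP => /(_ R (0^'+) (fun d x => forall y, a <= y <= b -> `|x - y| < d -> `|f x - f y| < e)) H.
have {H} : \forall d \near 0^'+, [set` `[a, b]] `<=`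
    (fun x => forall y, a <= y <= b -> `|x - y| < d -> `|f x - f y| < e).
  apply: H => x xab.
  have e20 : 0 < e / 2 by lra.
  have /subspace_continuousP /(_ x xab) /cvgrPdist_lt /(_ _ e20) := cf.
  rewrite /within /= => /nbhs_ballP [d /= d0 Hd].
  exists (ball x (d / 2), [set k | 0 < k < d / 2]).
    split => /=; first by apply/nbhs_ballP; exists (d / 2) => //=; lra.
    near=> k; apply/andP; split => //; near: k; apply: nbhs_right_lt; lra.
  move=> [x' k] /= [bx /andP[k0 kd]] x'ab y yab x'y.
  have xx' : `|f x - f x'| < e / 2.
    by apply: Hd => //; apply: le_ball bx; lra.
  have xy : `|f x - f y| < e / 2.
    apply: Hd; last by rewrite in_itv.
    rewrite /ball /= in bx *.
    have -> : x - y = (x - x') + (x' - y) by ring.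
    by apply: le_lt_trans (ler_normD _ _) _; lra.
  have -> : f x' - f y = - (f x - f x') + (f x - f y) by ring.
  by apply: le_lt_trans (ler_normD _ _) _; rewrite normrN; lra.
move=> nd; near (0 : R)^'+ => d; exists d.
  by near: d; exact: nbhs_right_gt.
move=> x y xab yab.
have : [set` `[a, b]] `<=` (fun x => forall y, a <= y <= b -> `|x - y| < d -> `|f x - f y| < e).
  by near: d.
by apply => //=; rewrite in_itv.
Unshelve. all: by end_near. Qed.

(** Near x, the signed integral from 0 differs by a constant from the integral from - M, to which
    the fundamental theorem applies because |x| < M. *)
Lemma antiderivative g : continuous g ->
  exists2 G : R -> R, G 0 = 0 & forall x, is_derive x 1 G (g x).
Proof.
move=> cg.
pose mu := @lebesgue_measure R.
pose G (y : R) : R := if 0 <= y then \int[mu]_(x in `]0, y]) g x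
                  else - \int[mu]_(x in `]y, 0]) g x.
have ig (a b : R) : mu.-integrable `[a, b] (EFin \o g).
  apply: continuous_compact_integrable; first exact: segment_compact.
  exact: continuous_subspaceT.
exists G; first by rewrite /G lexx set_itvoc0 Rintegral_set0.
move=> x.
pose M : R := `|x| + 1.
have M0 : 0 < - M -> False by rewrite /M; have := normr_ge0 x; lra.
have M1 : - M <= 0 by rewrite leNgt; apply/negP.
have GE (y : R) : `|y| < M -> G y = \int[mu]_(t in `[- M, y]) g t - \int[mu]_(t in `[- M, 0]) g t.
  rewrite ltr_norml => /andP[My yM]; rewrite /G; case: ifPn => [y0|].
    rewrite (@Rintegral_itvB _ _ (BLeft (- M)) (BRight y) 0) ?bnd_simp //.
  rewrite -ltNge => y0.
  rewrite -(@Rintegral_itvB _ _ (BLeft (- M)) (BRight 0) y) ?bnd_simp //.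
  - by rewrite opprB.
  - exact: ltW.
  - exact: ltW.
have xM : x < M by rewrite /M; have := ler_norm x; lra.
have Mx : - M < x by rewrite /M; have := ler_norm (- x); rewrite normrN; lra.
have [dI IE] := continuous_FTC1_closed xM (ig (- M) M) Mx (cg x).
have HI : is_derive x 1 (fun y : R => \int[mu]_(t in `[- M, y]) g t - \int[mu]_(t in `[- M, 0]) g t) (g x).
  set c := \int[mu]_(t in `[- M, 0]) g t.
  have HI0 : is_derive x 1 (fun y : R => \int[mu]_(t in `[- M, y]) g t) (g x).
    by split; [exact: dI | rewrite -derive1E; exact: IE].
  by apply: (derivef_eq (derivef_sub HI0 (derivef_cst c x))) => //; exact: subr0.
apply: near_eq_is_derive HI; near=> y; rewrite GE //.
have : ball x 1 y by near: y; exact: nbhsx_ballx.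
rewrite /ball /= /M => xy1; have -> : y = x - (x - y) by ring.
by apply: le_lt_trans (ler_normB _ _) _; lra.
Unshelve. all: by end_near. Qed.

Lemma integral_derive f (df : R -> R) a b : a < b -> continuous df ->
  (forall x, is_derive x 1 f (df x)) ->
  (\int[lebesgue_measure]_(x in `[a, b]) (df x)%:E = (f b - f a)%:E)%E.
Proof.
move=> ab cdf fdf; have cf := is_derive_continuous fdf.
rewrite (@continuous_FTC2 R df f a b) //.
- exact: continuous_subspaceT.
- split; first by move=> x _; have [] := fdf x.
    exact/cvg_at_right_filter/cf.
  exact/cvg_at_left_filter/cf.
- by move=> x _; rewrite derive1E; have [_ ->] := fdf x.
Qed.

Lemma compact_bounded_norm f a b : {within `[a, b], continuous f} ->
  exists2 C : R, 0 <= C & forall x, a <= x <= b -> `|f x| <= C.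
Proof.
move=> cf.
have := @continuous_compact _ _ f _ cf (@segment_compact R a b).
move=> /compact_bounded [C [Cr HC]].
exists (`|C| + 1); first by have := normr_ge0 C; lra.
move=> x xab; apply: (HC (`|C| + 1)); first by have := ler_norm C; lra.
by exists x => //=; rewrite in_itv.
Qed.
End Calculus.

(** * Gaussian moments and averages *)

Section GaussianMoments.
Context {R : realType}.
Variable s : R.
Hypothesis s0 : 0 < s.
Let mu := @lebesgue_measure R.
Let p (z : R) : R := normal_pdf 0 s z.
Implicit Types (z : R) (n : nat).

Let p_ge0 z : 0 <= p z. Proof. exact: normal_pdf_ge0. Qed.

Let sn0 : s != 0. Proof. by rewrite gt_eqF. Qed.

Let derive_p z : is_derive z 1 p (- (z / s ^+ 2) * p z).
Proof.
have E t : p t = normal_peak s * expR (- (t * t) * (s ^+ 2 *+ 2)^-1).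
  by rewrite /p normal_pdfE // /normal_fun subr0 expr2.
have d1 := derivef_mul (derivef_sub (derivef_cst 0 z) (derivef_mul (derivef_id z) (derivef_id z))) (derivef_cst (s ^+ 2 *+ 2)^-1 z).
have d2 := derivef_mul (derivef_cst (normal_peak s) z) (derivef_comp (is_derive_expR _) d1).
apply: (derivef_eq d2); first by move=> t; rewrite E sub0r.
rewrite E !sub0r; rewrite -mulr_natr; field; exact: sn0.
Qed.

Let continuous_p : continuous p.
Proof. exact: is_derive_continuous derive_p. Qed.

Let I n : set R := [set` `[- (n.+1%:R : R), n.+1%:R]].

Let mI n : measurable (I n). Proof. exact: measurable_itv. Qed.

Let J n (f : R -> R) : R := \int[mu]_(z in I n) f z.

Let ci n (f : R -> R) : continuous f -> mu.-integrable (I n) (EFin \o f).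
Proof.
move=> cf; apply: continuous_compact_integrable; first exact: segment_compact.
exact: continuous_subspaceT.
Qed.

Let JE n (f : R -> R) : continuous f -> (\int[mu]_(z in I n) (f z)%:E = (J n f)%:E)%E.
Proof.
move=> cf; rewrite /J /Rintegral fineK //.
by apply: integrable_fin_num; [exact: measurable_itv|exact: (ci n cf)].
Qed.

(** Monotone convergence over [-(n+1), n+1]. Gaussian moments are thus reduced to truncated
    integrals, which come from explicit antiderivatives and boundary terms. *)
Let cvgI (g : R -> R) : continuous g -> (forall z, 0 <= g z) ->
  ((J n g)%:E @[n --> \oo] --> \int[mu]_z (g z)%:E)%E.
Proof.
move=> cg g0.
have mg : measurable_fun setT g := continuous_measurable_fun cg.
have UI : [set: R] = \bigcup_n I n.
  apply/seteqP; split => // x _; exists (Num.truncn `|x|) => //=.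
  rewrite /I /= in_itv /= -ler_norml; apply/ltW.
  exact: truncnS_gt.
have : (\int[mu]_(z in I n) (g z)%:E @[n --> \oo] --> \int[mu]_z (g z)%:E)%E.
  rewrite UI; apply: ge0_nondecreasing_set_cvg_integral.
  - move=> m n mn; apply/subsetPset => x /=; rewrite /I /= !in_itv /= => /andP[h1 h2].
    have : (m.+1%:R : R) <= n.+1%:R by rewrite ler_nat.
    by move=> h; apply/andP; split; lra.
  - by move=> i; exact: measurable_itv.
  - move=> i; apply/measurable_EFinP; exact: measurable_funS mg.
  - by move=> i x _; rewrite lee_fin.
by under eq_fun do rewrite JE //.
Qed.

Let limJ (g : R -> R) (l : R) : continuous g -> (forall z, 0 <= g z) ->
  J n g @[n --> \oo] --> l -> (\int[mu]_z (g z)%:E = l%:E)%E.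
Proof.
move=> cg g0 Jl; have Jg := cvgI cg g0; apply: (cvg_unique _ Jg) => //.
by apply: cvg_EFin => //; exact: nearW.
Qed.

Let J_derive n (F f : R -> R) : (forall z, is_derive z 1 F (f z)) -> continuous f ->
  J n f = F n.+1%:R - F (- n.+1%:R).
Proof.
move=> Ff cf; rewrite /J /Rintegral (integral_derive _ cf Ff) //.
by rewrite ltrNl; apply: lt_trans (_ : 0 < _); rewrite ?oppr_lt0 ltr0n.
Qed.

Let cvgJp : J n p @[n --> \oo] --> (1 : R).
Proof.
have := cvgI continuous_p p_ge0.
rewrite (_ : (\int[mu]_z (p z)%:E = 1)%E); last exact: integral_normal_pdf.
by move/fine_cvgP => [].
Qed.

Let pN z : p (- z) = p z.
Proof. by rewrite /p normal_pdfE // /normal_fun !subr0 sqrrN. Qed.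

Let czn k : continuous (fun z => z ^+ k * p z).
Proof. by move=> z; apply: cvgM; [exact: exprn_continuous|exact: continuous_p]. Qed.

Let cczn c k : continuous (fun z => c * (z ^+ k * p z)).
Proof. by move=> z; apply: cvgM; [exact: cvg_cst|exact: czn]. Qed.

Let J0 n : J n (fun z => z ^+ 0 * p z) = J n p.
Proof. by congr (J n); apply/funext => z; rewrite mul1r. Qed.

Let JB n c k l : J n (fun z => z ^+ k * p z - c * (z ^+ l * p z)) =
  J n (fun z => z ^+ k * p z) - c * J n (fun z => z ^+ l * p z).
Proof.
rewrite /J RintegralB ?RintegralZl //.
- exact: mI.
- exact: (ci n (@czn l)).
- exact: mI.
- exact: (ci n (@czn k)).
- exact: (ci n (@cczn c l)).
Qed.

Let cB c k l : continuous (fun z => z ^+ k * p z - c * (z ^+ l * p z)).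
Proof. by move=> z; apply: cvgB; [exact: czn|exact: cczn]. Qed.

Let J1 n : J n (fun z => z ^+ 1 * p z) = 0.
Proof.
have dF z : is_derive z 1 (fun t => - s ^+ 2 * p t) (z ^+ 1 * p z).
  apply: (derivef_eq (derivef_mul (derivef_cst (- s ^+ 2) z) (derive_p z))) => //.
  by field; exact: sn0.
by rewrite (J_derive n dF (@czn 1)) pN subrr.
Qed.

Let J2 n : J n (fun z => z ^+ 2 * p z) =
  s ^+ 2 * J n p - 2 * s ^+ 2 * (n.+1%:R * p n.+1%:R).
Proof.
have dF z : is_derive z 1 (fun t => - s ^+ 2 * (t * p t)) (z ^+ 2 * p z - s ^+ 2 * (z ^+ 0 * p z)).
  apply: (derivef_eq (derivef_mul (derivef_cst (- s ^+ 2) z) (derivef_mul (derivef_id z) (derive_p z)))) => //.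
  by field; exact: sn0.
have := J_derive n dF (@cB _ _ _).
rewrite JB J0 pN => H; rewrite -(subrK (s ^+ 2 * J n p) (J n (fun z => z ^+ 2 * p z))) H.
by ring.
Qed.

Let J4 n : J n (fun z => z ^+ 4 * p z) <= 3 * s ^+ 2 * J n (fun z => z ^+ 2 * p z).
Proof.
have dF z : is_derive z 1 (fun t => - s ^+ 2 * (t * (t * t) * p t)) (z ^+ 4 * p z - 3 * s ^+ 2 * (z ^+ 2 * p z)).
  have did := derivef_id z.
  apply: (derivef_eq (derivef_mul (derivef_cst (- s ^+ 2) z) (derivef_mul (derivef_mul did (derivef_mul did did)) (derive_p z)))) => //.
  by field; exact: sn0.
have := J_derive n dF (@cB _ _ _).
rewrite JB pN -[X in X <= _](subrK (3 * s ^+ 2 * J n (fun z => z ^+ 2 * p z))) => ->.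
rewrite gerDr -subr_ge0.
set x : R := n.+1%:R.
have -> : 0 - (- s ^+ 2 * (x * (x * x) * p x) - - s ^+ 2 * (- x * (- x * - x) * p x)) = 2 * s ^+ 2 * (x ^+ 3 * p x) :> R by ring.
by rewrite !mulr_ge0 // ?exprn_ge0 // ltW.
Qed.

(** The inequality 1 + u <= expR u at u = x^2 / (2 s^2) bounds x p x by a constant over x. *)
Let cvg_np : n.+1%:R * p n.+1%:R @[n --> \oo] --> (0 : R).
Proof.
pose c : R := normal_peak s * (s ^+ 2 *+ 2).
apply: (@squeeze_cvgr _ _ _ _ (cst 0) (fun n => c * n.+1%:R^-1)).
- near=> n; apply/andP; split; first by rewrite mulr_ge0.
  set x : R := n.+1%:R.
  have x0 : 0 < x by rewrite ltr0n.
  have s2 : 0 < s ^+ 2 *+ 2 by rewrite pmulrn_lgt0 // exprn_gt0.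
  have ex : 0 < x ^+ 2 / (s ^+ 2 *+ 2) by rewrite divr_gt0 // exprn_gt0.
  rewrite /p normal_pdfE // /normal_fun subr0 mulNr expRN.
  rewrite mulrCA -[c / x]mulrA ler_wpM2l ?normal_peak_ge0 //.
  have := expR_ge1Dx (x ^+ 2 / (s ^+ 2 *+ 2)).
  set E := expR _ => hE; have E0 : 0 < E by rewrite expR_gt0.
  rewrite ler_pdivrMr // mulrAC ler_pdivlMr //.
  have hE' : x ^+ 2 / (s ^+ 2 *+ 2) <= E by lra.
  by move: hE'; rewrite ler_pdivrMr // expr2 (mulrC E).
- exact: cvg_cst.
- rewrite -(mulr0 c); apply: cvgM; first exact: cvg_cst.
  exact: cvg_harmonic.
Unshelve. all: by end_near. Qed.

Let cvgcM (c l : R) (u : nat -> R) : u n @[n --> \oo] --> l ->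
  c * u n @[n --> \oo] --> c * l.
Proof. by move=> ul; apply: cvgM; [exact: cvg_cst|exact: ul]. Qed.

Let cvgJ2 : J n (fun z => z ^+ 2 * p z) @[n --> \oo] --> s ^+ 2.
Proof.
have -> : (fun n => J n (fun z => z ^+ 2 * p z)) = (fun n => s ^+ 2 * J n p - 2 * s ^+ 2 * (n.+1%:R * p n.+1%:R)).
  by apply/funext => n; exact: J2.
have h := cvgB (@cvgcM (s ^+ 2) _ _ cvgJp) (@cvgcM (2 * s ^+ 2) _ _ cvg_np).
by rewrite mulr0 subr0 mulr1 in h; exact: h.
Qed.

Let ge0_integrable (g : R -> R) (l : R) : continuous g -> (forall z, 0 <= g z) ->
  (\int[mu]_z (g z)%:E <= l%:E)%E -> mu.-integrable setT (EFin \o g).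
Proof.
move=> cg g0 gl; apply/integrableP; split.
  by apply/measurable_EFinP; exact: continuous_measurable_fun.
under eq_integral do rewrite /= ger0_norm //.
by apply: le_lt_trans gl _; rewrite ltry.
Qed.

Let I2 : (\int[mu]_z (z ^+ 2 * p z)%:E = (s ^+ 2)%:E)%E.
Proof. by apply: limJ; [exact: (@czn 2)|move=> z; rewrite mulr_ge0 ?sqr_ge0|exact: cvgJ2]. Qed.

Lemma integrable_sqr_normal_pdf :
  mu.-integrable setT (EFin \o (fun z => z ^+ 2 * normal_pdf 0 s z)).
Proof.
apply: (@ge0_integrable _ (s ^+ 2)); [exact: czn| |by rewrite I2].
by move=> z; rewrite mulr_ge0 ?sqr_ge0.
Qed.

Lemma Rintegral_sqr_normal_pdf : \int[mu]_z (z ^+ 2 * normal_pdf 0 s z) = s ^+ 2.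
Proof. by rewrite /Rintegral I2. Qed.

Let I4 : (\int[mu]_z (z ^+ 4 * p z)%:E <= (3 * s ^+ 4)%:E)%E.
Proof.
have g0 z : 0 <= z ^+ 4 * p z by rewrite mulr_ge0 // exprn_even_ge0.
have c4 := cvgI (@czn 4) g0.
have : ((3 * s ^+ 2 * J n (fun z => z ^+ 2 * p z))%:E @[n --> \oo] --> (3 * s ^+ 2 * s ^+ 2)%:E)%E.
  apply: cvg_EFin; first exact: nearW.
  have h := @cvgcM (3 * s ^+ 2) _ _ cvgJ2.
  exact h.
rewrite -mulrA -exprD => c2.
by apply: (lee_cvg_to c4 c2); apply: nearW => n; rewrite lee_fin J4.
Qed.

Lemma integrable_exp4_normal_pdf :
  mu.-integrable setT (EFin \o (fun z => z ^+ 4 * normal_pdf 0 s z)).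
Proof.
apply: (@ge0_integrable _ (3 * s ^+ 4)); [exact: czn| |exact: I4].
by move=> z; rewrite mulr_ge0 // exprn_even_ge0.
Qed.

Lemma Rintegral_exp4_normal_pdf_le :
  \int[mu]_z (z ^+ 4 * normal_pdf 0 s z) <= 3 * s ^+ 4.
Proof.
have fin : (\int[mu]_z (z ^+ 4 * normal_pdf 0 s z)%:E)%E \is a fin_num.
  exact: (integrable_fin_num measurableT integrable_exp4_normal_pdf).
by have := I4; rewrite -(fineK fin) lee_fin.
Qed.

(** The function z p z changes sign, out of reach of monotone convergence; it is recovered as the
    difference of the nonnegative functions q = (1 + z + z^2) p and p + z^2 p. *)
Let q z := p z + z * p z + z ^+ 2 * p z.

Let q_ge0 z : 0 <= q z.
Proof.
have -> : q z = (1 + z + z ^+ 2) * p z by rewrite /q; ring.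
by apply: mulr_ge0 => //; nra.
Qed.

Let cq : continuous q.
Proof.
move=> z; apply: cvgD; last exact: czn.
by apply: cvgD; [exact: continuous_p|apply: (@czn 1)].
Qed.

Let Iq : (\int[mu]_z (q z)%:E = (1 + s ^+ 2)%:E)%E.
Proof.
apply: limJ => //.
have Jq n : J n q = J n p + J n (fun z => z ^+ 2 * p z).
  rewrite -[J n p]addr0 -(J1 n) /J /q !RintegralD //.
  - exact: mI.
  - exact: (ci n continuous_p).
  - exact: (ci n (@czn 1)).
  - exact: mI.
  - apply: (ci n (f := fun z => p z + z * p z)) => z; apply: cvgD; [exact: continuous_p|apply: (@czn 1)].
  - exact: (ci n (@czn 2)).
under eq_fun do rewrite Jq.
exact: (cvgD cvgJp cvgJ2).
Qed.

Let integrable_p : mu.-integrable setT (EFin \o p).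
Proof. exact: integrable_normal_pdf. Qed.

Let integrable_q : mu.-integrable setT (EFin \o q).
Proof. by apply: (@ge0_integrable _ (1 + s ^+ 2)) => //; rewrite Iq. Qed.

Let qE : (fun z => z * p z) = (fun z => q z - (p z + z ^+ 2 * p z)).
Proof. by apply/funext => z; rewrite /q; ring. Qed.

Let integrable_p2 : mu.-integrable setT (EFin \o (fun z => p z + z ^+ 2 * p z)).
Proof. exact: (@integrableD _ _ _ mu _ measurableT (EFin \o p) (EFin \o (fun z => z ^+ 2 * p z)) integrable_p integrable_sqr_normal_pdf). Qed.

Lemma integrable_id_normal_pdf :
  mu.-integrable setT (EFin \o (fun z => z * normal_pdf 0 s z)).
Proof.
rewrite -/p qE.
exact: (@integrableB _ _ _ mu _ measurableT (EFin \o q) (EFin \o (fun z => p z + z ^+ 2 * p z)) integrable_q integrable_p2).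
Qed.

Lemma Rintegral_id_normal_pdf : \int[mu]_z (z * normal_pdf 0 s z) = 0.
Proof.
rewrite -/p qE RintegralB // RintegralD //; last exact: integrable_sqr_normal_pdf.
rewrite Rintegral_sqr_normal_pdf /Rintegral Iq /p integral_normal_pdf /=.
by ring.
Qed.

End GaussianMoments.

Section RealIntegrable.
Context d (T : measurableType d) (R : realType).
Variables (mu : {measure set T -> \bar R}) (D : set T).
Hypothesis mD : measurable D.
Implicit Types f g : T -> R.

Lemma integrable_scale (c : R) f : mu.-integrable D (EFin \o f) ->
  mu.-integrable D (EFin \o (fun x => c * f x)).
Proof. by move=> fi; exact: (integrableZl mD c fi). Qed.

Lemma integrable_sub f g : mu.-integrable D (EFin \o f) ->
  mu.-integrable D (EFin \o g) -> mu.-integrable D (EFin \o (fun x => f x - g x)).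
Proof. by move=> fi gi; exact: (integrableB mD fi gi). Qed.

Lemma integrable_add f g : mu.-integrable D (EFin \o f) ->
  mu.-integrable D (EFin \o g) -> mu.-integrable D (EFin \o (fun x => f x + g x)).
Proof. by move=> fi gi; exact: (integrableD mD fi gi). Qed.

End RealIntegrable.

(** * Integrals against the Gaussian law *)

Section NormalIntegral.
Context {R : realType}.
Variable s : R.
Hypothesis s0 : 0 < s.
Notation mu := (@lebesgue_measure R).
Notation p := (normal_pdf 0 s).
Notation nu := (normal_prob 0 s).
Implicit Types (f g : R -> R) (y z C e : R).

Lemma integrable_bounded_normal_pdf f C : measurable_fun setT f ->
  (forall z, `|f z| <= C) -> mu.-integrable setT (EFin \o (fun z => f z * p z)).
Proof.
move=> mf fC.
have mp : measurable_fun setT p := measurable_normal_pdf 0 s.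
have ip := integrable_normal_pdf (0 : R) s.
have icp : mu.-integrable setT (EFin \o (fun z => C * p z)).
  exact: integrable_scale ip.
apply: (le_integrable measurableT _ _ icp).
  by apply/measurable_EFinP; exact: measurable_funM.
move=> z _ /=; rewrite lee_fin !normrM ler_wpM2r //.
by apply: le_trans (fC z) (ler_norm _).
Qed.

(** The Radon-Nikodym derivative of the normal law agrees almost everywhere with its explicit
    density, since both have the same integral over every measurable set. *)
Lemma Rintegral_normal_prob f C : measurable_fun setT f ->
  (forall z, `|f z| <= C) ->
  \int[nu]_z f z = \int[mu]_z (f z * p z).
Proof.
move=> mf fC; rewrite /Rintegral; congr fine.
have dom := normal_prob_dominates (0 : R) s.
have fi : nu.-integrable setT (EFin \o f).
  apply: measurable_bounded_integrable => //.
    by rewrite -ge0_fin_numE // fin_num_measure.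
  exists C; split; first exact: num_real.
  by move=> M CM z _ /=; apply: le_trans (fC z) (ltW CM).
rewrite -(Radon_Nikodym_change_of_variables dom measurableT fi).
apply: ae_eq_integral => //.
- apply: emeasurable_funM; first exact/measurable_EFinP.
  by apply: (measurable_int mu); apply: Radon_Nikodym_integrable.
- by apply/measurable_EFinP; apply: measurable_funM => //; exact: measurable_normal_pdf.
- rewrite [X in ae_eq _ _ _ X](_ : _ = (fun z => (f z)%:E * (p z)%:E)%E) //.
  apply: ae_eqe_mul2l => /=.
  rewrite (@Radon_NikodymE _ _ _ (charge_of_finite_measure nu) mu dom) /=.
  case: cid => /= h [h1 h2 h3].
  apply: integral_ae_eq => //=.
  + by apply/measurable_EFinP; exact: measurable_normal_pdf.
  + by move=> E E01 mE; rewrite -h3.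
Qed.

(** The Taylor expansion is integrated term by term: order 1 vanishes, order 2 gives s^2 f2 y / 2,
    and the remainder is bounded by the moments of orders 2 and 4. The argument is y - z because Y =
    X - B decreases when B increases. *)
Lemma heat_increment_le f (f1 f2 : R -> R) y e C C0 :
  (forall x : R, is_derive x 1 f (f1 x)) -> (forall x : R, is_derive x 1 f1 (f2 x)) ->
  (forall x, `|f x| <= C0) -> 0 <= C ->
  (forall x, `|f2 x - f2 y| <= e + C * (x - y) ^+ 2) ->
  `|\int[nu]_z f (y - z) - f y - s ^+ 2 * f2 y / 2| <= e * s ^+ 2 + C * (3 * s ^+ 4).
Proof.
move=> ff1 f12 fC0 C0' H.
have cf := is_derive_continuous ff1.
have mf : measurable_fun setT (fun z => f (y - z)).
  apply: measurableT_comp; first exact: continuous_measurable_fun.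
  exact: measurable_funB.
rewrite (Rintegral_normal_prob mf (fun z => fC0 _)).
have i0 := integrable_bounded_normal_pdf mf (fun z => fC0 _).
have ip : mu.-integrable setT (EFin \o p) := integrable_normal_pdf (0 : R) s.
have i1 := integrable_id_normal_pdf s0; have i2 := integrable_sqr_normal_pdf s0.
have i4 := integrable_exp4_normal_pdf s0.
have iZ c g : mu.-integrable setT (EFin \o g) -> mu.-integrable setT (EFin \o (fun z => c * g z)).
  by move=> ig; exact: integrable_scale ig.
have iB g h : mu.-integrable setT (EFin \o g) -> mu.-integrable setT (EFin \o h) -> mu.-integrable setT (EFin \o (fun z => g z - h z)).
  by move=> ig ih; exact: integrable_sub ig ih.
have iD g h : mu.-integrable setT (EFin \o g) -> mu.-integrable setT (EFin \o h) -> mu.-integrable setT (EFin \o (fun z => g z + h z)).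
  by move=> ig ih; exact: integrable_add ig ih.
pose r z := (f (y - z) * p z - f y * p z) - ((- f1 y) * (z * p z) + (f2 y / 2) * (z ^+ 2 * p z)).
have rE : \int[mu]_z (f (y - z) * p z) - f y - s ^+ 2 * f2 y / 2 = \int[mu]_z r z.
  rewrite /r RintegralB //; last 2 first.
  - exact: (iB _ _ i0 (iZ _ _ ip)).
  - exact: (iD _ _ (iZ _ _ i1) (iZ _ _ i2)).
  rewrite RintegralB //; last exact: iZ.
  rewrite RintegralD //; [|exact: iZ|exact: iZ].
  rewrite !RintegralZl // Rintegral_id_normal_pdf // Rintegral_sqr_normal_pdf //.
  have -> : \int[mu]_z p z = 1 by rewrite /Rintegral integral_normal_pdf.
  by ring.
have ir : mu.-integrable setT (EFin \o r).
  exact: (iB _ _ (iB _ _ i0 (iZ _ _ ip)) (iD _ _ (iZ _ _ i1) (iZ _ _ i2))).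
rewrite rE; apply: le_trans (le_normr_Rintegral measurableT ir) _.
have -> : e * s ^+ 2 + C * (3 * s ^+ 4) =
   \int[mu]_z (e * (z ^+ 2 * p z)) + C * (3 * s ^+ 4).
  by rewrite RintegralZl // Rintegral_sqr_normal_pdf.
apply: (@le_trans _ _ (\int[mu]_z (e * (z ^+ 2 * p z)) + \int[mu]_z (C * (z ^+ 4 * p z)))).
  rewrite -RintegralD //; [|exact: iZ|exact: iZ].
  apply: le_Rintegral => //.
  - exact: (@integrable_norm _ _ _ mu _ r ir).
  - exact: (iD _ _ (iZ _ _ i2) (iZ _ _ i4)).
  - move=> z _ /=.
    have := taylor2_le ff1 f12 C0' H (- z); rewrite sqrrN => T.
    have -> : r z = (f (y - z) - f y - f1 y * - z - f2 y * z ^+ 2 / 2) * p z.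
      by rewrite /r; ring.
    have p0 : 0 <= p z := normal_pdf_ge0 0 s z.
    rewrite normrM (ger0_norm p0).
    have -> : e * (z ^+ 2 * p z) + C * (z ^+ 4 * p z) = (e + C * z ^+ 2) * z ^+ 2 * p z.
      by ring.
    exact: ler_wpM2r.
rewrite lerD2l RintegralZl //.
by apply: ler_wpM2l => //; exact: Rintegral_exp4_normal_pdf_le.
Qed.

Lemma sqr_increment_le f (f1 : R -> R) y C0 C1 :
  (forall x : R, is_derive x 1 f (f1 x)) -> (forall x, `|f x| <= C0) ->
  (forall x, `|f1 x| <= C1) ->
  \int[nu]_z (f (y - z) - f y) ^+ 2 <= C1 ^+ 2 * s ^+ 2.
Proof.
move=> ff1 fC0 fC1.
have cf := is_derive_continuous ff1.
have mf : measurable_fun setT (fun z => (f (y - z) - f y) ^+ 2).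
  apply: measurable_funX; apply: measurable_funB => //.
  apply: measurableT_comp; first exact: continuous_measurable_fun.
  exact: measurable_funB.
have bf z : `|(f (y - z) - f y) ^+ 2| <= (C0 + C0) ^+ 2.
  rewrite ger0_norm ?sqr_ge0 // -(real_normK (num_real _)).
  rewrite lerXn2r ?nnegrE //; first by apply: addr_ge0; apply: le_trans (fC0 0).
  by apply: le_trans (ler_normB _ _) _; exact: lerD.
rewrite (Rintegral_normal_prob mf bf).
have i2 := integrable_sqr_normal_pdf s0.
rewrite -(Rintegral_sqr_normal_pdf s0) -RintegralZl //.
apply: le_Rintegral => //.
- exact: integrable_bounded_normal_pdf mf bf.
- exact: integrable_scale i2.
- move=> z _; rewrite mulrA ler_wpM2r ?normal_pdf_ge0 //.
  have := mean_value_le ff1 fC1 y (y - z).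
  rewrite (_ : y - z - y = - z); last by ring.
  rewrite normrN => H.
  rewrite -(real_normK (num_real (f (y - z) - f y))) -(real_normK (num_real z)) -exprMn.
  rewrite lerXn2r ?nnegrE //.
  by apply: le_trans H.
Qed.

End NormalIntegral.

(** * A discrete martingale *)

Lemma prob_bounded_integrable d (T : measurableType d) (R : realType)
    (P : probability T R) (f : T -> R) (C : R) :
  measurable_fun setT f -> (forall x, `|f x| <= C) ->
  P.-integrable setT (EFin \o f).
Proof.
move=> mf fC; apply: measurable_bounded_integrable => //.
  by rewrite -ge0_fin_numE // fin_num_measure.
exists C; split; first exact: num_real.
by move=> M CM z _ /=; apply: le_trans (fC z) (ltW CM).
Qed.

Lemma prob_Rintegral_cst d (T : measurableType d) (R : realType)
    (P : probability T R) (c : R) : \int[P]_w c = c.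
Proof.
rewrite (_ : (fun=> c) = cst c) // Rintegral_cst //.
by rewrite [X in fine X](_ : _ = 1%E) ?mulr1 //; exact: probability_setT.
Qed.

Lemma integrable_indic_prob d (T : measurableType d) (R : realType)
    (P : probability T R) (A : set T) :
  measurable A -> P.-integrable setT (EFin \o (\1_A : T -> R)).
Proof.
move=> mA; apply: (@prob_bounded_integrable _ _ _ P _ 1) => // w.
by rewrite indicE; case: (_ \in _); rewrite ?normr1 ?normr0.
Qed.

(** * Independence and freezing of the past *)

Section Freezing.
Context d (T : measurableType d) (R : realType).
Variables (P : probability T R) (G : set (set T)).
Hypothesis sigmaG : sigma_algebra [set: T] G.
Hypothesis subG : G `<=` measurable.
(** A copy of T whose measurable sets are those of G: G-measurability becomes plain measurability,
    and product spaces and Fubini's theorem apply. *)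
Let TG := g_sigma_algebraType G.

Lemma measurable_subalgebraE (A : set TG) : measurable A = G A.
Proof. by rewrite /measurable /= sigma_algebra_id. Qed.

Lemma measurable_id_subalgebra : measurable_fun [set: T] (id : T -> TG).
Proof.
by move=> _ A mA; rewrite setTI preimage_id; apply: subG; rewrite -measurable_subalgebraE.
Qed.

Lemma measurable_fun_subalgebra d' (U : measurableType d') (f : T -> U) :
  measurable_fun [set: TG] (f : TG -> U) -> measurable_fun [set: T] f.
Proof. by move=> mf; exact: measurableT_comp mf measurable_id_subalgebra. Qed.

Variables (Delta : T -> R) (N : probability (measurableTypeR R) R).
Hypothesis mDelta : measurable_fun [set: T] Delta.
Hypothesis indep : forall A C, G A -> measurable C ->
  (P (A `&` Delta @^-1` C) = P A * N C)%E.

Let mpair : measurable_fun [set: T] (fun w => ((w : TG), (Delta w : measurableTypeR R))).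
Proof. exact: measurable_fun_pair measurable_id_subalgebra mDelta. Qed.

Let X1 : {mfun T >-> TG} :=
  MeasurableFun.Pack (MeasurableFun.Class (isMeasurableFun.Build _ _ _ _ _ measurable_id_subalgebra)).

Lemma measurable_freezing (phi : TG * R -> R) (C : R) :
  measurable_fun [set: TG * measurableTypeR R] phi -> (forall x, `|phi x| <= C) ->
  measurable_fun [set: TG] (fun w => \int[N]_z phi (w, z)).
Proof.
move=> mphi phiC.
have iphi : (distribution P X1 \x N)%E.-integrable setT (EFin \o phi).
  exact: (@prob_bounded_integrable _ _ R (distribution P X1 \x N)%E _ C).
have inner (w : TG) : (\int[N]_z (phi (w, z))%:E)%E = (\int[N]_z phi (w, z))%:E.
  rewrite /Rintegral fineK //; apply: integrable_fin_num => //.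
  apply: (@prob_bounded_integrable _ _ R N (fun z => phi (w, z)) C) => //.
  exact: (measurableT_comp mphi (pair1_measurable w)).
have /integrableP[mF _] := integrable_fubini_F iphi.
by apply/measurable_EFinP; rewrite (_ : EFin \o _ = fun w => (\int[N]_z (phi (w, z))%:E)%E) //; apply/funext => w /=; rewrite inner.
Qed.

(** By independence the law of the pair (w, Delta w) on TG * R agrees on rectangles, hence
    everywhere, with the product of P restricted to G and N; Fubini's theorem then integrates Delta
    out with w fixed. This stands in for a conditional expectation given G. *)
Lemma freezing (phi : TG * R -> R) (C : R) :
  measurable_fun [set: TG * measurableTypeR R] phi -> (forall x, `|phi x| <= C) ->
  \int[P]_w phi (w, Delta w) = \int[P]_w \int[N]_z phi (w, z).
Proof.
move=> mphi phiC.
pose X2 : {mfun T >-> (TG * measurableTypeR R)%type} :=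
  MeasurableFun.Pack (MeasurableFun.Class (isMeasurableFun.Build _ _ _ _ _ mpair)).
have E (X : set (TG * measurableTypeR R)) : measurable X ->
    (distribution P X1 \x N)%E X = distribution P X2 X.
  apply: product_measure_unique => A B mA mB.
  rewrite /distribution /pushforward /= -indep //; last by rewrite -measurable_subalgebraE.
have iphi : (distribution P X1 \x N)%E.-integrable setT (EFin \o phi).
  exact: (@prob_bounded_integrable _ _ R (distribution P X1 \x N)%E _ C).
rewrite /Rintegral; congr fine.
transitivity (\int[distribution P X2]_x (phi x)%:E)%E.
  rewrite integral_pushforward //; first exact/measurable_EFinP.
  apply: (@prob_bounded_integrable _ _ _ P (phi \o X2) C) => [|x]; last exact: phiC.
  exact: measurableT_comp mphi mpair.
transitivity (\int[(distribution P X1 \x N)%E]_x (phi x)%:E)%E.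
  apply: eq_measure_integral => A mA _; exact: esym (E A mA).
rewrite -(integral12_prod_meas1 iphi) /fubini_F.
have inner (w : TG) : (\int[N]_z (phi (w, z))%:E)%E = (\int[N]_z phi (w, z))%:E.
  rewrite /Rintegral fineK //; apply: integrable_fin_num => //.
  apply: (@prob_bounded_integrable _ _ R N (fun z => phi (w, z)) C) => //.
  exact: (measurableT_comp mphi (pair1_measurable w)).
rewrite integral_pushforward //.
- by apply: eq_integral => w _ /=; exact: inner.
- by have /integrableP[] := integrable_fubini_F iphi.
- have /integrableP[mF FF] := integrable_fubini_F iphi.
  apply/integrableP; split; first exact: (measurableT_comp mF measurable_id_subalgebra).
  apply: le_lt_trans FF; rewrite ge0_integral_pushforward //.
  exact: measurableT_comp.
Qed.

End Freezing.

(** * Averages over one Gaussian step *)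

Section NormalAverage.
Context {R : realType}.
Variables (s : R) (f f1 : R -> R) (C0 C1 : R).
Hypothesis s0 : 0 < s.
Hypothesis ff1 : forall x : R, is_derive x 1 f (f1 x).
Hypothesis fC0 : forall x, `|f x| <= C0.
Hypothesis fC1 : forall x, `|f1 x| <= C1.
Notation nu := (normal_prob 0 s).

(** The heat semigroup applied to f: the conditional mean of f (Y) after a Brownian move of standard
    deviation s with X held fixed. *)
Definition normal_average (y : R) : R := \int[nu]_z f (y - z).

Let mf (y : R) : measurable_fun setT (fun z : R => f (y - z)).
Proof.
apply: measurableT_comp; last exact: measurable_funB.
exact: continuous_measurable_fun (is_derive_continuous ff1).
Qed.

Let nf (y : R) : nu.-integrable setT (EFin \o (fun z => f (y - z))).
Proof. by apply: (@prob_bounded_integrable _ _ R nu _ C0) => //; exact: mf. Qed.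

Let nc (c : R) : nu.-integrable setT (EFin \o (fun=> c)).
Proof. by apply: (@prob_bounded_integrable _ _ R nu _ `|c|). Qed.

Let Ec (c : R) : \int[nu]_z c = c.
Proof. exact: (prob_Rintegral_cst nu c). Qed.

Lemma normal_average_le y : `|normal_average y| <= C0.
Proof.
apply: le_trans (le_normr_Rintegral measurableT (nf y)) _.
rewrite -[X in _ <= X]Ec; apply: le_Rintegral => //.
by apply: (@prob_bounded_integrable _ _ R nu _ C0) => [|z]; [exact: measurableT_comp (mf y)|rewrite normr_id].
Qed.

Lemma normal_average_lipschitz y y' :
  `|normal_average y - normal_average y'| <= C1 * `|y - y'|.
Proof.
rewrite /normal_average -RintegralB //.
have i := integrable_sub measurableT (nf y) (nf y').
apply: le_trans (le_normr_Rintegral measurableT i) _.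
rewrite -[X in _ <= X]Ec; apply: le_Rintegral => //.
  exact: (integrable_norm i).
move=> z _; have := mean_value_le ff1 fC1 (y' - z) (y - z).
by rewrite (_ : y - z - (y' - z) = y - y'); last ring.
Qed.

Lemma measurable_normal_average : measurable_fun setT normal_average.
Proof.
apply: continuous_measurable_fun => x; apply/cvgrPdist_lt => e e0.
have C10 : 0 <= C1 by apply: le_trans (fC1 0).
near=> y; apply: le_lt_trans (normal_average_lipschitz _ _) _.
have : `|x - y| < e / (C1 + 1).
  near: y; apply: (@nbhsx_ballx R R^o); rewrite divr_gt0 //; lra.
rewrite ltr_pdivlMr; last by lra.
by have := normr_ge0 (x - y); nra.
Unshelve. all: by end_near. Qed.

(** A variance is at most the second moment about any point, here about f y, where the Lipschitz
    bound applies. *)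
Lemma normal_variance_le y :
  \int[nu]_z (f (y - z) - normal_average y) ^+ 2 <= C1 ^+ 2 * s ^+ 2.
Proof.
apply: le_trans (sqr_increment_le s0 y ff1 fC0 fC1).
set Qy := normal_average y.
have msq (c : R) : nu.-integrable setT (EFin \o (fun z => (f (y - z) - c) ^+ 2)).
  apply: (@prob_bounded_integrable _ _ R nu _ ((C0 + `|c|) ^+ 2)).
    by apply: measurable_funX; apply: measurable_funB => //; exact: mf.
  move=> z; rewrite normrX lerXn2r ?nnegrE //.
    by rewrite addr_ge0 //; apply: le_trans (fC0 0).
  by apply: le_trans (ler_normB _ _) _; rewrite lerD2r.
have -> : (fun z => (f (y - z) - Qy) ^+ 2) = (fun z => ((f (y - z) - f y) ^+ 2 -
     2 * (Qy - f y) * f (y - z)) + (Qy ^+ 2 - f y ^+ 2)).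
  by apply/funext => z; ring.
have i1 := integrable_scale measurableT (2 * (Qy - f y)) (nf y).
rewrite RintegralD //; last exact: (integrable_sub measurableT (msq _) i1).
rewrite RintegralB // RintegralZl // Ec -/(normal_average y) -/Qy.
by have := sqr_ge0 (Qy - f y); nra.
Qed.

End NormalAverage.

(** * The martingale of compensated Brownian steps *)

Section Martingale.
Context d (T : measurableType d) (R : realType).
Variables (P : probability T R) (G : nat -> set (set T)).
Hypothesis sigmaG : forall k, sigma_algebra [set: T] (G k).
Hypothesis subG : forall k, G k `<=` measurable.
Hypothesis monoG : forall k, G k `<=` G k.+1.
Local Notation TG k := (g_sigma_algebraType (G k)).
Variables (a y Delta : nat -> T -> R).
Hypothesis ma : forall k, measurable_fun [set: TG k] (a k).
Hypothesis a01 : forall k w, 0 <= a k w <= 1.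
Hypothesis my : forall k, measurable_fun [set: TG k] (y k).
Hypothesis mDelta : forall k, measurable_fun [set: TG k.+1] (Delta k).
Variables (s : R) (f f1 : R -> R) (C0 C1 : R).
Hypothesis s0 : 0 < s.
Hypothesis indep : forall k A C, G k A -> measurable C ->
  (P (A `&` Delta k @^-1` C) = P A * normal_prob 0 s C)%E.
Hypothesis ff1 : forall x : R, is_derive x 1 f (f1 x).
Hypothesis fC0 : forall x, `|f x| <= C0.
Hypothesis fC1 : forall x, `|f1 x| <= C1.

Let Q := normal_average s f.
(** Since y k is known before the step and Delta k is the independent Gaussian move of the step,
    this has conditional mean 0. The weights a k are later the indicators of not having left the
    interval, which turns the sum into a stopped martingale. *)
Definition increment k w := f (y k w - Delta k w) - Q (y k w).
Definition martingale n w := \sum_(k < n) a k w * increment k w.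

Let mT k d' (U : measurableType d') (g : T -> U) :
  measurable_fun [set: TG k] g -> measurable_fun [set: T] g.
Proof. exact: measurable_fun_subalgebra (sigmaG k) (@subG k) _ _ g. Qed.

Let mf : measurable_fun setT f.
Proof. exact: continuous_measurable_fun (is_derive_continuous ff1). Qed.

Let mQ : measurable_fun setT Q.
Proof. exact: measurable_normal_average ff1 fC0 fC1. Qed.

Let mono k d' (U : measurableType d') (g : T -> U) :
  measurable_fun [set: TG k] g -> measurable_fun [set: TG k.+1] g.
Proof.
move=> mg _ A mA; rewrite setTI measurable_subalgebraE //; apply: monoG.
by rewrite -(measurable_subalgebraE (sigmaG k)) -[X in measurable X]setTI; exact: mg.
Qed.

Notation nu := (normal_prob 0 s).

Let mfz (v : R) : measurable_fun setT (fun z : R => f (v - z)).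
Proof. by apply: measurableT_comp => //; exact: measurable_funB. Qed.

Let nf (v : R) : nu.-integrable setT (EFin \o (fun z => f (v - z))).
Proof. by apply: (@prob_bounded_integrable _ _ R nu _ C0) => //; exact: mfz. Qed.

Let nc (c : R) : nu.-integrable setT (EFin \o (fun=> c)).
Proof. by apply: (@prob_bounded_integrable _ _ R nu _ `|c|). Qed.

Let nsub (v c : R) : nu.-integrable setT (EFin \o (fun z => f (v - z) - c)).
Proof. exact: (integrable_sub measurableT (nf v) (nc c)). Qed.

Lemma measurable_increment k : measurable_fun [set: TG k.+1] (increment k).
Proof.
apply: measurable_funB; apply: measurableT_comp => //; last exact: mono.
by apply: measurable_funB => //; exact: mono.
Qed.

Lemma measurable_martingale n : measurable_fun [set: TG n] (martingale n).
Proof.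
elim: n => [|n IH].
  by rewrite (_ : martingale 0 = cst 0) //; apply/funext => w; rewrite /martingale big_ord0.
rewrite (_ : martingale n.+1 = fun w => martingale n w + a n w * increment n w).
  apply: measurable_funD; first exact: mono.
  by apply: measurable_funM; [exact: mono|exact: measurable_increment].
by apply/funext => w; rewrite /martingale big_ord_recr.
Qed.

Let C0_ge0 : 0 <= C0. Proof. by apply: le_trans (fC0 0). Qed.

Lemma increment_le k w : `|increment k w| <= 2 * C0.
Proof.
apply: le_trans (ler_normB _ _) _; rewrite mulr2n mulrDl !mul1r.
by apply: lerD => //; exact: normal_average_le.
Qed.

Let a_norm k w : `|a k w| <= 1.
Proof. by have /andP[h1 h2] := a01 k w; rewrite ger0_norm. Qed.

Lemma martingale_le n w : `|martingale n w| <= n%:R * (2 * C0).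
Proof.
apply: le_trans (ler_norm_sum _ _ _) _.
rewrite -[n in X in _ <= X]card_ord mulr_natl -sumr_const; apply: ler_sum => k _.
by rewrite normrM -[X in _ <= X]mul1r ler_pM //; exact: increment_le.
Qed.

(** Once y and xi are frozen, the integral over the Gaussian step of f (y - z) - Q y is 0 by the
    choice of Q. *)
Lemma increment_orthogonal k (xi : T -> R) C :
  measurable_fun [set: TG k] xi -> (forall w, `|xi w| <= C) ->
  \int[P]_w (xi w * increment k w) = 0.
Proof.
move=> mxi xiC.
pose phi (x : TG k * R) : R := xi x.1 * (f (y k x.1 - x.2) - Q (y k x.1)).
have mphi : measurable_fun [set: TG k * measurableTypeR R] phi.
  have m1 := measurableT_comp (@my k) (@measurable_fst _ _ (TG k) (measurableTypeR R)).
  have m2 := measurableT_comp mxi (@measurable_fst _ _ (TG k) (measurableTypeR R)).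
  apply: measurable_funM; first exact: m2.
  apply: measurable_funB; last exact: measurableT_comp mQ m1.
  apply: (measurableT_comp mf); apply: measurable_funB; first exact: m1.
  exact: (@measurable_snd _ _ (TG k) (measurableTypeR R)).
have phiC x : `|phi x| <= C * (2 * C0).
  rewrite normrM ler_pM // mulr2n mulrDl !mul1r.
  apply: le_trans (ler_normB _ _) _.
  by apply: lerD => //; exact: normal_average_le.
rewrite (freezing (sigmaG k) (@subG k) (mT (@mDelta k)) (@indep k) mphi phiC).
rewrite (_ : (fun w => _) = (fun=> 0)); last first.
  apply/funext => w.
  transitivity (xi w * \int[nu]_z (f (y k w - z) - Q (y k w))).
    exact: (@RintegralZl _ _ _ nu setT (fun z => f (y k w - z) - Q (y k w)) (xi w) measurableT (nsub _ _)).
  rewrite (RintegralB measurableT (nf _) (nc _)) (prob_Rintegral_cst nu).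
  by rewrite subrr mulr0.
exact: prob_Rintegral_cst.
Qed.

Lemma increment_variance k : \int[P]_w (a k w * increment k w ^+ 2) <= C1 ^+ 2 * s ^+ 2.
Proof.
pose phi (x : TG k * R) : R := a k x.1 * (f (y k x.1 - x.2) - Q (y k x.1)) ^+ 2.
have m1 := measurableT_comp (@my k) (@measurable_fst _ _ (TG k) (measurableTypeR R)).
have m2 := measurableT_comp (@ma k) (@measurable_fst _ _ (TG k) (measurableTypeR R)).
have mphi : measurable_fun [set: TG k * measurableTypeR R] phi.
  apply: measurable_funM; first exact: m2.
  apply: measurable_funX; apply: measurable_funB; last exact: measurableT_comp mQ m1.
  apply: (measurableT_comp mf); apply: measurable_funB; first exact: m1.
  exact: (@measurable_snd _ _ (TG k) (measurableTypeR R)).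
have b2 (v z : R) : `|(f (v - z) - Q v) ^+ 2| <= (2 * C0) ^+ 2.
  rewrite normrX lerXn2r ?nnegrE // ?mulr_ge0 //.
  rewrite mulr2n mulrDl !mul1r; apply: le_trans (ler_normB _ _) _.
  by apply: lerD => //; exact: normal_average_le.
have phiC x : `|phi x| <= 1 * (2 * C0) ^+ 2.
  by rewrite normrM ler_pM.
rewrite (freezing (sigmaG k) (@subG k) (mT (@mDelta k)) (@indep k) mphi phiC).
have nsq v : nu.-integrable setT (EFin \o (fun z => (f (v - z) - Q v) ^+ 2)).
  apply: (@prob_bounded_integrable _ _ R nu _ ((2 * C0) ^+ 2)) => [|z]; last exact: b2.
  by apply: measurable_funX; apply: measurable_funB => //; exact: mfz.
have PhiE w : \int[nu]_z phi (w, z) = a k w * \int[nu]_z (f (y k w - z) - Q (y k w)) ^+ 2.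
  exact: (@RintegralZl _ _ _ nu setT (fun z => (f (y k w - z) - Q (y k w)) ^+ 2) (a k w) measurableT (nsq _)).
have vb w : 0 <= \int[nu]_z phi (w, z) <= C1 ^+ 2 * s ^+ 2.
  have /andP[h1 h2] := a01 k w.
  have v0 : 0 <= \int[nu]_z (f (y k w - z) - Q (y k w)) ^+ 2.
    by apply: Rintegral_ge0 => z _; exact: sqr_ge0.
  have v1 := normal_variance_le s0 ff1 fC0 fC1 (y k w).
  rewrite PhiE mulr_ge0 //=; apply: le_trans v1.
  by rewrite -[X in _ <= X]mul1r ler_wpM2r.
rewrite -[X in _ <= X](prob_Rintegral_cst P); apply: le_Rintegral => //.
- apply: (@prob_bounded_integrable _ _ _ P _ (C1 ^+ 2 * s ^+ 2)).
    have := measurable_freezing P (sigmaG k) (@subG k) nu mphi phiC; exact: mT.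
  by move=> w; have /andP[h1 h2] := vb w; rewrite ger0_norm.
- by apply: (@prob_bounded_integrable _ _ _ P _ `|C1 ^+ 2 * s ^+ 2|).
- by move=> w _; have /andP[] := vb w.
Qed.

Let mM n : measurable_fun [set: T] (martingale n).
Proof. exact: mT (@measurable_martingale n). Qed.

Let mI k : measurable_fun [set: T] (increment k).
Proof. exact: mT (@measurable_increment k). Qed.

Let ma' k : measurable_fun [set: T] (a k).
Proof. exact: mT (@ma k). Qed.

Let iMn n : P.-integrable setT (EFin \o martingale n).
Proof. exact: (@prob_bounded_integrable _ _ _ P _ (n%:R * (2 * C0)) (@mM n) (martingale_le n)). Qed.

Let ab k w : `|a k w * increment k w| <= 2 * C0.
Proof. by rewrite normrM -[X in _ <= X]mul1r ler_pM //; exact: increment_le. Qed.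

Let mab k : measurable_fun setT (fun w => a k w * increment k w).
Proof. by apply: measurable_funM; [exact: ma'|exact: mI]. Qed.

Let martingaleS n w : martingale n.+1 w = martingale n w + a n w * increment n w.
Proof. by rewrite /martingale big_ord_recr. Qed.

Lemma martingale_mean n : \int[P]_w martingale n w = 0.
Proof.
elim: n => [|n IH].
  rewrite (_ : martingale 0 = fun=> 0); first exact: prob_Rintegral_cst.
  by apply/funext => w; rewrite /martingale big_ord0.
under eq_Rintegral do rewrite martingaleS.
rewrite RintegralD //; last exact: (@prob_bounded_integrable _ _ _ P _ _ (@mab n) (ab n)).
by rewrite IH (increment_orthogonal (@ma n) (a_norm n)) addr0.
Qed.

(** When the square is expanded, the cross term vanishes by orthogonality to the product of
    [martingale n] and [a n], and a^2 <= a leaves one variance per step. As s^2 is proportional to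
    the mesh in the application, the bound depends on the total time only. *)
Lemma martingale_variance n :
  \int[P]_w (martingale n w ^+ 2) <= n%:R * (C1 ^+ 2 * s ^+ 2).
Proof.
elim: n => [|n IH].
  rewrite mul0r (_ : (fun w => martingale 0 w ^+ 2) = fun=> 0); first by rewrite prob_Rintegral_cst.
  by apply/funext => w; rewrite /martingale big_ord0 expr0n.
have -> : (fun w => martingale n.+1 w ^+ 2) = (fun w => (martingale n w ^+ 2 +
    2 * ((martingale n w * a n w) * increment n w)) + a n w * (a n w * increment n w ^+ 2)).
  by apply/funext => w; rewrite martingaleS; ring.
have b0 w : `|martingale n w ^+ 2| <= (n%:R * (2 * C0)) ^+ 2.
  by rewrite normrX lerXn2r ?nnegrE ?mulr_ge0 //; exact: martingale_le.
have i0 : P.-integrable setT (EFin \o (fun w => martingale n w ^+ 2)).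
  by apply: prob_bounded_integrable b0; exact: measurable_funX.
have mma : measurable_fun setT (fun w => martingale n w * a n w) by apply: measurable_funM.
have b1 w : `|martingale n w * a n w| <= n%:R * (2 * C0) * 1.
  by rewrite normrM ler_pM //; exact: martingale_le.
have i1 : P.-integrable setT (EFin \o (fun w => martingale n w * a n w * increment n w)).
  apply: (@prob_bounded_integrable _ _ _ P _ (n%:R * (2 * C0) * 1 * (2 * C0))); first exact: measurable_funM.
  by move=> w; rewrite normrM ler_pM //; exact: increment_le.
have i2 := integrable_scale measurableT 2 i1.
have b3 w : `|a n w * increment n w ^+ 2| <= 1 * (2 * C0) ^+ 2.
  rewrite normrM ler_pM // normrX lerXn2r ?nnegrE ?mulr_ge0 //; exact: increment_le.
have m3 : measurable_fun setT (fun w => a n w * increment n w ^+ 2).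
  by apply: measurable_funM => //; exact: measurable_funX.
have i3 := prob_bounded_integrable P m3 b3.
have i4 : P.-integrable setT (EFin \o (fun w => a n w * (a n w * increment n w ^+ 2))).
  apply: (@prob_bounded_integrable _ _ _ P _ (1 * (1 * (2 * C0) ^+ 2))); first exact: measurable_funM.
  by move=> w; rewrite normrM ler_pM.
rewrite RintegralD //; last exact: integrable_add.
rewrite RintegralD // RintegralZl //.
rewrite (increment_orthogonal (xi := fun w => martingale n w * a n w) _ b1); last first.
  by apply: measurable_funM; [exact: measurable_martingale|exact: ma].
rewrite mulr0 addr0 -natr1 mulrDl mul1r; apply: lerD => //.
apply: le_trans (increment_variance n); apply: le_Rintegral => // w _.
have /andP[h1 h2] := a01 n w.
by rewrite -[X in _ <= X]mul1r ler_wpM2r // mulr_ge0 ?sqr_ge0.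
Qed.

End Martingale.

(** * Pathwise Riemann sums *)

Lemma itv_dist_le (R : realType) (s t r : R) : s <= r <= t -> `|s - r| <= t - s /\ `|t - r| <= t - s.
Proof. by move=> /andP[r1 r2]; rewrite !ler_norml; split; apply/andP; split; lra. Qed.

Lemma itv_enlarge (R : realType) (lo hi y z : R) :
  lo <= y <= hi -> `|z - y| < 1 -> lo - 1 <= z <= hi + 1.
Proof. by rewrite ltr_norml => /andP[y1 y2] /andP[z1 z2]; apply/andP; split; lra. Qed.

Lemma minmax_dist_le (R : realType) (p q r z e : R) : Num.min p q <= z <= Num.max p q ->
  `|p - r| <= e -> `|q - r| <= e -> `|r - z| <= e.
Proof.
rewrite !ler_norml /Num.min /Num.max; case: ifP => _ /andP[z1 z2] /andP[p1 p2] /andP[q1 q2];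
  by apply/andP; split; lra.
Qed.

Lemma Rintegral_itvoc_cst (R : realType) (s t r : R) : s <= t ->
  \int[@lebesgue_measure R]_(_ in `]s, t]) r = r * (t - s).
Proof.
move=> st; rewrite (_ : (fun=> r) = cst r) // Rintegral_cst; last exact: measurable_itv.
rewrite [X in fine X](_ : _ = (t - s)%:E) //.
apply: etrans (lebesgue_measure_itv _) _; rewrite /= lte_fin.
by case: ltP => [//|ts]; rewrite (le_anti (introT andP (conj st ts))) subrr.
Qed.

Section Path.
Context {R : realType}.
Notation mu := (@lebesgue_measure R).
Variables (x b D : R -> R) (c : R).
Let y t := x t - b t.
Let a t := D (y t).
Hypothesis c0 : 0 <= c.
Hypothesis ia : mu.-integrable `[0, c] (EFin \o a).
Hypothesis xE : forall t, 0 <= t <= c -> x t = \int[mu]_(s in `[0, t]) a s.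
Hypothesis cb : {within `[0, c], continuous b}.

Lemma path_continuous : {within `[0, c], continuous x}.
Proof.
have := parameterized_integral_continuous c0 ia.
rewrite !subspace_continuousP => H t tc.
have tc' : 0 <= t <= c by move: tc; rewrite /= in_itv.
have := H t tc; rewrite /from_subspace /parameterized_integral -(xE tc').
apply: cvg_trans; apply: near_eq_cvg; near=> s.
rewrite xE //.
have : [set` `[0, c]] s by near: s; exact: withinT.
by rewrite /= in_itv.
Unshelve. all: by end_near. Qed.

Lemma path_difference_continuous : {within `[0, c], continuous y}.
Proof. by move=> t; apply: cvgB; [exact: path_continuous|exact: cb]. Qed.

Let sub_itv s t : 0 <= s -> t <= c -> [set` `]s, t]] `<=` [set` `[0, c]].
Proof.
move=> s0 tc r /=; rewrite !in_itv /= => /andP[sr rt].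
by rewrite (le_trans s0 (ltW sr)) (le_trans rt tc).
Qed.

Let ioc (g : R -> R) s t : 0 <= s -> t <= c ->
  mu.-integrable `[0, c] (EFin \o g) -> mu.-integrable `]s, t] (EFin \o g).
Proof. by move=> s0 tc; apply: integrableS => //; exact: sub_itv. Qed.

Let IB (g : R -> R) s t : 0 <= s -> s <= t -> t <= c -> mu.-integrable `[0, c] (EFin \o g) ->
  \int[mu]_(r in `[0, t]) g r - \int[mu]_(r in `[0, s]) g r = \int[mu]_(r in `]s, t]) g r.
Proof.
move=> s0 st tc ig; apply: Rintegral_itvB => //.
by apply: integrableS ig => //; apply: subset_itvl; rewrite bnd_simp.
Qed.

Variables (f f1 f2 : R -> R) (C1 C2 k : R).
Hypothesis ff1 : forall z : R, is_derive z 1 f (f1 z).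
Hypothesis f12 : forall z : R, is_derive z 1 f1 (f2 z).
Hypothesis cf2 : continuous f2.
Hypothesis fC1 : forall z, `|f1 z| <= C1.
Hypothesis fC2 : forall z, `|f2 z| <= C2.
Hypothesis k0 : 0 <= k.

(** The infinitesimal generator of Y = X - B, with k = sigma^2 / 2 in the application. *)
Definition generator (z : R) : R := f1 z * D z + k * f2 z.

Let cy := path_difference_continuous.

Let my : measurable_fun `[0, c] y.
Proof. exact: subspace_continuous_measurable_fun. Qed.

Let ma : measurable_fun `[0, c] a.
Proof. by have /integrableP[/measurable_EFinP] := ia. Qed.

Let mf1y : measurable_fun `[0, c] (fun r => f1 (y r)).
Proof.
apply: measurableT_comp my; exact: continuous_measurable_fun (is_derive_continuous f12).
Qed.

Let mf2y : measurable_fun `[0, c] (fun r => f2 (y r)).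
Proof. apply: measurableT_comp my; exact: continuous_measurable_fun. Qed.

Let ic (r : R) : mu.-integrable `[0, c] (EFin \o (fun=> r)).
Proof.
by apply: continuous_compact_integrable; [exact: segment_compact|apply: continuous_subspaceT => z; exact: cvg_cst].
Qed.

Let iaM (g : R -> R) C : measurable_fun `[0, c] g -> (forall r, `|g r| <= C) ->
  mu.-integrable `[0, c] (EFin \o (fun r => g r * a r)).
Proof.
move=> mg gC.
apply: (le_integrable _ _ _ (integrable_scale _ C ia)) => //.
  by apply/measurable_EFinP; exact: measurable_funM.
move=> r _ /=; rewrite lee_fin !normrM ler_wpM2r //.
exact: le_trans (gC r) (ler_norm _).
Qed.

Let if2 : mu.-integrable `[0, c] (EFin \o (fun r => f2 (y r))).
Proof.
apply: (le_integrable _ _ _ (ic C2)) => //; first exact/measurable_EFinP.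
move=> r _ /=; rewrite lee_fin; exact: le_trans (fC2 _) (ler_norm _).
Qed.

Lemma integrable_generator : mu.-integrable `[0, c] (EFin \o (fun r => generator (y r))).
Proof.
apply: integrable_add => //; first exact: (iaM mf1y (fun r => fC1 _)).
exact: integrable_scale.
Qed.

Let ina : mu.-integrable `[0, c] (EFin \o (fun r => `|a r|)).
Proof. exact: (integrable_norm ia). Qed.

Let Lam t := \int[mu]_(r in `[0, t]) `|a r|.
Let I t := \int[mu]_(r in `[0, t]) generator (y r).

(** Only the half-step in which x moves, with b already at its final value, is present; q stands for
    the Brownian one. The increment of f is f1 z times the integral of the drift, and f1 z is
    compared with f1 (y r) inside that integral. The error is therefore measured by the integral of
    the absolute drift, and an unbounded or discontinuous drift does no harm. *)
Lemma path_step s t e q : 0 <= s -> s <= t -> t <= c -> 0 <= e ->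
  (forall r z, s < r <= t -> Num.min (x s - b t) (x t - b t) <= z <= Num.max (x s - b t) (x t - b t) ->
     `|f1 z - f1 (y r)| <= e) ->
  (forall r, s < r <= t -> `|f2 (y s) - f2 (y r)| <= e) ->
  `|q - k * (t - s) * f2 (y s)| <= e * (t - s) ->
  `|f (x t - b t) - f (x s - b t) + q - (I t - I s)| <=
    e * (Lam t - Lam s + (k + 1) * (t - s)).
Proof.
move=> s0 st tc e0 H1 H2 Hq.
have [z zst fE] := mean_value ff1 (x s - b t) (x t - b t).
have -> : f (x t - b t) - f (x s - b t) = f1 z * (x t - x s).
  by rewrite fE; congr (_ * _); ring.
have t0 := le_trans s0 st; have sc := le_trans st tc.
rewrite (xE (t := t)) ?t0 // (xE (t := s)) ?s0 //.
rewrite (IB s0 st tc ia) (IB s0 st tc integrable_generator) (IB s0 st tc ina).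
have mI : measurable ([set` `]s, t]] : set (measurableTypeR R)) by exact: measurable_itv.
have ia' := ioc s0 tc ia; have ig' := ioc s0 tc integrable_generator.
pose g r := (f1 z - f1 (y r)) * a r + k * (f2 (y s) - f2 (y r)).
have gi : mu.-integrable `]s, t] (EFin \o g).
  apply: ioc => //; apply: integrable_add => //.
    apply: (@iaM _ (C1 + C1)); first exact: measurable_funB.
    by move=> r; apply: le_trans (ler_normB _ _) _; exact: lerD.
  by apply: integrable_scale => //; apply: integrable_sub.
have i1 : mu.-integrable `]s, t] (EFin \o (fun r => f1 z * a r)) by exact: integrable_scale.
have i2 : mu.-integrable `]s, t] (EFin \o (fun=> k * f2 (y s))) by exact: ioc (ic _).
have E : f1 z * (\int[mu]_(r in `]s, t]) a r) + q - \int[mu]_(r in `]s, t]) generator (y r) =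
   \int[mu]_(r in `]s, t]) g r + (q - k * (t - s) * f2 (y s)).
  rewrite (_ : g = fun r => f1 z * a r + k * f2 (y s) - generator (y r)); last first.
    by apply/funext => r; rewrite /g /generator -/(a r); ring.
  rewrite (RintegralB mI (integrable_add mI i1 i2) ig') (RintegralD mI i1 i2).
  by rewrite RintegralZl // Rintegral_itvoc_cst //; ring.
rewrite E; apply: le_trans (ler_normD _ _) _.
rewrite (_ : e * _ = e * (\int[mu]_(r in `]s, t]) `|a r|) + k * e * (t - s) + e * (t - s)); last by ring.
apply: lerD => //.
apply: le_trans (le_normr_Rintegral mI gi) _.
have ina' := ioc s0 tc ina.
have i3 : mu.-integrable `]s, t] (EFin \o (fun r => e * `|a r|)) by exact: integrable_scale.
have i4 : mu.-integrable `]s, t] (EFin \o (fun=> k * e)) by exact: ioc (ic _).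
rewrite -(Rintegral_itvoc_cst (k * e) st) -RintegralZl // -(RintegralD mI i3 i4).
apply: le_Rintegral => //.
- exact: (integrable_norm gi).
- exact: integrable_add.
- move=> r /=; rewrite in_itv /= => srt.
  apply: le_trans (ler_normD _ _) _; rewrite !normrM (ger0_norm k0).
  by apply: lerD; [apply: ler_wpM2r => //; exact: H1|apply: ler_wpM2l => //; exact: H2].
Qed.

Variable u : R.
Hypothesis u0 : 0 <= u.

Let Lam_ge0 s t : 0 <= s -> s <= t -> t <= c -> 0 <= Lam t - Lam s.
Proof. by move=> s0 st tc; rewrite (IB s0 st tc ina); apply: Rintegral_ge0. Qed.

(* [q n] stands for the conditional expectation of the Brownian part of the n-th increment of [f y]. *)
Lemma path_sum e : 0 < e -> exists2 dl : R, 0 < dl &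
  forall (h : R) (n : nat) (q : nat -> R), 0 < h -> h < dl ->
  (forall j, (j < n)%N -> u + j.+1%:R * h <= c) ->
  (forall j, (j < n)%N -> `|q j - k * h * f2 (y (u + j%:R * h))| <= e * h) ->
  let t j := u + j%:R * h in
  `|\sum_(j < n) (f (x (t j.+1) - b (t j.+1)) - f (x (t j) - b (t j.+1)) + q j) - (I (t n) - I u)|
    <= e * (Lam (t n) - Lam u + (k + 1) * (n%:R * h)).
Proof.
move=> e0.
have C20 : 0 <= C2 by apply: le_trans (fC2 0).
(* The points at which f1 is compared differ by a move of x and a move of b, hence by at most 2 eta,
   and f1 is C2-Lipschitz: this value of eta gives C2 * (2 * eta) <= e. *)
have eta0 : 0 < e / (2 * (C2 + 1)) by rewrite divr_gt0 // mulr_gt0 //; lra.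
have [d1 d10 H1] := uniform_continuity path_continuous eta0.
have [d2 d20 H2] := uniform_continuity cb eta0.
have cf2y : {within `[0, c], continuous (fun r => f2 (y r))}.
  by move=> r; apply: continuous_comp; [exact: cy|exact: cf2].
have [d3 d30 H3] := uniform_continuity cf2y e0.
exists (Num.min d1 (Num.min d2 d3)); first by rewrite !lt_min d10 d20 d30.
move=> h n q h0; rewrite !lt_min => /andP[hd1 /andP[hd2 hd3]].
elim: n => [|n IH] Hn Hq /=.
  by rewrite big_ord0 !mulr0n !mul0r addr0 !subrr normr0 mulr0 addr0 mulr0.
have := IH (fun j jn => Hn j (ltnW jn)) (fun j jn => Hq j (ltnW jn)).
rewrite /= big_ord_recr /=.
set t := u + n%:R * h; set t' := u + n.+1%:R * h.
set S := \sum_(j < n) _ => HS.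
have t'E : t' = t + h by rewrite /t' /t -natr1; ring.
have t0 : 0 <= t by rewrite addr_ge0 // mulr_ge0 // ltW.
have t'c : t' <= c := Hn n (ltnSn n).
have tt' : t <= t' by rewrite t'E; lra.
pose eta := e / (2 * (C2 + 1)).
have etaE : eta * (2 * (C2 + 1)) = e by rewrite /eta divfK // gt_eqF //; lra.
have in_c r : t < r <= t' -> 0 <= r <= c.
  by move=> /andP[/ltW r1 r2]; rewrite (le_trans t0 r1) (le_trans r2 t'c).
have tin : 0 <= t <= c by rewrite t0 (le_trans tt' t'c).
have t'in : 0 <= t' <= c by rewrite (le_trans t0 tt').
have close r : t < r <= t' -> `|t - r| <= h /\ `|t' - r| <= h.
  by move=> /andP[/ltW r1 r2]; rewrite (_ : h = t' - t); [apply: itv_dist_le; rewrite r1|rewrite t'E; ring].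
have step := @path_step t t' e (q n) t0 tt' t'c (ltW e0).
have {step} step : `|f (x t' - b t') - f (x t - b t') + q n - (I t' - I t)| <= e * (Lam t' - Lam t + (k + 1) * (t' - t)).
  apply: step; first 2 last.
  - have -> : t' - t = h by rewrite t'E; ring.
    exact: Hq.
  - move=> r z rt zz.
    have rin := in_c _ rt; have [ctr ct'r] := close _ rt.
    have x1 : `|x t - x r| < eta by apply: H1 => //; exact: le_lt_trans hd1.
    have x2 : `|x t' - x r| < eta by apply: H1 => //; exact: le_lt_trans hd1.
    have b2 : `|b t' - b r| < eta by apply: H2 => //; exact: le_lt_trans hd2.
    have dist_le s : `|x s - x r| < eta -> `|x s - b t' - y r| <= 2 * eta.
      move=> xs; rewrite (_ : x s - b t' - y r = (x s - x r) - (b t' - b r)); last by rewrite /y; ring.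
      by apply: le_trans (ler_normB _ _) _; rewrite mulr2n mulrDl !mul1r lerD // ltW.
    have zyr : `|y r - z| <= 2 * eta by exact: minmax_dist_le zz (dist_le _ x1) (dist_le _ x2).
    rewrite distrC; apply: le_trans (mean_value_le f12 fC2 z (y r)) _.
    apply: (@le_trans _ _ (C2 * (2 * eta))); first exact: ler_wpM2l.
    by have := eta0; rewrite -/eta => h1; nra.
  - move=> r rt; apply: ltW; apply: H3 => //; first exact: in_c.
    by have [ctr _] := close _ rt; exact: le_lt_trans hd3.
rewrite (_ : S + _ - _ = (S - (I t - I u)) + (f (x t' - b t') - f (x t - b t') + q n - (I t' - I t))); last by ring.
apply: le_trans (ler_normD _ _) _.
apply: le_trans (lerD HS step) _.
by rewrite -mulrDr ler_pM2l // t'E /t -natr1; lra.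
Qed.

Lemma primitive_norm_mono s t : 0 <= s -> s <= t -> t <= c -> Lam s <= Lam t.
Proof. by move=> s0 st tc; rewrite -subr_ge0; exact: Lam_ge0. Qed.

End Path.

(** * Convergence in probability and uniform integrability *)

Section ConvergenceInProbability.
Context d (T : measurableType d) (R : realType) (P : probability T R).
Implicit Types (E : nat -> set T).

Definition tail E n := \bigcup_i E (n + i)%N.

Lemma tailP E n w : tail E n w <-> exists2 k, (n <= k)%N & E k w.
Proof.
split=> [[i _ Ei]|[k nk Ek]]; first by exists (n + i)%N => //; exact: leq_addr.
by exists (k - n)%N => //; rewrite subnKC.
Qed.

Lemma measurable_tail E n : (forall k, measurable (E k)) -> measurable (tail E n).
Proof. by move=> mE; exact: bigcup_measurable. Qed.

(** Continuity of P from above along the decreasing sets [tail E n]. *)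
Lemma prob_tail_le E (r dl : R) : (forall k, measurable (E k)) ->
  (P (\bigcap_n tail E n) <= r%:E)%E -> 0 < dl ->
  exists N, forall n, (N <= n)%N -> (P (tail E n) <= (r + dl)%:E)%E.
Proof.
move=> mE Pr dl0.
have mU n : measurable (tail E n) := measurable_tail n mE.
have mI : measurable (\bigcap_n tail E n) by exact: bigcap_measurable.
have U0 : (P (tail E 0%N) < +oo)%E by rewrite -ge0_fin_numE // fin_num_measure.
have ni : nonincreasing_seq (tail E).
  move=> n m nm; apply/subsetPset => w /tailP[k mk Ek].
  by apply/tailP; exists k => //; exact: leq_trans mk.
have finI : P (\bigcap_n tail E n) \is a fin_num by rewrite fin_num_measure.
have : (P \o tail E) n @[n --> \oo] --> (fine (P (\bigcap_n tail E n)))%:E.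
  by rewrite fineK //; exact: (nonincreasing_cvg_mu U0 mU mI ni).
move=> /fine_cvgP[_ /cvgrPdist_lt /(_ _ dl0) [N _ HN]].
exists N => n /HN /=; rewrite ltr_norml => /andP[h1 h2].
have finE : P (tail E n) \is a fin_num by rewrite fin_num_measure.
have hr : fine (P (\bigcap_n tail E n)) <= r by rewrite -lee_fin fineK.
by rewrite -(fineK finE) lee_fin; move: h1 hr; set p := fine _; set q := fine _; lra.
Qed.

(* The order of the limits matters: the first index is fixed before the second one tends to infinity. *)
Lemma prob_double_limit (E : nat -> nat -> set T) (dl : R) :
  (forall n m, measurable (E n m)) ->
  {ae P, forall w, exists N, forall n, (N <= n)%N ->
     exists M, forall m, (M <= m)%N -> ~ E n m w} ->
  0 < dl ->
  exists N, forall n, (N <= n)%N -> exists M, forall m, (M <= m)%N -> (P (E n m) <= dl%:E)%E.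
Proof.
move=> mE [A [mA PA subA]] dl0.
pose S n := \bigcap_m tail (E n) m.
have mS n : measurable (S n) by apply: bigcap_measurable => // m _; exact: measurable_tail.
have d20 : 0 < dl / 2 by lra.
have PS : (P (\bigcap_n tail S n) <= (0 : R)%:E)%E.
  apply: (@le_trans _ _ (P A)); last by rewrite PA.
  apply: le_measure; rewrite ?inE //.
    by apply: bigcap_measurable => // n _; exact: measurable_tail.
  move=> w Sw; apply: subA => -[N HN].
  have /tailP[n Nn Snw] := Sw N I.
  have [M HM] := HN n Nn.
  by have /tailP[m Mm Em] := Snw M I; exact: HM Em.
have [N HN] := prob_tail_le mS PS d20.
exists N => n /HN Pn.
have PSn : (P (S n) <= (0 + dl / 2)%:E)%E.
  apply: le_trans Pn; apply: le_measure; rewrite ?inE //; first exact: measurable_tail.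
  by move=> w Sw; apply/tailP; exists n.
have [M HM] := prob_tail_le (mE n) PSn d20.
exists M => m /HM; rewrite (_ : 0 + _ + _ = dl); last by lra.
apply: le_trans; apply: le_measure; rewrite ?inE //; first exact: measurable_tail.
by move=> w Ew; apply/tailP; exists m.
Qed.

Definition bounded_rv (f : T -> R) :=
  measurable_fun setT f /\ exists C : R, forall w, `|f w| <= C.

Lemma bounded_rv_integrable f : bounded_rv f -> P.-integrable setT (EFin \o f).
Proof. by move=> [mf [C fC]]; exact: prob_bounded_integrable fC. Qed.

Lemma bounded_rv_sqr f : bounded_rv f -> P.-integrable setT (EFin \o (fun w => f w ^+ 2)).
Proof.
move=> [mf [K fK]]; apply: (@prob_bounded_integrable _ _ _ P _ (K ^+ 2)).
  exact: measurable_funX.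
by move=> w; rewrite normrX lerXn2r ?nnegrE //; apply: le_trans (fK w).
Qed.

(** Pointwise, |v| <= e + eta v^2 + 1_{|v| > e} / (4 eta); beyond e this is (2 eta |v| - 1)^2 >= 0
    divided by 4 eta. A second moment bound thus turns smallness in probability into smallness of
    the mean. *)
Lemma Rintegral_norm_le (f : T -> R) (C e eta : R) : bounded_rv f ->
  \int[P]_w (f w ^+ 2) <= C -> 0 < e -> 0 < eta ->
  `|\int[P]_w f w| <= e + eta * C + fine (P [set w | e < `|f w|]) / (4 * eta).
Proof.
move=> bf fC e0 eta0; have [mf [K fK]] := bf.
have if_ := bounded_rv_integrable bf.
have if2 := bounded_rv_sqr bf.
pose A := [set w | e < `|f w|].
have mA : measurable A.
  rewrite (_ : A = (Num.norm \o f) @^-1` `]e, +oo[%classic); last first.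
    by apply/seteqP; split => w /=; rewrite in_itv /= ?andbT.
  by rewrite -[X in measurable X]setTI; apply: (measurableT_comp _ mf) => //; exact: measurable_itv.
have i1A := integrable_indic_prob P mA.
have i1 := integrable_scale measurableT eta if2.
have i2 := integrable_scale measurableT (4 * eta)^-1 i1A.
have i0 : P.-integrable setT (EFin \o (fun=> e)) by apply: (@prob_bounded_integrable _ _ _ P _ `|e|).
have E1A : \int[P]_w (\1_A w : R) = fine (P A).
  by rewrite /Rintegral integral_indic // setIT.
apply: le_trans (le_normr_Rintegral measurableT if_) _.
apply: (@le_trans _ _ (\int[P]_w ((e + eta * f w ^+ 2) + (4 * eta)^-1 * \1_A w))).
  apply: le_Rintegral => //.
  - exact: (integrable_norm if_).
  - by apply: integrable_add => //; exact: integrable_add.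
  - move=> w _; rewrite indicE.
    have [ew|we] := ltP e `|f w|; last first.
      rewrite memNset; last by rewrite /A /= ltNge we.
      rewrite mulr0 addr0; apply: le_trans we _.
      by rewrite lerDl mulr_ge0 ?sqr_ge0 // ltW.
    rewrite mem_set // mulr1.
    set v := `|f w|; rewrite -(real_normK (num_real (f w))) -/v.
    have i4 : (4 * eta)^-1 * (4 * eta) = 1 by rewrite mulVf // gt_eqF //; lra.
    set r := (4 * eta)^-1; rewrite -/r in i4.
    have : 0 <= r * (2 * eta * v - 1) ^+ 2.
      by apply: mulr_ge0; [rewrite invr_ge0; lra|exact: sqr_ge0].
    have -> : r * (2 * eta * v - 1) ^+ 2 = (r * (4 * eta)) * (eta * v ^+ 2) - (r * (4 * eta)) * v + r by ring.
    by rewrite i4; lra.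
rewrite RintegralD //; last exact: integrable_add.
rewrite RintegralD // !RintegralZl // E1A prob_Rintegral_cst.
rewrite [X in _ + X]mulrC -/A lerD2r lerD2l.
by rewrite ler_pM2l.
Qed.

Lemma uniform_integrability (D : nat -> nat -> T -> R) (C e : R) :
  (forall n m, bounded_rv (D n m)) ->
  (forall n m, \int[P]_w (D n m w ^+ 2) <= C) ->
  {ae P, forall w, forall eps : R, 0 < eps -> exists N, forall n, (N <= n)%N ->
     exists M, forall m, (M <= m)%N -> `|D n m w| <= eps} ->
  0 < e ->
  exists N, forall n, (N <= n)%N -> exists M, forall m, (M <= m)%N -> `|\int[P]_w D n m w| <= e.
Proof.
move=> bD DC aeD e0.
have C0 : 0 <= C by apply: le_trans (DC 0%N 0%N); apply: Rintegral_ge0 => w _; exact: sqr_ge0.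
(* A third of e for each term of the bound on the mean: eta * C <= e / 3 here, and dl / (4 * eta) =
   e / 3 below. *)
pose eta := e / (3 * (C + 1)).
have eta0 : 0 < eta by rewrite divr_gt0 //; lra.
have etaE : eta * (3 * (C + 1)) = e by rewrite /eta divfK // gt_eqF //; lra.
have e30 : 0 < e / 3 by lra.
pose A n m := [set w | e / 3 < `|D n m w|].
have mA n m : measurable (A n m).
  have [mf _] := bD n m.
  rewrite (_ : A n m = (Num.norm \o D n m) @^-1` `]e / 3, +oo[%classic); last first.
    by apply/seteqP; split => w /=; rewrite in_itv /= ?andbT.
  by rewrite -[X in measurable X]setTI; apply: (measurableT_comp _ mf) => //; exact: measurable_itv.
pose dl := e / 3 * (4 * eta).
have dl0 : 0 < dl by rewrite mulr_gt0 //; lra.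
have aeA : {ae P, forall w, exists N, forall n, (N <= n)%N ->
     exists M, forall m, (M <= m)%N -> ~ A n m w}.
  apply: filterS aeD => w /(_ _ e30) [N HN]; exists N => n /HN [M HM].
  by exists M => m /HM; rewrite /A /=; apply: contraTnot; rewrite -ltNge.
have [N HN] := prob_double_limit mA aeA dl0.
exists N => n /HN [M HM]; exists M => m /HM PA.
apply: le_trans (Rintegral_norm_le (bD n m) (DC n m) e30 eta0) _.
have : fine (P (A n m)) <= dl by rewrite -lee_fin fineK ?fin_num_measure.
rewrite -/(A n m) => h.
have : fine (P (A n m)) / (4 * eta) <= e / 3 by rewrite ler_pdivrMr //; lra.
by nra.
Qed.

End ConvergenceInProbability.

(** * The scale function and its approximation *)

Section StretchedExponential.
Context {R : realType}.
Notation mu := (@lebesgue_measure R).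
Variables (p kap : R) (s g : R -> R).
Hypothesis p0 : 0 < p.
Hypothesis kap0 : 0 < kap.
Hypothesis s00 : s 0 = 0.
Hypothesis sg : forall x : R, is_derive x 1 s (g x).
Hypothesis gE : forall x, 0 <= x -> g x = expR (- (kap * x `^ p)).

Let pn0 : p != 0. Proof. by rewrite gt_eqF. Qed.
Let kn0 : kap != 0. Proof. by rewrite gt_eqF. Qed.

Lemma stretched_mono x y : 0 <= x -> x <= y -> s x <= s y.
Proof.
move=> x0 xy; have [c] := mean_value sg x y.
rewrite (min_idPl xy) (max_idPr xy) => /andP[xc cy] E.
rewrite -subr_ge0 E; apply: mulr_ge0; last by rewrite subr_ge0.
by rewrite gE ?expR_ge0 //; exact: le_trans xc.
Qed.

(** Since expR u >= (u / m)^m, the density decays at least like x^-2 as soon as p m >= 2. The bound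
    has the form C / (1 + x^2) because its antiderivative is C atan. *)
Let bound : exists C : R, forall x, 0 <= x -> g x <= C / (1 + x ^+ 2).
Proof.
pose m := (Num.truncn (2 / p)).+1.
have m0 : 0 < m%:R :> R by rewrite ltr0n.
have mp : 2 <= p * m%:R.
  rewrite mulrC -ler_pdivrMr //; apply: ltW; exact: truncnS_gt.
pose K : R := (m%:R / kap) ^+ m.
have K0 : 0 < K by rewrite exprn_gt0 // divr_gt0.
exists (2 * (1 + K)) => x x0.
rewrite gE // ler_pdivlMr; last by have := sqr_ge0 x; lra.
have e1 : expR (- (kap * x `^ p)) <= 1.
  by rewrite -[X in _ <= X]expR0 ler_expR oppr_le0 mulr_ge0 ?powR_ge0 // ltW.
have [x1|x1] := leP x 1.
  have x2 : x ^+ 2 <= 1 by rewrite expr_le1.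
  have := sqr_ge0 x; have := expR_ge0 (- (kap * x `^ p)); nra.
set u := kap * x `^ p.
have u0 : 0 <= u by rewrite mulr_ge0 ?powR_ge0 // ltW.
have eu : (u / m%:R) ^+ m <= expR u.
  have -> : expR u = expR (u / m%:R) ^+ m.
    by rewrite -expRM_natr divfK // gt_eqF.
  rewrite lerXn2r ?nnegrE ?expR_ge0 //; first by rewrite divr_ge0.
  by have := expR_ge1Dx (u / m%:R); lra.
have xm : x ^+ 2 <= (x `^ p) ^+ m.
  rewrite -powR_mulrn ?powR_ge0 // -powRrM -powR_mulrn ?(ltW (lt_trans ltr01 x1)) //.
  by apply: ler_powR => //; exact: ltW.
have Ku : x ^+ 2 <= K * expR u.
  apply: le_trans xm _.
  have -> : (x `^ p) ^+ m = K * (u / m%:R) ^+ m.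
    rewrite /K /u -exprMn; congr (_ ^+ m); field.
    by rewrite kn0 gt_eqF.
  by rewrite ler_pM2l.
rewrite expRN; set E := expR u in eu Ku *.
have E1 : 1 <= E by rewrite /E -[X in X <= _]expR0 ler_expR.
rewrite ler_pdivrMl; last by lra.
have : K * 1 <= K * E by rewrite ler_pM2l.
lra.
Qed.

Lemma stretched_bounded : exists C : R, forall x, 0 <= x -> s x <= C.
Proof.
have [C gC] := bound; exists (C * (pi / 2)) => x x0.
have C0 : 0 <= C.
  have := gC 0 (lexx _); rewrite expr0n addr0 divr1; apply: le_trans.
  by rewrite gE // expR_ge0.
have d1 (t : R) := derivef_mul (derivef_cst C t) (is_derive1_atan t).
have [c] := mean_value (fun t => derivef_sub (d1 t) (sg t)) 0 x.
rewrite (min_idPl x0) (max_idPr x0) => /andP[c0 cx].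
rewrite s00 atan0 mulr0 !subr0 mul0r add0r => E.
have : 0 <= C * atan x - s x by rewrite E mulr_ge0 // subr_ge0 gC.
rewrite subr_ge0 => h; apply: le_trans h _.
by apply: ler_wpM2l => //; apply: ltW; exact: atan_ltpi2.
Qed.

(** The limit of s at +oo, as s is nondecreasing on [0, +oo[. *)
Definition stretched_limit : R := sup [set s x | x in [set x | 0 <= x]].

Let has_sup_s : has_sup [set s x | x in [set x | 0 <= x]].
Proof.
split; first by exists (s 0), 0 => //=.
by have [C sC] := stretched_bounded; exists C => _ [x x0 <-]; exact: sC.
Qed.

Lemma stretched_le_limit x : 0 <= x -> s x <= stretched_limit.
Proof. by move=> x0; apply: (sup_upper_bound has_sup_s); exists x. Qed.

Lemma stretched_near_limit e : 0 < e ->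
  exists2 x0, 0 <= x0 & forall x, x0 <= x -> stretched_limit - e < s x.
Proof.
move=> e0; have [_ [x x0 <-] sx] := sup_adherent e0 has_sup_s.
exists x => // z xz; apply: lt_le_trans sx _; exact: stretched_mono.
Qed.

Lemma stretched_lt_limit x : 0 <= x -> s x < stretched_limit.
Proof.
move=> x0; apply: (@lt_le_trans _ _ (s (x + 1))); last by apply: stretched_le_limit; lra.
have [c] := mean_value sg x (x + 1).
have xx1 : x <= x + 1 by lra.
rewrite (min_idPl xx1) (max_idPr xx1) => /andP[xc _] E.
rewrite -subr_gt0 E; apply: mulr_gt0; last by lra.
by rewrite gE ?expR_gt0 //; exact: le_trans xc.
Qed.

(** The substitution t = kap x^p in the Gamma integral at 1/p: r is the inverse of x |-> kap x^p,
    and c s (r t) is an antiderivative of the integrand h on t > 0. *)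
Let h (t : R) : R := t `^ (p^-1 - 1) * expR (- t).
Let c : R := p * kap `^ p^-1.
Let r (t : R) : R := (t / kap) `^ p^-1.

Let derive_cs (t : R) : 0 < t -> is_derive t 1 (fun t => c * s (r t)) (h t).
Proof.
move=> t0; have tk : 0 < t / kap by rewrite divr_gt0.
have d1 := derivef_mul (derivef_id t) (derivef_cst kap^-1 t).
have d2 := derivef_comp (f := fun x => x `^ p^-1) (g := fun t => t / kap) (is_derive1_powR p^-1 tk) d1.
have d3 := derivef_mul (derivef_cst c t) (derivef_comp (sg _) d2).
apply: (derivef_eq d3) => //.
rewrite mul0r add0r gE ?powR_ge0 // -powRrM mulVf // powRr1 ?(ltW tk) //.
have -> : kap * (t / kap) = t by rewrite mulrC divfK.
rewrite /h /c powRM ?invr_ge0 ?(ltW t0) ?(ltW kap0) //.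
have -> : kap^-1 `^ (p^-1 - 1) = kap / kap `^ p^-1.
  rewrite -powR_inv1 ?(ltW kap0) // -powRrM mulN1r opprB powRB ?powRr1 ?(ltW kap0) //.
  by rewrite kn0 implybT.
have kp0 : kap `^ p^-1 != 0 by rewrite gt_eqF // powR_gt0.
by field; rewrite pn0 kn0 kp0.
Qed.

Let hc (t : R) : 0 < t -> {for t, continuous h}.
Proof.
move=> t0; apply: cvgM.
  have := is_derive1_powR (p^-1 - 1) t0 => -[+ _].
  by move=> /derivable1_diffP/differentiable_continuous.
apply: continuous_comp; first exact: opp_continuous.
exact: continuous_expR.
Qed.

(** The image of [1/(n+1), n+1] under x |-> kap x^p. It stays away from 0, near which h is unbounded
    when p > 1. *)
Let J n : set R := [set` `[kap * (n.+1%:R^-1 : R) `^ p, kap * n.+1%:R `^ p]].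

Let rK (x : R) : 0 <= x -> r (kap * x `^ p) = x.
Proof. by move=> x0; rewrite /r mulrC mulKf // -powRrM mulfV // powRr1. Qed.

Let integral_J n : (\int[mu]_(t in J n) (h t)%:E = (c * (s n.+1%:R - s n.+1%:R^-1))%:E)%E.
Proof.
have n0 : 0 < n.+1%:R :> R by rewrite ltr0n.
have A0 : 0 < kap * (n.+1%:R^-1 : R) `^ p by rewrite mulr_gt0 // powR_gt0 // invr_gt0.
(* For n = 0 the interval is a single point and both sides vanish; the fundamental theorem is stated
   for distinct endpoints. *)
have [n1|n1] := eqVneq n 0%N.
  rewrite /J n1 invr1 subrr mulr0 set_itv1 integral_set1 //.
have AB : kap * (n.+1%:R^-1 : R) `^ p < kap * n.+1%:R `^ p.
  rewrite ltr_pM2l // gt0_ltr_powR ?nnegrE ?invr_ge0 ?(ltW n0) //.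
  apply: (@lt_trans _ _ 1); rewrite ?invf_lt1 // ltr1n ltnS lt0n //.
have pos t : kap * (n.+1%:R^-1 : R) `^ p <= t -> 0 < t by apply: lt_le_trans.
have cF (t : R) : 0 < t -> {for t, continuous (fun t => c * s (r t))}.
  by move=> t0; have [+ _] := derive_cs t0 => /derivable1_diffP/differentiable_continuous.
rewrite (@continuous_FTC2 R h (fun t => c * s (r t))) //.
- by rewrite !rK ?invr_ge0 ?(ltW n0) // -EFinB mulrBr.
- apply/continuous_within_itvP => //; split.
  + by move=> t; rewrite in_itv /= => /andP[/ltW/pos t0 _]; exact: hc.
  + by apply/cvg_at_right_filter/hc.
  + by apply/cvg_at_left_filter/hc/pos/ltW.
- split.
  + by move=> t; rewrite in_itv /= => /andP[/ltW/pos t0 _]; have [] := derive_cs t0.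
  + exact/cvg_at_right_filter/cF.
  + exact/cvg_at_left_filter/cF/pos/ltW.
- move=> t; rewrite in_itv /= => /andP[/ltW/pos t0 _].
  by rewrite derive1E; have [_ ->] := derive_cs t0.
Qed.

Lemma stretched_limitE : Gamma p^-1 = p * kap `^ p^-1 * stretched_limit.
Proof.
have Jmono : nondecreasing_seq J.
  move=> n m nm; apply/subsetPset => t; rewrite /J /= !in_itv /= => /andP[h1 h2].
  have n0 : 0 < n.+1%:R :> R by rewrite ltr0n.
  have m0 : 0 < m.+1%:R :> R by rewrite ltr0n.
  have nm' : (n.+1%:R : R) <= m.+1%:R by rewrite ler_nat.
  apply/andP; split; [apply: le_trans h1|apply: le_trans h2 _].
    by rewrite ler_pM2l // ge0_ler_powR ?nnegrE ?invr_ge0 ?(ltW p0) ?(ltW n0) ?(ltW m0) // lef_pV2.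
  by rewrite ler_pM2l // ge0_ler_powR ?nnegrE ?(ltW p0) ?(ltW n0) ?(ltW m0).
have UJ : [set` `]0, +oo[] = \bigcup_n J n.
  apply/seteqP; split => t; rewrite /J /= ?in_itv /= ?andbT.
    move=> t0; have x0 : 0 < r t by rewrite powR_gt0 // divr_gt0.
    have tE : t = kap * (r t) `^ p.
      by rewrite /r -powRrM mulVf // powRr1 ?divr_ge0 ?(ltW t0) ?(ltW kap0) // mulrC divfK.
    exists (Num.truncn (r t + (r t)^-1)) => //=; rewrite in_itv /=.
    have := truncnS_gt (r t + (r t)^-1); set m := (_.+1)%:R => hm.
    have i0 : 0 < (r t)^-1 by rewrite invr_gt0.
    have m0 : 0 < m by lra.
    rewrite [X in _ <= X <= _]tE; apply/andP; split.
      rewrite ler_pM2l // ge0_ler_powR ?nnegrE ?invr_ge0 ?(ltW p0) ?(ltW x0) ?(ltW m0) //.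
      by rewrite -[X in _ <= X]invrK lef_pV2 // ?posrE //; lra.
    by rewrite ler_pM2l // ge0_ler_powR ?nnegrE ?(ltW p0) ?(ltW x0) ?(ltW m0) //; lra.
  move=> [n _] /=; rewrite in_itv /= => /andP[h1 _]; apply: lt_le_trans h1.
  by rewrite mulr_gt0 // powR_gt0 // invr_gt0 ltr0n.
rewrite /Gamma /Rintegral -/h UJ.
have mh : measurable_fun (`]0, +oo[%classic : set R) h.
  apply: open_continuous_measurable_fun; first exact: interval_open.
  by move=> t; rewrite inE /= in_itv /= andbT; exact: hc.
have cv : (\int[mu]_(t in J n) (h t)%:E @[n --> \oo] --> \int[mu]_(t in \bigcup_n J n) (h t)%:E)%E.
  apply: ge0_nondecreasing_set_cvg_integral => //.
  - by move=> n; exact: measurable_itv.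
  - move=> n; apply/measurable_EFinP; apply: measurable_funS mh => //.
    by rewrite UJ; exact: bigcup_sup.
  - by move=> n t _; rewrite lee_fin mulr_ge0 ?powR_ge0 ?expR_ge0.
have cv3 : s n.+1%:R @[n --> \oo] --> stretched_limit.
  apply/cvgrPdist_lt => e e0; have [x0 x00 Hx0] := stretched_near_limit e0.
  exists (Num.truncn x0) => // n /= xn.
  have xn' : x0 <= n.+1%:R.
    by apply/ltW/(lt_le_trans (truncnS_gt x0)); rewrite ler_nat.
  have h1 := Hx0 _ xn'; have h2 := stretched_le_limit (le_trans x00 xn').
  by rewrite ger0_norm; lra.
have cv4 : s (n.+1%:R^-1) @[n --> \oo] --> s 0.
  have cs := is_derive_continuous sg.
  by apply: (cvg_comp (fun n => n.+1%:R^-1) s) (cs 0); exact: cvg_harmonic.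
have cv5 : c * (s n.+1%:R - s n.+1%:R^-1) @[n --> \oo] --> c * stretched_limit.
  have cv6 := cvgB cv3 cv4; rewrite s00 subr0 in cv6.
  by apply: cvgM; [exact: cvg_cst|exact: cv6].
have cv2 : ((c * (s n.+1%:R - s n.+1%:R^-1))%:E @[n --> \oo] --> (c * stretched_limit)%:E)%E.
  by apply: cvg_EFin; [exact: nearW|exact: cv5].
have -> // : (\int[mu]_(t in \bigcup_n J n) (h t)%:E = (c * stretched_limit)%:E)%E.
apply: (cvg_unique _ cv) => //.
have cvE : (fun n => \int[mu]_(t in J n) (h t)%:E)%E = (fun n => (c * (s n.+1%:R - s n.+1%:R^-1))%:E)%E.
  by apply/funext => n; exact: integral_J.
by rewrite cvE; exact: cv2.
Qed.

End StretchedExponential.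

(** * Positive part and a continuously differentiable cutoff *)

Section PositivePart.
Context {R : realType}.

Lemma continuous_compf (f g : R -> R) (x : R) :
  {for x, continuous f} -> {for f x, continuous g} ->
  {for x, continuous (fun t => g (f t))}.
Proof. by move=> cf cg; exact: continuous_comp cf cg. Qed.

Implicit Types x y K : R.

Definition pos x : R := (x + `|x|) / 2.

Lemma pos_ge x : 0 <= x -> pos x = x.
Proof. by move=> x0; rewrite /pos ger0_norm //; field. Qed.

Lemma pos_le x : x <= 0 -> pos x = 0.
Proof. by move=> x0; rewrite /pos ler0_norm // subrr mul0r. Qed.

Lemma pos_ge0 x : 0 <= pos x.
Proof. by have [x0|/ltW x0] := leP 0 x; [rewrite pos_ge|rewrite pos_le]. Qed.

Lemma pos_norm x : pos x <= `|x|.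
Proof. by rewrite /pos; have := ler_norm x; lra. Qed.

Lemma continuous_pos : continuous pos.
Proof.
move=> x; apply: cvgM; last exact: cvg_cst.
by apply: cvgD; [exact: cvg_id|exact: norm_continuous].
Qed.

(** The continuous function 2 pos has an antiderivative, which the mean value theorem identifies
    with pos^2 on each half-line; differentiability at 0 comes for free. *)
Lemma derive_pos2 x : is_derive x 1 (fun t => pos t ^+ 2) (2 * pos x).
Proof.
have c2 : continuous (fun x => 2 * pos x).
  by move=> z; apply: cvgM; [exact: cvg_cst|exact: continuous_pos].
have [F F0 dF] := antiderivative c2.
suff FE : F =1 (fun t => pos t ^+ 2) by apply: (derivef_eq (dF x)).
move=> y.
have [y0|/ltW y0] := leP 0 y; last first.
  have [c + E] := mean_value dF y 0.
  rewrite (min_idPl y0) (max_idPr y0) => /andP[_ c0].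
  by move: E; rewrite F0 (pos_le c0) (pos_le y0) mulr0 mul0r expr0n /=; lra.
have d2 (t : R) := derivef_sub (dF t) (derivef_mul (derivef_id t) (derivef_id t)).
have [c + E] := mean_value d2 0 y.
rewrite (min_idPl y0) (max_idPr y0) => /andP[c0 _].
by move: E; rewrite F0 (pos_ge c0) (pos_ge y0) expr2; lra.
Qed.

Lemma continuous_pos2 : continuous (fun t => pos t ^+ 2).
Proof. exact: is_derive_continuous derive_pos2. Qed.

Lemma derive_neg x : is_derive x 1 (fun t : R => - t) (- 1).
Proof.
apply: (derivef_eq (derivef_sub (derivef_cst 0 x) (derivef_id x))); last by rewrite sub0r.
by move=> t; rewrite sub0r.
Qed.

Lemma continuous_powR_norm q : 0 < q -> continuous (fun x => `|x| `^ q).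
Proof.
move=> q0 x; have [->|x0] := eqVneq x 0.
  rewrite /continuous_at normr0 powR0 ?gt_eqF //.
  apply/cvgrPdist_lt => e e0.
  near=> t; rewrite sub0r normrN ger0_norm ?powR_ge0 //.
  have te : `|t| < e `^ q^-1.
    have : ball (0 : R) (e `^ q^-1) t.
      by near: t; apply: (@nbhsx_ballx R R^o); rewrite powR_gt0.
    by rewrite /ball /= sub0r normrN.
  have -> : e = (e `^ q^-1) `^ q by rewrite -powRrM mulVf ?gt_eqF // powRr1 // ltW.
  by apply: gt0_ltr_powR; rewrite ?nnegrE ?powR_ge0.
have nx0 : 0 < `|x| by rewrite normr_gt0.
apply: (continuous_compf (f := fun t => `|t|) (g := fun t => t `^ q)).
  exact: norm_continuous.
have [+ _] := is_derive1_powR q nx0.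
by move=> /derivable1_diffP/differentiable_continuous.
Unshelve. all: by end_near. Qed.

(** Equal to 1 on [-K, K] and to 0 off [-K-1, K+1]. Squares of positive parts are C^1, which is
    enough because the cutoff multiplies a first derivative. *)
Definition cutoff K x : R := pos (1 - pos (x - K) ^+ 2 - pos (- x - K) ^+ 2) ^+ 2.
Definition dcutoff K x : R := 2 * pos (1 - pos (x - K) ^+ 2 - pos (- x - K) ^+ 2) *
  (- (2 * pos (x - K)) + 2 * pos (- x - K)).

Let derive_inner K x : is_derive x 1 (fun x : R => 1 - pos (x - K) ^+ 2 - pos (- x - K) ^+ 2)
  (- (2 * pos (x - K)) + 2 * pos (- x - K)).
Proof.
have d1 := derivef_comp (f := fun t => pos t ^+ 2) (g := fun t => t - K) (derive_pos2 (x - K)) (derivef_sub (derivef_id x) (derivef_cst K x)).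
have d2 := derivef_comp (f := fun t => pos t ^+ 2) (g := fun t => - t - K) (derive_pos2 (- x - K)) (derivef_sub (derive_neg x) (derivef_cst K x)).
apply: (derivef_eq (derivef_sub (derivef_sub (derivef_cst 1 x) d1) d2)) => //.
by ring.
Qed.

Lemma derive_cutoff K x : is_derive x 1 (cutoff K) (dcutoff K x).
Proof.
exact: (derivef_comp (f := fun t => pos t ^+ 2) (derive_pos2 _) (derive_inner K x)).
Qed.

Lemma continuous_dcutoff K : continuous (dcutoff K).
Proof.
have cK (f : R -> R) : continuous f -> continuous (fun x => pos (f x - K)).
  move=> cf x; apply: (continuous_compf (f := fun x => f x - K)); last exact: continuous_pos.
  by apply: cvgB; [exact: cf|exact: cvg_cst].
have c1 := cK _ (fun x => cvg_id). 
have c2 := cK _ (is_derive_continuous derive_neg).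
move=> x; apply: cvgM.
  apply: cvgM; first exact: cvg_cst.
  apply: (continuous_compf (f := fun x => 1 - pos (x - K) ^+ 2 - pos (- x - K) ^+ 2)); last exact: continuous_pos.
  exact: is_derive_continuous (derive_inner K) x.
by apply: cvgD; [apply: cvgN; apply: cvgM; [exact: cvg_cst|exact: c1]|apply: cvgM; [exact: cvg_cst|exact: c2]].
Qed.

Lemma cutoff_in K x : `|x| <= K -> cutoff K x = 1 /\ dcutoff K x = 0.
Proof.
rewrite ler_norml => /andP[h1 h2].
have E1 : pos (x - K) = 0 by apply: pos_le; lra.
have E2 : pos (- x - K) = 0 by apply: pos_le; lra.
by rewrite /cutoff /dcutoff E1 E2 expr0n /= !subr0 pos_ge // expr1n mulr0 oppr0 addr0 mulr0.
Qed.

Lemma cutoff_out K x : 0 <= K -> K + 1 <= `|x| -> cutoff K x = 0 /\ dcutoff K x = 0.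
Proof.
move=> K0 xK.
suff E : pos (1 - pos (x - K) ^+ 2 - pos (- x - K) ^+ 2) = 0.
  by rewrite /cutoff /dcutoff E expr0n /= mulr0 mul0r.
apply: pos_le; have := sqr_ge0 (pos (x - K)); have := sqr_ge0 (pos (- x - K)).
move: xK; have [x0|x0] := leP 0 x.
  rewrite ger0_norm // => xK; rewrite (pos_ge (x := x - K)); last by lra.
  have h : 1 <= x - K by lra.
  by have := exprn_ege1 2 h; lra.
rewrite ltr0_norm // => xK; rewrite (pos_ge (x := - x - K)); last by lra.
have h : 1 <= - x - K by lra.
by have := exprn_ege1 2 h; lra.
Qed.

Lemma cutoff_01 K x : 0 <= cutoff K x <= 1.
Proof.
rewrite /cutoff sqr_ge0 /= expr_le1 ?pos_ge0 //.
have := sqr_ge0 (pos (x - K)); have := sqr_ge0 (pos (- x - K)).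
set u := 1 - _ - _ => h1 h2; have u1 : u <= 1 by rewrite /u; lra.
by have [u0|/ltW u0] := leP 0 u; rewrite ?(pos_ge u0) ?(pos_le u0).
Qed.

End PositivePart.

(** * Test functions with a prescribed derivative on a segment *)

Section TestFunction.
Context {R : realType}.

Record test_function (f f1 f2 : R -> R) : Prop := TestFunction {
  test_derive1 : forall x : R, is_derive x 1 f (f1 x);
  test_derive2 : forall x : R, is_derive x 1 f1 (f2 x);
  test_continuous2 : continuous f2;
  test_bound0 : exists C : R, forall x, `|f x| <= C;
  test_bound2 : exists C : R, forall x, `|f2 x| <= C }.

(** The bounds on f and f2 control f1: f (x + 1) - f x equals f1 c for some c within 1 of x, and f1
    varies by at most C2 between x and c. *)
Lemma test_bound1 (f f1 f2 : R -> R) : test_function f f1 f2 ->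
  exists C : R, forall x, `|f1 x| <= C.
Proof.
move=> [d1 d2 _ [C0 H0] [C2 H2]]; exists (C2 + 2 * C0) => x.
have [c] := mean_value d1 x (x + 1).
rewrite (min_idPl _) ?(max_idPr _) ?lerDl // => /andP[xc cx].
rewrite addrAC subrr add0r mulr1 => E.
have -> : f1 x = (f1 x - f1 c) + (f (x + 1) - f x) by rewrite E subrK.
apply: le_trans (ler_normD _ _) _; apply: lerD.
  apply: le_trans (mean_value_le d2 H2 c x) _.
  rewrite -[X in _ <= X]mulr1; apply: ler_wpM2l; first exact: le_trans (H2 0).
  by rewrite ler_norml; apply/andP; split; lra.
by apply: le_trans (ler_normB _ _) _; rewrite mulr2n mulrDl !mul1r; apply: lerD.
Qed.

(** An antiderivative of g times the cutoff is constant on each side of [-K-1, K+1], hence bounded,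
    while its first two derivatives on [-K, K] are g and g1. *)
Lemma cutoff_test_function (g g1 : R -> R) (K : R) : 0 <= K ->
  (forall x : R, is_derive x 1 g (g1 x)) -> continuous g1 ->
  exists f f1 f2, [/\ test_function f f1 f2, f 0 = 0,
    forall x, `|f1 x| <= `|g x| &
    forall x, `|x| <= K -> f1 x = g x /\ f2 x = g1 x].
Proof.
move=> K0 gg1 cg1; have cg := is_derive_continuous gg1.
pose f1 x := g x * cutoff K x.
pose f2 x := g1 x * cutoff K x + g x * dcutoff K x.
have d12 (x : R) : is_derive x 1 f1 (f2 x) := derivef_mul (gg1 x) (derive_cutoff K x).
have cc := is_derive_continuous (derive_cutoff K).
have cf2 : continuous f2.
  move=> x; apply: cvgD; apply: cvgM; [exact: cg1|exact: cc|exact: cg|exact: continuous_dcutoff].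
have [f f0 d01] := antiderivative (is_derive_continuous d12).
exists f, f1, f2; split=> //; last first.
- by move=> x /cutoff_in[E1 E2]; rewrite /f1 /f2 E1 E2 !mulr1 mulr0 addr0.
- move=> x; have /andP[h1 h2] := cutoff_01 K x.
  by rewrite /f1 normrM (ger0_norm h1) -[X in _ <= X]mulr1 ler_wpM2l.
have cf := is_derive_continuous d01.
have [C0 C00 HC0] := @compact_bounded_norm R f (- (K + 1)) (K + 1) (continuous_subspaceT cf).
have [C2 C20 HC2] := @compact_bounded_norm R f2 (- (K + 1)) (K + 1) (continuous_subspaceT cf2).
split=> //.
  exists C0 => x; have [xK|/ltW xK] := leP `|x| (K + 1).
    by apply: HC0; rewrite -ler_norml.
  have [x0|/ltW x0] := leP 0 x.
    have xK' : K + 1 <= x by move: xK; rewrite ger0_norm.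
    have [c] := mean_value d01 (K + 1) x.
    rewrite (min_idPl xK') (max_idPr xK') => /andP[c1 _] E.
    have [Ec _] := @cutoff_out R K c K0 (le_trans c1 (ler_norm c)).
    have -> : f x = f (K + 1) by move: E; rewrite /f1 Ec mulr0 mul0r; lra.
    by apply: HC0; apply/andP; split; lra.
  have xK' : x <= - (K + 1) by move: xK; rewrite ler0_norm // lerNr.
  have [c] := mean_value d01 x (- (K + 1)).
  rewrite (min_idPl xK') (max_idPr xK') => /andP[_ c1] E.
  have [Ec _] : cutoff K c = 0 /\ dcutoff K c = 0.
    by apply: cutoff_out => //; rewrite -normrN; apply: le_trans (ler_norm _); lra.
  have -> : f x = f (- (K + 1)) by move: E; rewrite /f1 Ec mulr0 mul0r; lra.
  by apply: HC0; apply/andP; split; lra.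
exists C2 => x; have [xK|/ltW xK] := leP `|x| (K + 1).
  by apply: HC2; rewrite -ler_norml.
by have [E1 E2] := cutoff_out K0 xK; rewrite /f2 E1 E2 !mulr0 addr0 normr0.
Qed.

End TestFunction.

(** * Smooth approximations of one-sided powers *)

Section SmoothedPower.
Context {R : realType}.
Variable q : R.
Hypothesis q0 : 0 < q.
Implicit Types (dl x y e K : R).

(** Approximates [pos x] to the power q. Adding dl^2 keeps the base away from 0, so the derivative
    is continuous even for q <= 1, when that of the limit jumps or blows up at 0; the subtracted
    constant makes the function vanish on x <= 0. *)
Definition smoothed_power dl x : R :=
  (pos x ^+ 2 + dl ^+ 2) `^ (q / 2) - (dl ^+ 2) `^ (q / 2).

Definition dsmoothed_power dl x : R :=
  (pos x ^+ 2 + dl ^+ 2) `^ (q / 2 - 1) * pos x.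

Let base_gt0 dl x : 0 < dl -> 0 < pos x ^+ 2 + dl ^+ 2.
Proof. by move=> d0; rewrite ltr_wpDl ?sqr_ge0 // exprn_gt0. Qed.

Lemma derive_smoothed_power dl x : 0 < dl ->
  is_derive x 1 (smoothed_power dl) (q * dsmoothed_power dl x).
Proof.
move=> d0.
have d1 := derivef_add (derive_pos2 x) (derivef_cst (dl ^+ 2) x).
have d2 := derivef_comp (f := fun t => t `^ (q / 2)) (g := fun x => pos x ^+ 2 + dl ^+ 2) (is_derive1_powR (q / 2) (base_gt0 x d0)) d1.
apply: (derivef_eq (derivef_sub d2 (derivef_cst _ x))) => //.
by rewrite /dsmoothed_power; field.
Qed.

Lemma continuous_dsmoothed_power dl : 0 < dl -> continuous (dsmoothed_power dl).
Proof.
move=> d0 x; apply: cvgM; last exact: continuous_pos.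
apply: (continuous_compf (f := fun x => pos x ^+ 2 + dl ^+ 2) (g := fun t => t `^ (q / 2 - 1))).
  by apply: cvgD; [exact: continuous_pos2|exact: cvg_cst].
have [+ _] := is_derive1_powR (q / 2 - 1) (base_gt0 x d0).
by move=> /derivable1_diffP/differentiable_continuous.
Qed.

Lemma smoothed_power_ge0 dl x : 0 <= smoothed_power dl x.
Proof.
rewrite subr_ge0 ge0_ler_powR ?nnegrE ?addr_ge0 ?sqr_ge0 //; last by rewrite lerDr sqr_ge0.
by rewrite divr_ge0 // ltW.
Qed.

Lemma dsmoothed_power_le0 dl x : x <= 0 -> dsmoothed_power dl x = 0.
Proof. by move=> x0; rewrite /dsmoothed_power pos_le // mulr0. Qed.

Lemma dsmoothed_power_ge0 dl x : 0 <= dsmoothed_power dl x.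
Proof. by rewrite mulr_ge0 ?powR_ge0 // pos_ge0. Qed.

Let sqr_powR x r : 0 <= x -> (x ^+ 2) `^ r = x `^ (2 * r).
Proof. by move=> x0; rewrite -powR_mulrn // -powRrM. Qed.

Lemma smoothed_power_near K e : 0 <= K -> 0 < e -> exists2 d0 : R, 0 < d0 &
  forall dl, 0 < dl -> dl < d0 -> forall x, `|x| <= K ->
    `|smoothed_power dl x - pos x `^ q| <= e.
Proof.
move=> K0 e0; have q2 : 0 < q / 2 by rewrite divr_gt0.
have e20 : 0 < e / 2 by lra.
have cont : {within `[0, K ^+ 2 + 1], continuous (fun t : R => `|t| `^ (q / 2))}.
  exact/continuous_subspaceT/continuous_powR_norm.
have [d d0 H] := uniform_continuity cont e20.
exists (Num.min 1 d); first by rewrite lt_min ltr01 d0.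
move=> dl dl0; rewrite lt_min => /andP[dl1 dld] x xK.
have dl2 : dl ^+ 2 < d by apply: le_lt_trans dld; rewrite expr2; nra.
have dl21 : dl ^+ 2 <= 1 by rewrite expr_le1 // ltW.
have dl20 := sqr_ge0 dl.
have px : pos x ^+ 2 <= K ^+ 2.
  by rewrite lerXn2r ?nnegrE ?pos_ge0 //; exact: le_trans (pos_norm x) xK.
have px0 := sqr_ge0 (pos x); have K20 := sqr_ge0 K.
have h1 : `|(`|pos x ^+ 2 + dl ^+ 2| `^ (q / 2)) - (`|pos x ^+ 2| `^ (q / 2))| < e / 2.
  apply: H; [by apply/andP; split; lra|by apply/andP; split; lra|].
  by rewrite (_ : _ - _ = dl ^+ 2); [rewrite ger0_norm|ring].
have h2 : `|(`|dl ^+ 2| `^ (q / 2)) - (`|0 : R| `^ (q / 2))| < e / 2.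
  apply: H; [by apply/andP; split; lra|by apply/andP; split; lra|].
  by rewrite subr0 ger0_norm.
rewrite normr0 powR0 ?gt_eqF // subr0 (ger0_norm dl20) in h2.
rewrite (ger0_norm px0) (ger0_norm (addr_ge0 px0 dl20)) in h1.
have E : pos x `^ q = (pos x ^+ 2) `^ (q / 2).
  by rewrite sqr_powR ?pos_ge0 //; congr (_ `^ _); field.
rewrite /smoothed_power E.
rewrite (_ : _ - _ = ((pos x ^+ 2 + dl ^+ 2) `^ (q / 2) - (pos x ^+ 2) `^ (q / 2)) - (dl ^+ 2) `^ (q / 2)); last by ring.
by apply: le_trans (ler_normB _ _) _; lra.
Qed.

Let powE x : 0 < x -> (x ^+ 2) `^ (q / 2 - 1) * x = x `^ (q - 1).
Proof.
move=> x0; rewrite sqr_powR ?(ltW x0) // -[X in _ * X](powRr1 (ltW x0)) -powRD.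
  by congr (_ `^ _); field.
by rewrite (gt_eqF x0) implybT.
Qed.

Lemma dsmoothed_power_near x e : 0 < x -> 0 < e -> exists2 d0 : R, 0 < d0 &
  forall dl, 0 < dl -> dl < d0 -> `|dsmoothed_power dl x - x `^ (q - 1)| <= e.
Proof.
move=> x0 e0; have x20 : 0 < x ^+ 2 by rewrite exprn_gt0.
have [+ _] := is_derive1_powR (q / 2 - 1) x20.
move=> /derivable1_diffP/differentiable_continuous /cvgrPdist_lt.
move=> /(_ (e / x)); rewrite divr_gt0 // => /(_ isT) /nbhs_ballP [d /= d0 Hd].
exists (Num.min 1 d); first by rewrite lt_min ltr01 d0.
move=> dl dl0; rewrite lt_min => /andP[dl1 dld].
have dl2 : dl ^+ 2 < d by apply: le_lt_trans dld; rewrite expr2; nra.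
have : ball (x ^+ 2) d (x ^+ 2 + dl ^+ 2).
  by rewrite /ball /= opprD addrA subrr sub0r normrN ger0_norm ?sqr_ge0.
move=> /Hd; rewrite -powE // /dsmoothed_power pos_ge ?(ltW x0) // -mulrBl normrM (gtr0_norm x0) => h.
rewrite distrC -ler_pdivlMr //; exact: ltW.
Qed.

(** If q <= 2 the exponent q/2 - 1 is nonpositive, and removing dl^2 can only increase the power,
    which gives x^(q-1); if q > 2 the expression is bounded on ]0, K] uniformly in dl <= 1. *)
Lemma dsmoothed_power_dominated K : 0 <= K -> exists2 C : R, 0 <= C &
  forall dl x, 0 < dl -> dl <= 1 -> 0 < x -> x <= K ->
    dsmoothed_power dl x <= C + x `^ (q - 1).
Proof.
move=> K0; have [r0|r0] := leP (q / 2 - 1) 0.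
  exists 0 => // dl x dl0 _ x0 xK; rewrite add0r -powE // /dsmoothed_power pos_ge ?(ltW x0) //.
  rewrite ler_wpM2r ?(ltW x0) //.
  have -> : q / 2 - 1 = - (1 - q / 2) by ring.
  rewrite !powRN lef_pV2 ?posrE ?powR_gt0 ?exprn_gt0 //; last first.
    by rewrite ltr_wpDl ?sqr_ge0 // exprn_gt0.
  have r0' : 0 <= 1 - q / 2 by move: r0; set t := q / 2; lra.
  have h : x ^+ 2 <= x ^+ 2 + dl ^+ 2 by rewrite lerDl sqr_ge0.
  by apply: ge0_ler_powR => //; rewrite nnegrE ?addr_ge0 ?sqr_ge0.
exists ((K ^+ 2 + 1) `^ (q / 2 - 1) * K); first by rewrite mulr_ge0 ?powR_ge0.
move=> dl x dl0 dl1 x0 xK; apply: (@le_trans _ _ ((K ^+ 2 + 1) `^ (q / 2 - 1) * K)); last first.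
  by rewrite lerDl powR_ge0.
rewrite /dsmoothed_power pos_ge ?(ltW x0) //; apply: ler_pM; rewrite ?powR_ge0 ?(ltW x0) //.
have h : x ^+ 2 + dl ^+ 2 <= K ^+ 2 + 1.
  by apply: lerD; [rewrite lerXn2r ?nnegrE ?(ltW x0)|rewrite expr_le1 // ltW].
by apply: (ge0_ler_powR (ltW r0)) => //; rewrite nnegrE addr_ge0 ?sqr_ge0.
Qed.

End SmoothedPower.

(** * The scale density and approximations of the scale function *)

Section ScaleFunction.
Context {R : realType}.
Variables (k a1 a2 b1 b2 : R).
Hypothesis k0 : 0 < k.
Hypothesis a1_gt : -1 < a1.
Hypothesis a2_gt : -1 < a2.
Hypothesis b1_lt0 : b1 < 0.
Hypothesis b2_gt0 : 0 < b2.
Implicit Types (dl x y e K : R).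

Let p1 := a1 + 1.
Let p2 := a2 + 1.
Let p10 : 0 < p1. Proof. by have := a1_gt; rewrite /p1; lra. Qed.
Let p20 : 0 < p2. Proof. by have := a2_gt; rewrite /p2; lra. Qed.
Let D := drift a1 a2 b1 b2.

(** The primitive of the drift that vanishes at 0; it is nonnegative because the drift points away
    from 0. *)
Definition potential y : R :=
  b2 / p2 * pos y `^ p2 - b1 / p1 * pos (- y) `^ p1.

Definition scale_density y : R := expR (- (potential y / k)).

Let cpos_powR q : 0 < q -> continuous (fun y => pos y `^ q).
Proof.
move=> q0 y; have E : (fun y => pos y `^ q) = (fun y => `|pos y| `^ q).
  by apply/funext => z; rewrite ger0_norm // pos_ge0.
rewrite E; apply: (continuous_compf (f := pos) (g := fun t => `|t| `^ q)).
  exact: continuous_pos.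
exact: continuous_powR_norm.
Qed.

Lemma continuous_scale_density : continuous scale_density.
Proof.
have c1 : continuous (fun y => pos (- y) `^ p1).
  move=> y; apply: (continuous_compf (f := -%R) (g := fun t => pos t `^ p1)).
    exact: opp_continuous.
  exact: (cpos_powR p10).
move=> y; apply: (continuous_compf (f := fun y => - (potential y / k)) (g := expR)); last exact: continuous_expR.
apply: cvgN; apply: cvgM; last exact: cvg_cst.
by apply: cvgB; apply: cvgM; [exact: cvg_cst|exact: (cpos_powR p20)|exact: cvg_cst|exact: c1].
Qed.

Lemma potential_ge0 y : 0 <= potential y.
Proof.
apply: addr_ge0; first by rewrite mulr_ge0 ?powR_ge0 // ltW // divr_gt0.
by rewrite -mulNr mulr_ge0 ?powR_ge0 // -mulNr ltW // divr_gt0 ?oppr_gt0.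
Qed.

Lemma scale_density_le1 y : 0 < scale_density y <= 1.
Proof.
rewrite expR_gt0 /= -[X in _ <= X]expR0 ler_expR oppr_le0 divr_ge0 ?potential_ge0 //.
exact: ltW.
Qed.

Lemma scale_density_ge0 y : 0 <= y ->
  scale_density y = expR (- (b2 / (k * p2) * y `^ p2)).
Proof.
move=> y0; rewrite /scale_density /potential (pos_ge y0) (pos_le (x := - y)) ?oppr_le0 //.
rewrite (powR0 (lt0r_neq0 p10)) mulr0 subr0; congr (expR (- _)).
by field; rewrite !gt_eqF.
Qed.

Lemma scale_density_opp y : 0 <= y ->
  scale_density (- y) = expR (- (`|b1| / (k * p1) * y `^ p1)).
Proof.
move=> y0; rewrite /scale_density /potential opprK (pos_ge y0) (pos_le (x := - y)) ?oppr_le0 //.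
rewrite (powR0 (lt0r_neq0 p20)) mulr0 sub0r ltr0_norm //; congr (expR (- _)).
by field; rewrite !gt_eqF.
Qed.

Lemma scale_exists : exists2 S : R -> R, S 0 = 0 & forall x : R, is_derive x 1 S (scale_density x).
Proof. exact: antiderivative continuous_scale_density. Qed.

Let c0 := D 0.

(* The last term makes the derivative at 0 equal to [drift 0], which is [b1] rather than 0 when [a1 = 0]. *)
Definition smoothed_potential dl y : R :=
  b2 / p2 * smoothed_power p2 dl y - b1 / p1 * smoothed_power p1 dl (- y) +
  c0 * (dl ^+ 2 * y / (dl ^+ 2 + y ^+ 2)).

Definition smoothed_drift dl y : R :=
  b2 * dsmoothed_power p2 dl y + b1 * dsmoothed_power p1 dl (- y) +
  c0 * (dl ^+ 2 * (dl ^+ 2 - y ^+ 2) / (dl ^+ 2 + y ^+ 2) ^+ 2).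

Let den_gt0 dl y : 0 < dl -> 0 < dl ^+ 2 + y ^+ 2.
Proof. by move=> d0; rewrite ltr_wpDr ?sqr_ge0 // exprn_gt0. Qed.

Let derive_den dl y : is_derive y 1 (fun y => dl ^+ 2 + y ^+ 2) (2 * y).
Proof.
apply: (derivef_eq (derivef_add (derivef_cst (dl ^+ 2) y) (derivef_mul (derivef_id y) (derivef_id y)))) => //.
by ring.
Qed.

Lemma derive_smoothed_potential dl y : 0 < dl ->
  is_derive y 1 (smoothed_potential dl) (smoothed_drift dl y).
Proof.
move=> d0; have dn := den_gt0 y d0.
have e1 := derivef_mul (derivef_cst (b2 / p2) y) (derive_smoothed_power p2 y d0).
have e2 := derivef_mul (derivef_cst (b1 / p1) y)
  (derivef_comp (f := smoothed_power p1 dl) (g := fun t => - t) (derive_smoothed_power p1 (- y) d0) (derive_neg y)).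
have e3 := derivef_mul (derivef_mul (derivef_cst (dl ^+ 2) y) (derivef_id y))
  (derivef_inv (f := fun y => dl ^+ 2 + y ^+ 2) (lt0r_neq0 dn) (derive_den dl y)).
have e4 := derivef_mul (derivef_cst c0 y) e3.
apply: (derivef_eq (derivef_add (derivef_sub e1 e2) e4)) => //.
rewrite /smoothed_drift; field.
by rewrite gt_eqF ?dn // !gt_eqF.
Qed.

Lemma continuous_smoothed_drift dl : 0 < dl -> continuous (smoothed_drift dl).
Proof.
move=> d0 y; have dn := den_gt0 y d0.
have cden : continuous (fun y => dl ^+ 2 + y ^+ 2) := is_derive_continuous (derive_den dl).
apply: cvgD; first apply: cvgD.
- by apply: cvgM; [exact: cvg_cst|exact: continuous_dsmoothed_power].
- apply: cvgM; first exact: cvg_cst.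
  apply: (continuous_compf (f := -%R) (g := dsmoothed_power p1 dl)).
    exact: opp_continuous.
  exact: continuous_dsmoothed_power.
- apply: cvgM; first exact: cvg_cst.
  apply: cvgM.
    apply: cvgM; first exact: cvg_cst.
    by apply: cvgB; [exact: cvg_cst|exact: exprn_continuous].
  apply: cvgV; first by rewrite expf_neq0 // gt_eqF.
  apply: (continuous_compf (f := fun y => dl ^+ 2 + y ^+ 2) (g := fun t => t ^+ 2)); first exact: cden.
  exact: exprn_continuous.
Qed.

Let corr_le dl y : 0 < dl -> `|dl ^+ 2 * y / (dl ^+ 2 + y ^+ 2)| <= dl / 2.
Proof.
move=> d0; have dn := den_gt0 y d0.
rewrite normrM normfV (gtr0_norm dn) ler_pdivrMr // normrM (ger0_norm (sqr_ge0 _)).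
have := sqr_ge0 (dl - `|y|); rewrite -(real_normK (num_real y)).
by set v := `|y|; nra.
Qed.

Let dcorr_le dl y : 0 < dl -> `|dl ^+ 2 * (dl ^+ 2 - y ^+ 2) / (dl ^+ 2 + y ^+ 2) ^+ 2| <= dl ^+ 2 / (dl ^+ 2 + y ^+ 2).
Proof.
move=> d0; have dn := den_gt0 y d0; have y2 := sqr_ge0 y; have d2 := sqr_ge0 dl.
rewrite normrM normfV (ger0_norm (sqr_ge0 (_ + _))) normrM (ger0_norm d2).
rewrite ler_pdivrMr ?exprn_gt0 // expr2 mulrA divfK ?gt_eqF //.
by rewrite ler_wpM2l // ler_norml; apply/andP; split; lra.
Qed.

Lemma smoothed_potential_near K e : 0 <= K -> 0 < e -> exists2 d0 : R, 0 < d0 &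
  forall dl, 0 < dl -> dl < d0 -> forall y, `|y| <= K ->
    `|smoothed_potential dl y - potential y| <= e.
Proof.
move=> K0 e0.
have c20 : 0 < b2 / p2 by rewrite divr_gt0.
have c10 : 0 < - b1 / p1 by rewrite divr_gt0 // oppr_gt0.
have cc : 0 < `|c0| + 1 by have := normr_ge0 c0; lra.
have [d1 d10 H1] := smoothed_power_near p10 K0 (divr_gt0 (divr_gt0 e0 (ltr0Sn R 2)) c10).
have [d2 d20 H2] := smoothed_power_near p20 K0 (divr_gt0 (divr_gt0 e0 (ltr0Sn R 2)) c20).
exists (Num.min (e / 3 / (`|c0| + 1)) (Num.min d1 d2)).
  by rewrite !lt_min d10 d20 !andbT divr_gt0 // divr_gt0.
move=> dl dl0; rewrite !lt_min => /andP[dlc /andP[dl1 dl2]] y yK.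
have {H1} := H1 _ dl0 dl1 (- y); rewrite normrN => /(_ yK).
have {H2} := H2 _ dl0 dl2 y yK.
rewrite (ler_pdivlMr _ _ c20) (ler_pdivlMr _ _ c10) => H2 H1.
rewrite /smoothed_potential /potential.
rewrite (_ : _ - _ = b2 / p2 * (smoothed_power p2 dl y - pos y `^ p2) +
  (- b1 / p1) * (smoothed_power p1 dl (- y) - pos (- y) `^ p1) +
  c0 * (dl ^+ 2 * y / (dl ^+ 2 + y ^+ 2))); last by ring.
apply: le_trans (ler_normD _ _) _.
apply: le_trans (lerD (ler_normD _ _) (lexx _)) _.
rewrite (normrM (b2 / p2)) (normrM (- b1 / p1)) (gtr0_norm c20) (gtr0_norm c10).
have h3 : `|c0| * `|dl ^+ 2 * y / (dl ^+ 2 + y ^+ 2)| <= e / 3.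
  apply: (@le_trans _ _ ((`|c0| + 1) * dl)).
    have := corr_le y dl0; set v := `|_ / _|; have := normr_ge0 c0; set w := `|c0|.
    by have := normr_ge0 (dl ^+ 2 * y / (dl ^+ 2 + y ^+ 2)); rewrite -/v; nra.
  by move: dlc; rewrite ltr_pdivlMr // mulrC => /ltW.
rewrite (normrM c0) (mulrC (b2 / p2)) (mulrC (- b1 / p1)).
have -> : e = e / 3%:R + e / 3%:R + e / 3 by field.
by apply: lerD h3; apply: lerD; [exact: H2|exact: H1].
Qed.

Lemma smoothed_potential_ge dl y : 0 < dl -> dl <= 1 -> - `|c0| <= smoothed_potential dl y.
Proof.
move=> dl0 dl1.
have h1 : 0 <= b2 / p2 * smoothed_power p2 dl y.
  by rewrite mulr_ge0 ?smoothed_power_ge0 // ltW // divr_gt0.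
have h2 : 0 <= - (b1 / p1) * smoothed_power p1 dl (- y).
  by rewrite -mulNr mulr_ge0 ?smoothed_power_ge0 // ltW // divr_gt0 ?oppr_gt0.
have h3 : `|c0 * (dl ^+ 2 * y / (dl ^+ 2 + y ^+ 2))| <= `|c0|.
  rewrite normrM -[X in _ <= X]mulr1 ler_wpM2l //.
  by apply: le_trans (corr_le y dl0) _; lra.
move: h3; rewrite ler_norml => /andP[h3 _].
rewrite /smoothed_potential; move: h1 h2 h3; set u := b2 / p2 * _; set v := b1 / p1 * _.
by rewrite mulNr -/v; lra.
Qed.

Let drift_gt0 y : 0 < y -> D y = b2 * y `^ a2.
Proof. by move=> y0; rewrite /D /drift leNgt y0 /= gtr0_norm. Qed.

Let drift_lt0 y : y < 0 -> D y = b1 * (- y) `^ a1.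
Proof. by move=> y0; rewrite /D /drift (ltW y0) ltr0_norm. Qed.

(** Away from 0 the correction term tends to 0; at 0 it equals [D 0] while the other terms vanish.
    Convergence thus holds at every point, including the values taken at times when Y = 0. *)
Lemma drift_sub_smoothed_near y e : 0 < e -> exists2 d0 : R, 0 < d0 &
  forall dl, 0 < dl -> dl < d0 -> `|D y - smoothed_drift dl y| <= e.
Proof.
move=> e0.
have corr (v : R) : v != 0 -> exists2 d0 : R, 0 < d0 & forall dl, 0 < dl -> dl < d0 ->
   `|c0 * (dl ^+ 2 * (dl ^+ 2 - v ^+ 2) / (dl ^+ 2 + v ^+ 2) ^+ 2)| <= e / 2.
  move=> v0; have v20 : 0 < v ^+ 2 by rewrite exprn_even_gt0.
  have cc : 0 < `|c0| + 1 by have := normr_ge0 c0; lra.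
  exists (Num.min 1 (e / 2 / (`|c0| + 1) * v ^+ 2)).
    by rewrite lt_min ltr01 mulr_gt0 // !divr_gt0.
  move=> dl dl0; rewrite lt_min => /andP[dl1 dlv].
  rewrite normrM; apply: (@le_trans _ _ ((`|c0| + 1) * (e / 2 / (`|c0| + 1)))); last first.
    by rewrite mulrC divfK // gt_eqF.
  apply: ler_pM => //; first by rewrite lerDl.
  apply: le_trans (dcorr_le v dl0) _.
  rewrite ler_pdivrMr; last exact: den_gt0.
  have w0 : 0 < e / 2 / (`|c0| + 1) by rewrite !divr_gt0.
  move: dlv w0; set w := e / 2 / _ => dlv w0; have := sqr_ge0 dl.
  have : dl ^+ 2 <= dl by rewrite expr2; nra.
  by nra.
have [y0|y0|->] := ltrgt0P y.
- have [d1 d10 H1] := dsmoothed_power_near p2 y0 (divr_gt0 (divr_gt0 e0 (ltr0Sn R 1)) b2_gt0).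
  have [d2 d20 H2] := corr y (lt0r_neq0 y0).
  exists (Num.min d1 d2); first by rewrite lt_min d10 d20.
  move=> dl dl0; rewrite lt_min => /andP[dl1 dl2].
  have {H1} := H1 dl dl0 dl1; rewrite ler_pdivlMr // => H1.
  have {H2} := H2 dl dl0 dl2 => H2.
  rewrite /smoothed_drift (dsmoothed_power_le0 p1 dl (x := - y)); last by rewrite oppr_le0 ltW.
  rewrite (drift_gt0 y0).
  have -> : a2 = p2 - 1 by rewrite /p2; ring.
  rewrite (_ : _ - _ = - (dsmoothed_power p2 dl y - y `^ (p2 - 1)) * b2 - c0 * (dl ^+ 2 * (dl ^+ 2 - y ^+ 2) / (dl ^+ 2 + y ^+ 2) ^+ 2)); last by ring.
  apply: le_trans (ler_normB _ _) _; rewrite normrM normrN (gtr0_norm b2_gt0).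
  have -> : e = e / 2%:R + e / 2 by field.
  exact: lerD.
- have yN : 0 < - y by rewrite oppr_gt0.
  have b1N : 0 < - b1 by rewrite oppr_gt0.
  have [d1 d10 H1] := dsmoothed_power_near p1 yN (divr_gt0 (divr_gt0 e0 (ltr0Sn R 1)) b1N).
  have [d2 d20 H2] := corr y (ltr0_neq0 y0).
  exists (Num.min d1 d2); first by rewrite lt_min d10 d20.
  move=> dl dl0; rewrite lt_min => /andP[dl1 dl2].
  have {H1} := H1 dl dl0 dl1; rewrite ler_pdivlMr // => H1.
  have {H2} := H2 dl dl0 dl2 => H2.
  rewrite /smoothed_drift (dsmoothed_power_le0 p2 dl (x := y)); last exact: ltW.
  rewrite (drift_lt0 y0).
  have -> : a1 = p1 - 1 by rewrite /p1; ring.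
  rewrite (_ : _ - _ = (dsmoothed_power p1 dl (- y) - (- y) `^ (p1 - 1)) * - b1 - c0 * (dl ^+ 2 * (dl ^+ 2 - y ^+ 2) / (dl ^+ 2 + y ^+ 2) ^+ 2)); last by ring.
  apply: le_trans (ler_normB _ _) _; rewrite normrM (gtr0_norm b1N).
  have -> : e = e / 2%:R + e / 2 by field.
  exact: lerD.
- exists 1 => // dl dl0 _; rewrite /smoothed_drift oppr0 !dsmoothed_power_le0 // expr0n /= addr0 subr0.
  rewrite !mulr0 !add0r -expr2 divff ?expf_neq0 ?gt_eqF // mulr1 /c0 subrr normr0.
  exact: ltW.
Qed.

(** The bound is expressed through |D y|, which is what is known to be integrable along a path; the
    smoothed drift costs at most one more |D y| and a constant. *)
Lemma smoothed_drift_dominated K : 0 <= K -> exists2 C : R, 0 <= C &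
  forall dl y, 0 < dl -> dl <= 1 -> `|y| <= K -> `|D y - smoothed_drift dl y| <= C + 2 * `|D y|.
Proof.
move=> K0.
have [C1 C10 H1] := dsmoothed_power_dominated p1 K0.
have [C2 C20 H2] := dsmoothed_power_dominated p2 K0.
have b1N : 0 < - b1 by rewrite oppr_gt0.
have h1 : 0 <= - b1 * C1 by rewrite mulr_ge0 // ltW.
have h2 : 0 <= b2 * C2 by rewrite mulr_ge0 // ltW.
exists (- b1 * C1 + b2 * C2 + `|c0|); first by have := normr_ge0 c0; lra.
move=> dl y dl0 dl1 yK.
have h3 : `|c0 * (dl ^+ 2 * (dl ^+ 2 - y ^+ 2) / (dl ^+ 2 + y ^+ 2) ^+ 2)| <= `|c0|.
  rewrite normrM -[X in _ <= X]mulr1 ler_wpM2l //.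
  apply: le_trans (dcorr_le y dl0) _; rewrite ler_pdivrMr ?den_gt0 // mul1r lerDl.
  exact: sqr_ge0.
apply: le_trans (ler_normB _ _) _.
suff : `|smoothed_drift dl y| <= - b1 * C1 + b2 * C2 + `|c0| + `|D y| by lra.
rewrite /smoothed_drift; apply: le_trans (ler_normD _ _) _.
suff : `|b2 * dsmoothed_power p2 dl y + b1 * dsmoothed_power p1 dl (- y)| <= - b1 * C1 + b2 * C2 + `|D y| by lra.
have [y0|y0] := ltP 0 y.
  rewrite (dsmoothed_power_le0 p1 dl (x := - y)); last by rewrite oppr_le0 ltW.
  rewrite mulr0 addr0 normrM (gtr0_norm b2_gt0) (ger0_norm (dsmoothed_power_ge0 _ _ _)).
  rewrite (drift_gt0 y0) normrM (gtr0_norm b2_gt0) (ger0_norm (powR_ge0 _ _)).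
  have := H2 dl y dl0 dl1 y0 (le_trans (ler_norm y) yK).
  have -> : p2 - 1 = a2 by rewrite /p2; ring.
  rewrite -(ler_pM2l b2_gt0) mulrDr; set u := dsmoothed_power _ _ _; set v := y `^ _; lra.
rewrite (dsmoothed_power_le0 p2 dl y0) mulr0 add0r normrM (ltr0_norm b1_lt0) (ger0_norm (dsmoothed_power_ge0 _ _ _)).
rewrite le_eqVlt in y0; case/predU1P : y0 => [->|y0].
  rewrite oppr0 dsmoothed_power_le0 // mulr0.
  by have := normr_ge0 (D 0); lra.
have yN : 0 < - y by rewrite oppr_gt0.
rewrite (drift_lt0 y0) normrM (ltr0_norm b1_lt0) (ger0_norm (powR_ge0 _ _)).
have yK' : - y <= K by apply: le_trans yK; rewrite -normrN ler_norm.
have := H1 dl (- y) dl0 dl1 yN yK'.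
have -> : p1 - 1 = a1 by rewrite /p1; ring.
rewrite -(ler_pM2l b1N) mulrDr; set u := dsmoothed_power _ _ _; set v := (- y) `^ _; lra.
Qed.

(** Let V be the smoothed potential. With f' = exp (- V / k) on [-K, K], the generator of f reduces
    to (D - V') exp (- V / k), and inherits the pointwise convergence and the domination of D - V'.
    The bound on the first derivatives is uniform in n, for the sake of the later L^2 bounds. *)
Lemma scale_approximation (S : R -> R) K : 0 <= K -> S 0 = 0 ->
  (forall x : R, is_derive x 1 S (scale_density x)) ->
  exists (f f1 f2 : nat -> R -> R) (C1 C : R), [/\
    forall n, test_function (f n) (f1 n) (f2 n),
    forall n y, `|f1 n y| <= C1,
    forall n y, `|y| <= K -> `|generator D (f1 n) (f2 n) k y| <= C * (1 + `|D y|),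
    forall y e, `|y| <= K -> 0 < e ->
      exists N, forall n, (N <= n)%N -> `|generator D (f1 n) (f2 n) k y| <= e &
    forall e, 0 < e -> exists N, forall n, (N <= n)%N ->
      forall y, `|y| <= K -> `|f n y - S y| <= e].
Proof.
move=> K0 S0 dS.
pose dl n : R := n.+1%:R^-1.
have dl0 n : 0 < dl n by rewrite invr_gt0 ltr0n.
have dl1 n : dl n <= 1 by rewrite invf_le1 ?ler1n // ltr0n.
have dlN (d : R) : 0 < d -> exists N, forall n, (N <= n)%N -> dl n < d.
  move=> d0; exists (Num.truncn d^-1) => n Nn.
  rewrite /dl -[X in _ < X]invrK ltf_pV2 ?posrE ?invr_gt0 //.
  by apply: lt_le_trans (truncnS_gt _) _; rewrite ler_nat.
pose g n y := expR (- (smoothed_potential (dl n) y / k)).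
pose g1 n y := - (smoothed_drift (dl n) y / k) * g n y.
have dg n (y : R) : is_derive y 1 (g n) (g1 n y).
  have d1 := derivef_mul (derive_smoothed_potential y (dl0 n)) (derivef_cst k^-1 y).
  have d2 := derivef_comp (f := fun t => - t) (g := fun y => smoothed_potential (dl n) y / k) (derive_neg _) d1.
  have d3 := derivef_comp (f := expR) (g := fun y => - (smoothed_potential (dl n) y / k)) (is_derive_expR _) d2.
  by apply: (derivef_eq d3) => //; rewrite /g1 /g; ring.
have cg1 n : continuous (g1 n).
  move=> y; apply: cvgM; last exact: (is_derive_continuous (dg n)).
  by apply: cvgN; apply: cvgM; [exact: (continuous_smoothed_drift (dl0 n))|exact: cvg_cst].
have ex n := cutoff_test_function K0 (dg n) (cg1 n).
pose f n := projT1 (cid (ex n)).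
have exf n : exists f1 f2, [/\ test_function (f n) f1 f2, f n 0 = 0,
    forall x, `|f1 x| <= `|g n x| & forall x, `|x| <= K -> f1 x = g n x /\ f2 x = g1 n x].
  exact: projT2 (cid (ex n)).
pose f1 n := projT1 (cid (exf n)).
have exf1 n : exists f2, [/\ test_function (f n) (f1 n) f2, f n 0 = 0,
    forall x, `|f1 n x| <= `|g n x| & forall x, `|x| <= K -> f1 n x = g n x /\ f2 x = g1 n x].
  exact: projT2 (cid (exf n)).
pose f2 n := projT1 (cid (exf1 n)).
have H n : [/\ test_function (f n) (f1 n) (f2 n), f n 0 = 0,
    forall x, `|f1 n x| <= `|g n x| & forall x, `|x| <= K -> f1 n x = g n x /\ f2 n x = g1 n x].
  exact: projT2 (cid (exf1 n)).
(* The smoothed potentials with dl <= 1 are bounded below by - |c0|. *)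
pose C1 := expR (`|c0| / k).
have gC1 n y : 0 < g n y <= C1.
  rewrite expR_gt0 /= ler_expR -mulNr ler_pM2r ?invr_gt0 //.
  by have := smoothed_potential_ge y (dl0 n) (dl1 n); lra.
have C10 : 0 < C1 by rewrite expR_gt0.
have genE n y : `|y| <= K -> generator D (f1 n) (f2 n) k y = (D y - smoothed_drift (dl n) y) * g n y.
  move=> yK; have [_ _ _ /(_ y yK) [E1 E2]] := H n.
  by rewrite /generator E1 E2 /g1; field; rewrite gt_eqF.
have [C C0 HC] := smoothed_drift_dominated K0.
exists f, f1, f2, C1, ((C + 2) * C1); split.
- by move=> n; have [] := H n.
- move=> n y; have [_ _ /(_ y) h _] := H n; apply: le_trans h _.
  by have /andP[h1 h2] := gC1 n y; rewrite gtr0_norm.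
- move=> n y yK; rewrite genE // normrM.
  have /andP[h1 h2] := gC1 n y; rewrite (gtr0_norm h1).
  rewrite mulrAC; apply: ler_pM => //; first exact: ltW.
  apply: le_trans (HC _ _ (dl0 n) (dl1 n) yK) _.
  by have := normr_ge0 (D y); nra.
- move=> y e yK e0; have [d d0 Hd] := drift_sub_smoothed_near y (divr_gt0 e0 C10).
  have [N HN] := dlN d d0; exists N => n Nn; rewrite genE // normrM.
  have /andP[h1 h2] := gC1 n y; rewrite (gtr0_norm h1).
  have := Hd _ (dl0 n) (HN n Nn); rewrite ler_pdivlMr //; apply: le_trans.
  by rewrite ler_wpM2l.
- move=> e e0.
  have K10 : 0 < K + 1 by lra.
  (* Both f n and S vanish at 0, so on [-K, K] they differ by at most K times the gap between their
     derivatives, and that gap is at most C1 * (e' / k) when the potentials are within e' of each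
     other. *)
  pose e' := e * k / (C1 * (K + 1)).
  have e'0 : 0 < e' by rewrite divr_gt0 // mulr_gt0.
  have [d d0 Hd] := smoothed_potential_near K0 e'0.
  have [N HN] := dlN d d0; exists N => n Nn y yK.
  have [tf fn0 _ fK] := H n.
  have [c + E] := mean_value (fun z => derivef_sub (test_derive1 tf z) (dS z)) 0 y.
  rewrite fn0 S0 !subr0 in E; rewrite E => cy.
  have cK : `|c| <= K.
    apply: le_trans yK; move: cy; rewrite /Num.min /Num.max; case: ifP => y0 /andP[h1 h2].
      by rewrite !ger0_norm //; lra.
    by rewrite !ler0_norm //; lra.
  have [-> _] := fK c cK.
  have V1 := smoothed_potential_ge c (dl0 n) (dl1 n).
  have V2 := potential_ge0 c.
  have := Hd _ (dl0 n) (HN n Nn) c cK.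
  set V := smoothed_potential (dl n) c in V1 *; set U := potential c in V2 * => VU.
  have [t + Et] := mean_value (@is_derive_expR R) (- (U / k)) (- (V / k)).
  rewrite ge_min le_max => /andP[_ tU].
  have tC : expR t <= C1.
    rewrite ler_expR; case/orP: tU => h; apply: le_trans h _; rewrite -mulNr ler_pM2r ?invr_gt0 //.
      by have := normr_ge0 c0; lra.
    by lra.
  have -> : g n c - scale_density c = expR t * (- (V / k) - - (U / k)) by rewrite -Et.
  rewrite !normrM (ger0_norm (expR_ge0 t)).
  have -> : - (V / k) - - (U / k) = - (V - U) / k by ring.
  rewrite normrM normrN normfV (gtr0_norm k0).
  apply: (@le_trans _ _ (C1 * (e' / k) * (K + 1))).
    apply: ler_pM => //; first by rewrite mulr_ge0 ?expR_ge0 // divr_ge0 // ltW.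
      apply: ler_pM; rewrite ?expR_ge0 //; first by rewrite divr_ge0 // ltW.
      by rewrite ler_pM2r ?invr_gt0.
    by lra.
  rewrite le_eqVlt /e'; apply/orP; left; apply/eqP; field.
  by rewrite !gt_eqF.
Qed.

End ScaleFunction.

(** * The stopped process on a grid *)

Section HeatUniform.
Context {R : realType}.

(** Close to y, f2 varies little by uniform continuity on the enlarged interval; at distance dd or
    more, the crude bound 2 C2 is absorbed by C (x - y)^2 with C = 2 C2 / dd^2. This is the modulus
    that the Taylor expansion asks for, uniformly in y. *)
Lemma heat_uniform (sigma lo hi e : R) (f f1 f2 : R -> R) : 0 < sigma ->
  test_function f f1 f2 -> 0 < e -> exists2 h0 : R, 0 < h0 &
  forall h, 0 < h -> h < h0 -> forall y, lo <= y <= hi ->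
    `|normal_average (sigma * Num.sqrt h) f y - f y - sigma ^+ 2 / 2 * h * f2 y| <= e * h.
Proof.
move=> s0 [d1 d2 c2 [C0 fC0] [C2 fC2]] e0.
have s20 : 0 < sigma ^+ 2 by rewrite exprn_gt0.
have e20 : 0 < e / 2 / sigma ^+ 2 by rewrite !divr_gt0.
have C20 : 0 <= C2 by apply: le_trans (fC2 0).
have [d d0 Hd] := uniform_continuity (continuous_subspaceT c2 : {within `[lo - 1, hi + 1], continuous f2}) e20.
pose dd := Num.min d 1.
have dd0 : 0 < dd by rewrite lt_min d0 ltr01.
pose C := 2 * C2 / dd ^+ 2.
have Cge0 : 0 <= C.
  by apply: divr_ge0; [exact: mulr_ge0|exact: sqr_ge0].
have H y x : lo <= y <= hi -> `|f2 x - f2 y| <= e / 2 / sigma ^+ 2 + C * (x - y) ^+ 2.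
  move=> /andP[y1 y2]; have [xy|xy] := ltP `|x - y| dd.
    move: xy; rewrite lt_min => /andP[xyd].
    rewrite ltr_norml => /andP[x1 x2].
    apply: (@le_trans _ _ (e / 2 / sigma ^+ 2)); last by rewrite lerDl mulr_ge0 ?sqr_ge0.
    by apply/ltW/Hd => //; apply/andP; split; lra.
  apply: (@le_trans _ _ (C * (x - y) ^+ 2)); last by rewrite lerDr ltW.
  apply: (@le_trans _ _ (2 * C2)).
    by apply: le_trans (ler_normB _ _) _; rewrite mulr2n mulrDl !mul1r; exact: lerD.
  rewrite /C -(real_normK (num_real (x - y))) mulrAC -mulrA ler_peMr ?mulr_ge0 //.
  rewrite ler_pdivlMr ?exprn_gt0 // mul1r.
  by rewrite lerXn2r ?nnegrE // ltW.
exists (e / 2 / (3 * (C + 1) * sigma ^+ 4)).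
  by rewrite !divr_gt0 // mulr_gt0 ?exprn_gt0 // mulr_gt0 //; lra.
move=> h h0 hlt y yin.
have sh : 0 < sigma * Num.sqrt h by rewrite mulr_gt0 // sqrtr_gt0.
have := heat_increment_le sh d1 d2 fC0 Cge0 (fun x => H y x yin).
have E2 : (sigma * Num.sqrt h) ^+ 2 = sigma ^+ 2 * h by rewrite exprMn sqr_sqrtr // ltW.
have E4 : (sigma * Num.sqrt h) ^+ 4 = sigma ^+ 4 * h ^+ 2.
  by rewrite (exprM _ 2 2) E2; ring.
rewrite E2 E4 -/(normal_average _ _ _) => T.
rewrite (_ : sigma ^+ 2 / 2 * h * f2 y = sigma ^+ 2 * h * f2 y / 2); last by ring.
apply: le_trans T _.
rewrite mulrA divfK ?gt_eqF //.
have s40 : 0 < sigma ^+ 4 by rewrite exprn_gt0.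
have : h * (3 * (C + 1) * sigma ^+ 4) < e / 2.
  by rewrite -ltr_pdivlMr // mulr_gt0 // mulr_gt0 //; lra.
set S := sigma ^+ 4 in s40 *; move=> hh.
have hS : 0 <= h * S by rewrite mulr_ge0 // ltW.
have k1 : C * (3 * S * h) <= e / 2 by nra.
have -> : C * (3 * (S * h ^+ 2)) = C * (3 * S * h) * h by ring.
have : C * (3 * S * h) * h <= e / 2 * h by rewrite ler_pM2r.
lra.
Qed.

End HeatUniform.

(** * The process on a grid, stopped at its exit from an interval *)

Section Process.
Context d (T : measurableType d) (R : realType).
Variables (P : probability T R) (F : R -> set (set T)).
Variables (sigma a1 a2 b1 b2 : R) (B X : R -> T -> R) (zeta : T -> \bar R).
Hypothesis filtrationF : filtration F.
Hypothesis brownianB : brownian_motion P F sigma B.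
Hypothesis solutionX : solution P F B a1 a2 b1 b2 X zeta.
Local Notation TF t := (g_sigma_algebraType (F t)).
Let D := drift a1 a2 b1 b2.
Let mu := @lebesgue_measure R.

Definition alive (t : R) : set T := [set w | (t%:E < zeta w)%E].

Definition regular_path w :=
  [/\ B 0 w = 0, {within `[0, +oo[, continuous (B ^~ w)}, (0 < zeta w)%E,
     forall t : R, 0 <= t -> (t%:E < zeta w)%E ->
        mu.-integrable `[0, t] (fun s => (D (X s w - B s w))%:E) /\
        X t w = \int[mu]_(s in `[0, t]) D (X s w - B s w) &
     (zeta w < +oo)%E -> `|X t w| @[t --> (fine (zeta w))^'-] --> +oo].

Lemma ae_regular_path : {ae P, forall w, regular_path w}.
Proof.
have [_ B0 cB _ _] := brownianB; have [_ z0 XE Xoo] := solutionX.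
by near=> w; split; near: w.
Unshelve. all: by end_near. Qed.

(** The process Y, extended by 0 past the explosion time, where X is arbitrary; the extension is
    adapted at all times. *)
Definition live_difference t w : R := if `[< alive t w >] then X t w - B t w else 0.

Let sigF t : 0 <= t -> sigma_algebra [set: T] (F t).
Proof. by have [h _ _] := filtrationF; exact: h. Qed.

Let monoF s t : 0 <= s -> s <= t -> F s `<=` F t.
Proof. by have [_ _ h] := filtrationF; exact: h. Qed.

Lemma adapted_alive t : 0 <= t -> F t (alive t).
Proof.
move=> t0; have [h _ _ _] := solutionX.
by have := h t setT t0 measurableT; rewrite preimage_setT setIT.
Qed.

Let mF t (A : set T) : 0 <= t -> F t A -> measurable (A : set (TF t)).
Proof. by move=> t0 FA; rewrite measurable_subalgebraE; [exact: FA|exact: sigF]. Qed.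

Let Fm t (A : set T) : 0 <= t -> measurable (A : set (TF t)) -> F t A.
Proof. by move=> t0; rewrite measurable_subalgebraE; [|exact: sigF]. Qed.

Lemma adapted_brownian t : 0 <= t -> measurable_fun [set: TF t] (B t).
Proof.
move=> t0 _ C mC; rewrite setTI; apply: mF => //.
by have [h _ _ _ _] := brownianB; exact: h.
Qed.

Lemma adapted_live_difference t : 0 <= t -> measurable_fun [set: TF t] (live_difference t).
Proof.
move=> t0; have mA : measurable (alive t : set (TF t)) := mF t0 (adapted_alive t0).
have mX : measurable_fun [set: TF t] (fun w => if `[< alive t w >] then X t w else 0).
  move=> _ C mC; rewrite setTI.
  rewrite (_ : _ @^-1` C = (alive t `&` X t @^-1` C) `|` (~` alive t `&` [set w | C 0])).
    apply: measurableU.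
      by apply: mF => //; have [h _ _ _] := solutionX; exact: h.
    apply: measurableI; first exact: measurableC.
    by have [C0|nC0] := pselect (C 0); [rewrite (_ : [set _ | _] = setT)|rewrite (_ : [set _ | _] = set0)] => //;
      apply/seteqP; split.
  apply/seteqP; split => w /=; case: asboolP => aw; first by left.
  - by right.
  - by case=> -[].
  - by case=> -[].
have mB : measurable_fun [set: TF t] (fun w => \1_(alive t) w * B t w).
  by apply: measurable_funM; [exact: measurable_indic|exact: adapted_brownian].
rewrite (_ : live_difference t = fun w => (if `[< alive t w >] then X t w else 0) - \1_(alive t) w * B t w).
  exact: measurable_funB.
apply/funext => w; rewrite /live_difference indicE; case: asboolP => aw.
  by rewrite mem_set // mul1r.
by rewrite memNset // mul0r subr0.
Qed.

Section Grid.
Variables (A : set T) (u h lo hi : R).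
Hypothesis u0 : 0 <= u.
Hypothesis h0 : 0 < h.
Hypothesis FA : F u A.
Hypothesis lohi : lo <= hi.

Definition grid (j : nat) : R := u + j%:R * h.

Definition inside j : set T := [set w | alive (grid j) w /\ lo <= live_difference (grid j) w <= hi].

(** The event, known at grid time n, that the stopped process still takes the step from n to n +
    1. *)
Definition active n : set T := [set w | A w /\ forall j, (j <= n)%N -> inside j w].

Lemma grid_ge0 j : 0 <= grid j.
Proof. by rewrite addr_ge0 // mulr_ge0 // ltW. Qed.

Lemma grid_le i j : (i <= j)%N -> grid i <= grid j.
Proof. by move=> ij; rewrite lerD2l ler_pM2r // ler_nat. Qed.

Lemma gridS j : grid j.+1 = grid j + h.
Proof. by rewrite /grid -natr1; ring. Qed.

Lemma adapted_inside j : F (grid j) (inside j).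
Proof.
have g0 := grid_ge0 j; apply: Fm => //; apply: measurableI; first exact: (mF g0 (adapted_alive g0)).
rewrite (_ : (fun w => _) = live_difference (grid j) @^-1` `[lo, hi]%classic); last first.
  by apply/seteqP; split => w /=; rewrite in_itv.
by rewrite -[X in measurable X]setTI; apply: adapted_live_difference => //; exact: measurable_itv.
Qed.

Lemma adapted_active n : F (grid n) (active n).
Proof.
have g0 := grid_ge0 n; apply: Fm => //.
rewrite (_ : active n = A `&` \bigcap_(j in [set j | (j <= n)%N]) inside j); last first.
  by apply/seteqP; split => w; case.
apply: measurableI; first by apply: mF => //; apply: monoF FA => //; rewrite -[X in X <= _]addr0 -(mul0r h) (grid_le (leq0n n)).
apply: bigcap_measurable => [|j jn]; first by exists 0%N.
apply: mF => //; apply: monoF (adapted_inside j); [exact: grid_ge0|exact: grid_le].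
Qed.

Lemma active_mono i j w : (i <= j)%N -> active j w -> active i w.
Proof. by move=> ij [Aw H]; split=> // k ki; apply: H; exact: leq_trans ij. Qed.

(** The active indices form an initial segment; its length kap is the grid index at which the
    stopped process rests, and kap = n if no exit is seen before. *)
Lemma exit_index n w : exists2 kap, (kap <= n)%N &
  forall j, (j < n)%N -> (active j w <-> (j < kap)%N).
Proof.
elim: n => [|n [kap kn H]]; first by exists 0%N.
have [an|nan] := pselect (active n w).
  exists n.+1 => // j jn; split => // _.
  by apply: active_mono an.
exists kap; first exact: leqW.
move=> j; rewrite ltnS leq_eqVlt => /predU1P[->|]; last exact: H.
by split => // nk; rewrite ltnNge kn in nk.
Qed.

(** At the grid point of exit the process may be far outside the interval, or dead; clamping keeps
    the gain bounded for every mesh. Along a given regular path it has no effect once the mesh is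
    fine, since Y then moves by less than 1 per step. *)
Definition clamp (y : R) : R := Num.max (lo - 1) (Num.min y (hi + 1)).

Lemma clamp_in y : lo - 1 <= clamp y <= hi + 1.
Proof. by rewrite /clamp le_max lexx /= ge_max ge_min lexx orbT andbT; have := lohi; lra. Qed.

Lemma clamp_id y : lo - 1 <= y <= hi + 1 -> clamp y = y.
Proof. by move=> /andP[y1 y2]; rewrite /clamp (min_idPl y2) (max_idPr y1). Qed.

Definition gain (f : R -> R) n w : R :=
  \sum_(j < n) \1_(active j) w * (f (clamp (live_difference (grid j.+1) w)) -
                                  f (clamp (live_difference (grid j) w))).

Lemma sum_active (g : nat -> R) n w kap : (kap <= n)%N ->
  (forall j, (j < n)%N -> (active j w <-> (j < kap)%N)) ->
  \sum_(j < n) \1_(active j) w * g j = \sum_(j < kap) g j.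
Proof.
move=> kn H; rewrite [RHS](big_ord_widen n g kn) [RHS]big_mkcond /=; apply: eq_bigr => j _.
rewrite indicE; case: ifPn => jk.
  by rewrite mem_set ?mul1r //; apply/H.
by rewrite memNset ?mul0r // => /(H j (ltn_ord j)); apply/negP.
Qed.

Lemma gainE f n w kap : (kap <= n)%N ->
  (forall j, (j < n)%N -> (active j w <-> (j < kap)%N)) ->
  gain f n w = f (clamp (live_difference (grid kap) w)) - f (clamp (live_difference (grid 0) w)).
Proof.
move=> kn H; rewrite /gain (sum_active (fun j => f (clamp (live_difference (grid j.+1) w)) - f (clamp (live_difference (grid j) w))) kn H).
by rewrite -(big_mkord xpredT (fun j => f (clamp (live_difference (grid j.+1) w)) - f (clamp (live_difference (grid j) w)))) telescope_sumr.
Qed.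

(** The gain telescopes to the variation of f (Y) up to the exit; what is left without its
    martingale part is a Riemann sum for the integral of the generator. *)
Definition defect (f : R -> R) n w : R := gain f n w -
  martingale (fun j => \1_(active j)) (fun j => live_difference (grid j))
    (fun j w => B (grid j.+1) w - B (grid j) w) (sigma * Num.sqrt h) f n w.

End Grid.
End Process.

Lemma mesh_small (R : realType) (l dl : R) : 0 <= l -> 0 < dl ->
  exists M, forall m, (M <= m)%N -> l / m.+1%:R < dl.
Proof.
move=> l0 dl0; exists (Num.truncn (l / dl)) => m Mm.
rewrite ltr_pdivrMr ?ltr0n // mulrC -ltr_pdivrMr //.
by apply: lt_le_trans (truncnS_gt _) _; rewrite ler_nat.
Qed.

(** * The grid sums along a single path *)

Section Pathwise.
Context d (T : measurableType d) (R : realType).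
Variables (a1 a2 b1 b2 : R) (B X : R -> T -> R) (zeta : T -> \bar R) (w : T).
Hypothesis regw : regular_path a1 a2 b1 b2 B X zeta w.
Let D := drift a1 a2 b1 b2.
Let mu := @lebesgue_measure R.
Let y t := X t w - B t w.

Lemma alive_le s t : s <= t -> alive zeta t w -> alive zeta s w.
Proof. by move=> st; apply: le_lt_trans; rewrite lee_fin. Qed.

Lemma live_differenceE t : alive zeta t w -> live_difference B X zeta t w = y t.
Proof. by move=> lt; rewrite /live_difference asboolT. Qed.

Lemma regular_integrable c : 0 <= c -> alive zeta c w ->
  mu.-integrable `[0, c] (EFin \o (fun s => D (y s))).
Proof. by move=> c0 lc; have [_ _ _ /(_ c c0 lc) [] + _ _] := regw. Qed.

Lemma regular_integral c : alive zeta c w -> forall t, 0 <= t <= c ->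
  X t w = \int[mu]_(s in `[0, t]) D (y s).
Proof.
move=> lc t /andP[t0 tc].
by have [_ _ _ /(_ t t0 (alive_le tc lc)) [_ +] _] := regw.
Qed.

Lemma regular_brownian c : {within `[0, c], continuous (B ^~ w)}.
Proof.
have [_ cB _ _ _] := regw; apply: continuous_subspaceW cB => t /=.
by rewrite !in_itv /= andbT => /andP[].
Qed.

Lemma regular_continuous c : 0 <= c -> alive zeta c w -> {within `[0, c], continuous y}.
Proof.
move=> c0 lc; exact: (path_difference_continuous c0 (regular_integrable c0 lc)
  (regular_integral lc) (@regular_brownian c)).
Qed.

Variables (A : set T) (u lo hi : R).
Hypothesis u0 : 0 <= u.
Hypothesis lu : alive zeta u w.

(* Before its explosion time the path leaves [lo, hi], so the part of the path seen by fine grids stays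
   in a compact time interval on which it is alive. *)
Lemma horizon l : 0 < l -> exists c, [/\ u <= c, alive zeta c w &
  exists M, forall m, (M <= m)%N -> forall kap, (kap <= m.+1)%N ->
    (forall j, (j < kap)%N -> inside B X zeta u (l / m.+1%:R) lo hi j w) ->
    grid u (l / m.+1%:R) kap <= c].
Proof.
move=> l0; have [al|dead] := pselect (alive zeta (u + l) w).
  exists (u + l); split => //; first by rewrite lerDl ltW.
  exists 0%N => m _ kap km _; rewrite /grid lerD2l mulrCA ger_pMr //.
  by rewrite ler_pdivrMr ?ltr0n // mul1r ler_nat.
have zle : (zeta w <= (u + l)%:E)%E by rewrite leNgt; apply/negP.
have zfin : zeta w \is a fin_num.
  by rewrite fin_numE; apply/andP; split; apply/eqP => zE; move: lu zle; rewrite /alive /= zE.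
pose z := fine (zeta w).
have zE : zeta w = z%:E by rewrite fineK.
have aliveE t : alive zeta t w <-> t < z by rewrite /alive /= zE lte_fin.
have uz : u < z by apply/aliveE.
have [C C0 HC] := compact_bounded_norm (@regular_brownian (u + l)).
have [_ _ _ _ /(_ _)] := regw; rewrite zE ltry => /(_ isT).
(* Together with |B| <= C, such a lower bound on |X| forces |Y| > |lo| + |hi|, which is outside
   [lo, hi]. *)
rewrite -zE -/z => /cvgryPge /(_ (C + `|lo| + `|hi| + 1)).
rewrite /at_left near_withinE => -[dl /= dl0 Hdl].
pose t0 := Num.max u (z - dl).
have t0z : t0 < z by rewrite gt_max uz /= ltrBlDr ltrDl.
have ut0 : u <= t0 by rewrite le_max lexx.
have t0dl : z - dl <= t0 by rewrite le_max lexx orbT.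
have large t : t0 < t -> t < z -> ~ lo <= y t <= hi.
  move=> t1 t2 /andP[y1 y2].
  have XC : C + `|lo| + `|hi| + 1 <= `|X t w|.
    apply: Hdl => //; rewrite /ball_ /= ltr_norml; apply/andP; split; lra.
  have zul : z <= u + l by rewrite -lee_fin -zE.
  have BC : `|B t w| <= C by have u0' := u0; apply: HC; apply/andP; split; lra.
  have : `|X t w| <= `|y t| + `|B t w|.
    by apply: le_trans (ler_normD _ _); rewrite subrK.
  have : `|y t| <= `|lo| + `|hi|.
    have := ler_norm hi; have := ler_norm (- lo); rewrite normrN => h1 h2.
    have := normr_ge0 hi; have := normr_ge0 lo => h3 h4.
    by rewrite ler_norml; apply/andP; split; lra.
  by lra.
(* The last grid point seen inside [lo, hi] is at most t0; with a mesh below (z - t0) / 2 the next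
   one is still before this midpoint. *)
exists ((t0 + z) / 2); split; [lra|by apply/aliveE; lra|].
have [M HM] := mesh_small (ltW l0) (dl := (z - t0) / 2) ltac:(lra).
exists M => m /HM; set h := l / _ => hs [|j] km Hin; first by rewrite /grid mul0r addr0; lra.
have [/aliveE gz] := Hin j (ltnSn j).
rewrite live_differenceE ?aliveE // => yin.
have : grid u h j <= t0 by rewrite leNgt; apply/negP => /large /(_ gz yin).
by rewrite gridS; lra.
Qed.

Variables (sigma : R) (f f1 f2 : R -> R).
Hypothesis sigma0 : 0 < sigma.
Hypothesis tf : test_function f f1 f2.
Let k := sigma ^+ 2 / 2.
Let gen := generator D f1 f2 k.
Let I t := \int[mu]_(r in `[0, t]) gen (y r).

(** On a fine mesh the clamps are inactive, and the defect is exactly the sum of [path_sum] with q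
    the one-step heat increment of f. The bounds on Y hold at all times up to the exit, not only on
    the grid, because the integral of the generator runs over all of them. *)
Lemma path_defect c l e : 0 < l -> u <= c -> alive zeta c w -> 0 < e ->
  (exists M, forall m, (M <= m)%N -> forall kap, (kap <= m.+1)%N ->
    (forall j, (j < kap)%N -> inside B X zeta u (l / m.+1%:R) lo hi j w) ->
    grid u (l / m.+1%:R) kap <= c) ->
  A w -> lo <= y u <= hi ->
  exists M, forall m, (M <= m)%N -> forall kap, (kap <= m.+1)%N ->
    (forall j, (j < m.+1)%N -> (active B X zeta A u (l / m.+1%:R) lo hi j w <-> (j < kap)%N)) ->
    [/\ u <= grid u (l / m.+1%:R) kap <= c,
        `|defect sigma B X zeta A u (l / m.+1%:R) lo hi f m.+1 w - (I (grid u (l / m.+1%:R) kap) - I u)| <= e &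
        forall r, u <= r <= grid u (l / m.+1%:R) kap -> lo - 1 <= y r <= hi + 1].
Proof.
move=> l0 uc lc e0 [M0 HM0] Aw yu.
have c0 : 0 <= c by apply: le_trans uc.
have ia := regular_integrable c0 lc; have xE := regular_integral lc.
have cb := @regular_brownian c.
have [f_1 f_2 cf2 _ [C2 fC2]] := tf; have [C1 fC1] := test_bound1 tf.
have k0 : 0 <= k by rewrite divr_ge0 // sqr_ge0.
pose Lam t := \int[mu]_(r in `[0, t]) `|D (y r)|.
have Lam_mono s t : 0 <= s -> s <= t -> t <= c -> Lam s <= Lam t.
  by move=> s0 st tc; apply: (primitive_norm_mono ia s0 st tc).
have Lamuc := Lam_mono u c u0 uc (lexx c).
(* An upper bound for the weights by which [path_sum] multiplies its error, so that the error e / N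
   suffices; the final 1 makes it positive. *)
pose N := Lam c - Lam u + (k + 1) * l + 1.
have N0 : 0 < N by rewrite /N; have := mulr_ge0 (addr_ge0 k0 ler01) (ltW l0); lra.
have e'0 : 0 < e / N by rewrite divr_gt0.
have [d1 d10 H1] := path_sum c0 ia xE cb f_1 f_2 cf2 fC1 fC2 k0 u0 e'0.
have [d2 d20 H2] := heat_uniform lo hi sigma0 tf e'0.
have [d3 d30 H3] := uniform_continuity (regular_continuous c0 lc) ltr01.
have [M1 HM1] := mesh_small (ltW l0) d10.
have [M2 HM2] := mesh_small (ltW l0) d20.
have [M3 HM3] := mesh_small (ltW l0) d30.
exists (M0 + M1 + M2 + M3)%N => m Mm kap km Hkap.
have h0 : 0 < l / m.+1%:R by rewrite divr_gt0.
have /HM1 hd1 : (M1 <= m)%N by apply: leq_trans Mm; rewrite -!addnA addnCA leq_addr.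
have /HM2 hd2 : (M2 <= m)%N by apply: leq_trans Mm; rewrite -addnA addnCA leq_addr.
have /HM3 hd3 : (M3 <= m)%N by apply: leq_trans Mm; rewrite leq_addl.
have /HM0 {HM0} : (M0 <= m)%N by apply: leq_trans Mm; rewrite -!addnA leq_addr.
have hm : m.+1%:R * (l / m.+1%:R) = l by rewrite mulrC divfK // pnatr_eq0.
move: h0 hm hd1 hd2 hd3 Hkap; set h := l / m.+1%:R => h0 hm hd1 hd2 hd3 Hkap Hc.
have act j : (j < kap)%N -> active B X zeta A u h lo hi j w.
  by move=> jk; apply/Hkap => //; exact: leq_trans km.
have ins j : (j < kap)%N -> inside B X zeta u h lo hi j w.
  by move=> /act [_ H]; exact: H.
have gc := Hc kap km ins.
have kap0 : (0 < kap)%N.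
  apply/(Hkap 0%N (ltn0Sn m)); split => // j; rewrite leqn0 => /eqP ->.
  by rewrite /inside /= /grid mul0r addr0; split => //; rewrite live_differenceE.
have gu j : u <= grid u h j by rewrite /grid lerDl mulr_ge0 // ltW.
have gjc j : (j <= kap)%N -> grid u h j <= c.
  by move=> jk; apply: le_trans gc; apply: grid_le.
have lg j : (j <= kap)%N -> alive zeta (grid u h j) w.
  by move=> /gjc jc; exact: alive_le lc.
have ldE j : (j <= kap)%N -> live_difference B X zeta (grid u h j) w = y (grid u h j).
  by move=> /lg; exact: live_differenceE.
have yin j : (j < kap)%N -> lo <= y (grid u h j) <= hi.
  by move=> jk; have [_] := ins j jk; rewrite ldE // ltnW.
have near_grid r : u <= r <= grid u h kap -> exists2 j, (j < kap)%N & `|r - grid u h j| <= h.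
  move=> /andP[ur rg].
  have [rE|rlt] := eqVneq r (grid u h kap).
    exists kap.-1; first by rewrite prednK.
    by rewrite rE -{1}(prednK kap0) gridS addrAC subrr add0r gtr0_norm.
  have {rlt} rlt : r < grid u h kap by rewrite lt_neqAle rlt.
  have q0 : 0 <= (r - u) / h by rewrite divr_ge0 ?subr_ge0 // ltW.
  exists (Num.truncn ((r - u) / h)).
    rewrite truncn_lt_nat //.
    by rewrite ltr_pdivrMr // ltrBlDl.
  have /andP[] := truncn_itv q0; set n := Num.truncn _.
  rewrite ler_pdivlMr // ltr_pdivrMr // -natr1 mulrDl mul1r /grid.
  move=> q1 q2; have [|+ _] := @itv_dist_le R (u + n%:R * h) (u + n%:R * h + h) r.
    by rewrite addrC -lerBrDr q1 addrC -addrA -lerBlDl ltW.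
  by rewrite distrC [X in _ <= X]addrAC subrr add0r.
have yr r : u <= r <= grid u h kap -> lo - 1 <= y r <= hi + 1.
  move=> rin; have [j jk rj] := near_grid r rin.
  have /andP[ur rg] := rin.
  apply: itv_enlarge (yin j jk) _; apply: H3; last exact: le_lt_trans rj hd3.
    by rewrite (le_trans u0 ur) (le_trans rg gc).
  by rewrite gjc ?(ltnW jk) // (le_trans u0 (gu j)).
split => //; first by rewrite gu gc.
have grid_in j : (j <= kap)%N -> u <= grid u h j <= grid u h kap.
  by move=> jk; rewrite gu grid_le.
pose q j := normal_average (sigma * Num.sqrt h) f (y (grid u h j)) - f (y (grid u h j)).
have := H1 h kap q h0 hd1 (fun j jk => gjc j.+1 jk) _.
have Hq j : (j < kap)%N -> `|q j - k * h * f2 (y (u + j%:R * h))| <= e / N * h.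
  by move=> jk; apply: (H2 h h0 hd2 _ (yin j jk)).
move=> /(_ Hq) /=.
rewrite -!/(grid u h _).
have -> : \sum_(j < kap) (f (X (grid u h j.+1) w - B (grid u h j.+1) w) -
      f (X (grid u h j) w - B (grid u h j.+1) w) + q j) =
    defect sigma B X zeta A u h lo hi f m.+1 w.
  rewrite /defect /gain /martingale -sumrB.
  rewrite [RHS](_ : _ = \sum_(j < m.+1) \1_(active B X zeta A u h lo hi j) w *
     (f (clamp lo hi (live_difference B X zeta (grid u h j.+1) w)) -
      f (clamp lo hi (live_difference B X zeta (grid u h j) w)) -
      increment (fun j => live_difference B X zeta (grid u h j))
        (fun j w => B (grid u h j.+1) w - B (grid u h j) w) (sigma * Num.sqrt h) f j w)); last first.
    by apply: eq_bigr => j _; rewrite [RHS]mulrBr.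
  rewrite (sum_active (fun j => f (clamp lo hi (live_difference B X zeta (grid u h j.+1) w)) -
      f (clamp lo hi (live_difference B X zeta (grid u h j) w)) -
      increment (fun j => live_difference B X zeta (grid u h j))
        (fun j w => B (grid u h j.+1) w - B (grid u h j) w) (sigma * Num.sqrt h) f j w) km Hkap).
  apply: eq_bigr => -[j jk] _ /=; rewrite /increment !ldE ?(ltnW jk) //.
  rewrite !clamp_id ?yr ?grid_in ?(ltnW jk) // /q.
  rewrite (_ : y (grid u h j) - (B (grid u h j.+1) w - B (grid u h j) w) =
    X (grid u h j) w - B (grid u h j.+1) w); last by rewrite /y; ring.
  by rewrite /y; ring.
move=> /le_trans; apply.
have hk : kap%:R * h <= l by rewrite -hm ler_pM2r // ler_nat.
have Lk := Lam_mono _ c (le_trans u0 (gu kap)) gc (lexx c).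
apply: (@le_trans _ _ (e / N * N)); last by rewrite divfK // gt_eqF.
rewrite ler_pM2l // -/(Lam _) -/(Lam _).
have := ler_wpM2l (addr_ge0 k0 ler01) hk; rewrite /N.
by move: Lk; set L1 := Lam (grid _ _ _); lra.
Qed.

End Pathwise.

(** * Expectations *)

(** Dominated convergence over the set E of times at which |y| <= K. Any ]u, t] as in the conclusion
    lies in E, so the integral of the absolute value over E bounds all these integrals at once; the
    exit time, which depends on the mesh, can then be substituted for t. *)
Lemma generator_vanishes (R : realType) (y Dy : R -> R) (gen : nat -> R -> R) (c C K eps : R) :
  let mu := @lebesgue_measure R in
  measurable_fun `[0, c] y -> mu.-integrable `[0, c] (EFin \o Dy) ->
  (forall n, mu.-integrable `[0, c] (EFin \o (fun r => gen n (y r)))) ->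
  (forall n r, `|y r| <= K -> `|gen n (y r)| <= C * (1 + `|Dy r|)) ->
  (forall z e, `|z| <= K -> 0 < e -> exists N, forall n, (N <= n)%N -> `|gen n z| <= e) ->
  0 < eps -> exists N, forall n, (N <= n)%N -> forall u t, 0 <= u -> u <= t -> t <= c ->
    (forall r, u <= r <= t -> `|y r| <= K) ->
    `|\int[mu]_(r in `[0, t]) gen n (y r) - \int[mu]_(r in `[0, u]) gen n (y r)| <= eps.
Proof.
move=> mu my iD ig dom ptw eps0.
pose E : set R := `[0, c] `&` y @^-1` `[- K, K]%classic.
have mE : measurable (E : set (measurableTypeR R)) by apply: my => //; exact: measurable_itv.
have EK r : E r <-> 0 <= r <= c /\ `|y r| <= K.
  by rewrite /E /= !in_itv /= -ler_norml; split=> -[].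
have Ec : E `<=` [set` `[0, c]] by move=> r [].
have igE n : mu.-integrable E (EFin \o (fun r => gen n (y r))).
  by apply: integrableS (ig n) => //; exact: measurable_itv.
have inE n := integrable_norm (igE n).
pose g r := C * (1 + `|Dy r|).
have igg : mu.-integrable E (EFin \o g).
  apply: (integrable_scale mE); apply: (integrable_add mE).
    suff i1 : mu.-integrable `[0, c] (EFin \o (fun=> 1)) by apply: integrableS i1 => //; exact: measurable_itv.
    by apply: continuous_compact_integrable; [exact: segment_compact|apply: continuous_subspaceT => z; exact: cvg_cst].
  by apply: integrableS (integrable_norm iD) => //; exact: measurable_itv.
have cv : (\int[mu]_(r in E) (`|gen n (y r)|)%:E)%E @[n --> \oo] --> (\int[mu]_(r in E) (cst 0%E) r)%E.
  apply: (dominated_cvg mE _ _ _ igg) => //.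
  - by move=> n; have /integrableP[] := inE n.
  - move=> r /EK[_ yK]; apply: cvg_EFin; first by near=> n.
    apply/cvgrPdist_le => e e0; have [N HN] := ptw _ _ yK e0.
    by exists N => // n Nn; rewrite sub0r normrN /= normr_id; exact: HN.
  - by move=> n r /EK[_ yK]; rewrite /= lee_fin normr_id; exact: dom.
rewrite integral0 in cv.
have /fine_cvgP[_ /cvgrPdist_le /(_ _ eps0) [N _ HN]] := cv.
exists N => n /HN; rewrite sub0r normrN /= => Hn u t u0 ut tc yK.
have st : [set` `]u, t]] `<=` E.
  move=> r; rewrite /= in_itv /= => /andP[ur rt]; apply/EK; split.
    by rewrite (le_trans u0 (ltW ur)) (le_trans rt tc).
  by apply: yK; rewrite (ltW ur) rt.
have mI : measurable ([set` `]u, t]] : set (measurableTypeR R)) by exact: measurable_itv.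
have it : mu.-integrable `[0, t] (EFin \o (fun r => gen n (y r))).
  by apply: integrableS (ig n) => //; apply: subset_itvl; rewrite bnd_simp.
rewrite (Rintegral_itvB it); try by rewrite bnd_simp.
have iI : mu.-integrable `]u, t] (EFin \o (fun r => gen n (y r))) by apply: integrableS (igE n).
apply: le_trans (le_normr_Rintegral mI iI) _.
apply: le_trans Hn; apply: le_trans (ler_norm _).
rewrite /Rintegral; apply: fine_le.
- exact: integrable_fin_num (integrable_norm iI).
- exact: integrable_fin_num (inE n).
- apply: ge0_subset_integral => //.
  by have /integrableP[] := inE n.
Unshelve. all: by end_near. Qed.

Section Expectation.
Context d (T : measurableType d) (R : realType).
Variables (P : probability T R) (F : R -> set (set T)).
Variables (sigma a1 a2 b1 b2 : R) (B X : R -> T -> R) (zeta : T -> \bar R).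
Hypothesis sigma_gt0 : 0 < sigma.
Hypothesis filtrationF : filtration F.
Hypothesis brownianB : brownian_motion P F sigma B.
Hypothesis solutionX : solution P F B a1 a2 b1 b2 X zeta.
Let D := drift a1 a2 b1 b2.
Let mu := @lebesgue_measure R.
Variables (A : set T) (u l lo hi : R).
Hypothesis u0 : 0 <= u.
Hypothesis l0 : 0 < l.
Hypothesis FA : F u A.
Hypothesis lohi : lo <= hi.

Let mesh m : R := l / m.+1%:R.
Let mesh0 m : 0 < mesh m. Proof. by rewrite divr_gt0. Qed.
Let g0 m j : 0 <= grid u (mesh m) j. Proof. exact: grid_ge0 u0 (mesh0 m) j. Qed.
Let gS m j : grid u (mesh m) j.+1 = grid u (mesh m) j + mesh m. Proof. exact: gridS. Qed.

Let sF t : 0 <= t -> sigma_algebra [set: T] (F t).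
Proof. by have [h _ _] := filtrationF; exact: h. Qed.
Let subF t : 0 <= t -> F t `<=` measurable.
Proof. by have [_ h _] := filtrationF; exact: h. Qed.
Let monoF s t : 0 <= s -> s <= t -> F s `<=` F t.
Proof. by have [_ _ h] := filtrationF; exact: h. Qed.

Let G m j := F (grid u (mesh m) j).
Let a m j : T -> R := \1_(active B X zeta A u (mesh m) lo hi j).
Let yy m j := live_difference B X zeta (grid u (mesh m) j).
Let De m j w := B (grid u (mesh m) j.+1) w - B (grid u (mesh m) j) w.

Let sG m j : sigma_algebra [set: T] (G m j). Proof. exact: sF. Qed.
Let subG m j : G m j `<=` measurable. Proof. exact: subF. Qed.
Let monoG m j : G m j `<=` G m j.+1.
Proof. by apply: monoF => //; rewrite gS lerDl ltW. Qed.

Lemma measurable_active m j : measurable (active B X zeta A u (mesh m) lo hi j).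
Proof. by apply: (@subG m j); apply: (adapted_active filtrationF brownianB solutionX). Qed.

Let ma m j : measurable_fun [set: g_sigma_algebraType (G m j)] (a m j).
Proof.
apply: measurable_indic; rewrite (measurable_subalgebraE (@sG m j)).
exact: (adapted_active filtrationF brownianB solutionX).
Qed.

Let a01 m j w : 0 <= a m j w <= 1.
Proof. by rewrite /a indicE; case: (_ \in _); rewrite ?lexx ?ler01. Qed.

Let my m j : measurable_fun [set: g_sigma_algebraType (G m j)] (yy m j).
Proof. exact: (adapted_live_difference filtrationF brownianB solutionX (g0 m j)). Qed.

Lemma measurable_live_difference m j :
  measurable_fun setT (live_difference B X zeta (grid u (mesh m) j)).
Proof. exact: (measurable_fun_subalgebra (sG m j) (@subG m j) (@my m j)). Qed.

Let mDe m j : measurable_fun [set: g_sigma_algebraType (G m j.+1)] (De m j).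
Proof.
apply: measurable_funB; first exact: (adapted_brownian filtrationF brownianB (g0 m j.+1)).
move=> _ C mC; rewrite setTI (measurable_subalgebraE (@sG m j.+1)); apply: monoG.
by have [h _ _ _ _] := brownianB; apply: h.
Qed.

Let indep m j (E : set T) (C : set R) : G m j E -> measurable C ->
  (P (E `&` De m j @^-1` C) = P E * normal_prob 0 (sigma * Num.sqrt (mesh m)) C)%E.
Proof.
move=> GE mC; have [_ _ _ n i] := brownianB.
have lt : grid u (mesh m) j < grid u (mesh m) j.+1 by rewrite gS ltrDl.
have := i _ _ E C (g0 m j) lt GE mC; rewrite (n _ _ C (g0 m j) lt mC).
by rewrite (_ : grid u (mesh m) j.+1 - grid u (mesh m) j = mesh m) //; rewrite gS; ring.
Qed.

Let s0 m : 0 < sigma * Num.sqrt (mesh m).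
Proof. by rewrite mulr_gt0 // sqrtr_gt0. Qed.

Lemma active0E m w : active B X zeta A u (mesh m) lo hi 0 w <->
  [/\ A w, alive zeta u w & lo <= live_difference B X zeta u w <= hi].
Proof.
have E : grid u (mesh m) 0 = u by rewrite /grid mul0r addr0.
split=> [[Aw /(_ 0%N (leqnn _))]|[Aw h1 h2]].
  by rewrite /inside /= E => -[].
by split => // j; rewrite leqn0 => /eqP ->; rewrite /inside /= E.
Qed.

Lemma gain_inactive f m w : ~ active B X zeta A u (mesh m) lo hi 0 w ->
  gain B X zeta A u (mesh m) lo hi f m.+1 w = 0.
Proof.
move=> na; rewrite /gain big1 // => j _; rewrite indicE memNset ?mul0r //.
by move=> aj; apply: na; exact: active_mono aj.
Qed.

Lemma gain_le f (C : R) m w :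
  (forall x y, lo - 1 <= x <= hi + 1 -> lo - 1 <= y <= hi + 1 -> `|f x - f y| <= C) ->
  `|gain B X zeta A u (mesh m) lo hi f m.+1 w| <= C.
Proof.
move=> H; have [kap km Hk] := exit_index B X zeta A u (mesh m) lo hi m.+1 w.
by rewrite (gainE f km Hk); apply: H; exact: clamp_in.
Qed.

Lemma measurable_gain f m : continuous f ->
  measurable_fun setT (gain B X zeta A u (mesh m) lo hi f m.+1).
Proof.
move=> cf; have mf := continuous_measurable_fun cf.
have mc j : measurable_fun setT (fun w => f (clamp lo hi (yy m j w))).
  apply: (measurableT_comp mf); apply: measurable_maxr => //.
  by apply: measurable_minr => //; exact: measurable_live_difference.
apply: measurable_sum => j; apply: measurable_funM; last by apply: measurable_funB; exact: mc.
exact/measurable_indic/measurable_active.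
Qed.

Section TestFunction.
Variables (f f1 f2 : R -> R) (C1 : R).
Hypothesis tf : test_function f f1 f2.
Hypothesis fC1 : forall x, `|f1 x| <= C1.

Let d1 := test_derive1 tf.

Let C10 : 0 <= C1. Proof. exact: le_trans (fC1 0). Qed.

Lemma gain_lipschitz m w : `|gain B X zeta A u (mesh m) lo hi f m.+1 w| <= C1 * (hi - lo + 2).
Proof.
apply: gain_le => x y /andP[x1 x2] /andP[y1 y2].
apply: le_trans (mean_value_le d1 fC1 y x) _; apply: ler_wpM2l => //.
by rewrite ler_norml; apply/andP; split; lra.
Qed.

Let M m := martingale (a m) (yy m) (De m) (sigma * Num.sqrt (mesh m)) f m.+1.

Let mM m : measurable_fun setT (M m).
Proof.
have [C0 fC0] := test_bound0 tf.
apply: (measurable_fun_subalgebra (sG m m.+1) (@subG m m.+1)).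
exact: (measurable_martingale (sG m) (@monoG m) (@ma m) (@my m) (@mDe m) _ d1 fC0 fC1).
Qed.

Let bM m : bounded_rv (M m).
Proof.
have [C0 fC0] := test_bound0 tf; split; first exact: mM.
by exists (m.+1%:R * (2 * C0)); exact: (martingale_le _ _ (a01 m) _ d1 fC0).
Qed.

Let bgain m : bounded_rv (gain B X zeta A u (mesh m) lo hi f m.+1).
Proof.
split; first exact: measurable_gain (is_derive_continuous d1).
by exists (C1 * (hi - lo + 2)); exact: gain_lipschitz.
Qed.

Lemma bounded_defect m : bounded_rv (defect sigma B X zeta A u (mesh m) lo hi f m.+1).
Proof.
have [m1 [K1 H1]] := bgain m; have [m2 [K2 H2]] := bM m.
split; first exact: measurable_funB.
by exists (K1 + K2) => w; apply: le_trans (ler_normB _ _) _; exact: lerD (H1 w) (H2 w).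
Qed.

Lemma defect_mean m :
  \int[P]_w defect sigma B X zeta A u (mesh m) lo hi f m.+1 w =
  \int[P]_w gain B X zeta A u (mesh m) lo hi f m.+1 w.
Proof.
have [C0 fC0] := test_bound0 tf.
rewrite /defect RintegralB //; [|exact: bounded_rv_integrable|exact: (bounded_rv_integrable P (bM m))].
by rewrite (martingale_mean (sG m) (@subG m) (@monoG m) (@ma m) (a01 m) (@my m) (@mDe m) (@indep m) d1 fC0 fC1) subr0.
Qed.

(** The gain is at most C1 times the width of the enlarged interval, and the martingale has variance
    at most C1^2 sigma^2 l because the number of steps times the mesh is l. The bound is independent
    of the mesh and depends on f only through C1. *)
Lemma defect_sqr m :
  \int[P]_w (defect sigma B X zeta A u (mesh m) lo hi f m.+1 w ^+ 2) <=
  2 * (C1 * (hi - lo + 2)) ^+ 2 + 2 * (C1 ^+ 2 * sigma ^+ 2 * l).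
Proof.
have [C0 fC0] := test_bound0 tf.
have bsq g := @bounded_rv_sqr _ _ _ P g.
have v := martingale_variance (sG m) (@subG m) (@monoG m) (@ma m) (a01 m) (@my m) (@mDe m) (s0 m) (@indep m) d1 fC0 fC1 m.+1.
have vE : m.+1%:R * (C1 ^+ 2 * (sigma * Num.sqrt (mesh m)) ^+ 2) = C1 ^+ 2 * sigma ^+ 2 * l.
  rewrite exprMn sqr_sqrtr ?ltW // /mesh; field.
  by rewrite nat1r pnatr_eq0.
rewrite vE in v.
set K := C1 * (hi - lo + 2).
have iK : P.-integrable setT (EFin \o (fun=> 2 * K ^+ 2)).
  by apply: (@prob_bounded_integrable _ _ _ P _ `|2 * K ^+ 2|).
have i2 := integrable_scale measurableT 2 (bsq _ (bM m)).
apply: (@le_trans _ _ (\int[P]_w (2 * K ^+ 2 + 2 * M m w ^+ 2))).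
  apply: le_Rintegral => //; first exact: bsq (bounded_defect m).
    exact: integrable_add.
  move=> w _; rewrite /defect -/(M m w).
  have := gain_lipschitz m w; rewrite -/K; set x := gain _ _ _ _ _ _ _ _ _ _ _; set z := M m w.
  move=> xK; have : x ^+ 2 <= K ^+ 2.
    by rewrite -(real_normK (num_real x)) lerXn2r ?nnegrE //; apply: le_trans xK.
  by have := sqr_ge0 (x + z); rewrite sqrrB sqrrD !mulr2n; set p := x * z; lra.
rewrite RintegralD // prob_Rintegral_cst RintegralZl //; last exact: bsq (bM m).
by rewrite lerD2l ler_pM2l.
Qed.

End TestFunction.

Lemma defect_inactive f m w : ~ active B X zeta A u (mesh m) lo hi 0 w ->
  defect sigma B X zeta A u (mesh m) lo hi f m.+1 w = 0.
Proof.
move=> na; rewrite /defect gain_inactive // /martingale big1 ?subr0 // => j _.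
rewrite indicE memNset ?mul0r //.
by move=> aj; apply: na; exact: active_mono aj.
Qed.

(** Optional stopping for S (Y) at the exit from [lo, hi], or at time u + l. With f n fixed and the
    mesh tending to 0, the defect is close path by path to an integral of the generator of f n,
    itself small for n large; the uniform L^2 bound carries this over to expectations. *)
Lemma scale_gain (S : R -> R) e : -1 < a1 -> -1 < a2 -> b1 < 0 -> 0 < b2 -> S 0 = 0 ->
  (forall x : R, is_derive x 1 S (scale_density (sigma ^+ 2 / 2) a1 a2 b1 b2 x)) -> 0 < e ->
  exists M, forall m, (M <= m)%N -> `|\int[P]_w gain B X zeta A u (mesh m) lo hi S m.+1 w| <= e.
Proof.
move=> a1_gt a2_gt b1_lt0 b2_gt0 S0 dS e0.
set k := sigma ^+ 2 / 2.
have k0 : 0 < k by rewrite divr_gt0 // exprn_gt0.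
pose K := `|lo| + `|hi| + 1.
have K0 : 0 <= K by rewrite /K addr_ge0 // addr_ge0.
have inK y : lo - 1 <= y <= hi + 1 -> `|y| <= K.
  move=> /andP[y1 y2]; have := ler_norm hi; have := ler_norm (- lo); rewrite normrN => h1 h2.
  have := normr_ge0 hi; have := normr_ge0 lo => h3 h4.
  by rewrite /K ler_norml; apply/andP; split; lra.
have [f [f1 [f2 [C1 [C [tf fC1 dom ptw unif]]]]]] := scale_approximation k0 a1_gt a2_gt b1_lt0 b2_gt0 K0 S0 dS.
have := @uniform_integrability _ _ _ P (fun n m => defect sigma B X zeta A u (mesh m) lo hi (f n) m.+1) _ (e / 2)
  (fun n m => bounded_defect (tf n) (fC1 n) m) (fun n m => defect_sqr (tf n) (fC1 n) m).
case=> [||N HN]; last 1 first.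
(* The gain involves two values of the function, so replacing f n by S costs twice e / 4. The index
   n is fixed before the threshold M on the mesh. *)
- have [N' HN'] := unif (e / 4) ltac:(lra).
  have [M HM] := HN (N + N')%N (leq_addr _ _).
  exists M => m /HM; rewrite (defect_mean (tf _) (fC1 _)).
  set n := (N + N')%N => Hm.
  have Sn y : lo - 1 <= y <= hi + 1 -> `|f n y - S y| <= e / 4 by move=> /inK; exact: HN' (leq_addl _ _) y.
  have cS := is_derive_continuous dS; have cf := is_derive_continuous (test_derive1 (tf n)).
  have bg h : continuous h -> bounded_rv (gain B X zeta A u (mesh m) lo hi h m.+1).
    move=> ch; split; first exact: measurable_gain.
    have [Ch _ HCh] := compact_bounded_norm (continuous_subspaceT ch : {within `[lo - 1, hi + 1], continuous h}).
    exists (Ch + Ch) => w; apply: gain_le => x y xin yin.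
    by apply: le_trans (ler_normB _ _) _; apply: lerD; exact: HCh.
  have i1 := bounded_rv_integrable P (bg _ cf); have i2 := bounded_rv_integrable P (bg _ cS).
  have E : \int[P]_w gain B X zeta A u (mesh m) lo hi S m.+1 w =
     \int[P]_w gain B X zeta A u (mesh m) lo hi (f n) m.+1 w -
     \int[P]_w (gain B X zeta A u (mesh m) lo hi (f n) m.+1 w - gain B X zeta A u (mesh m) lo hi S m.+1 w).
    by rewrite RintegralB //; ring.
  rewrite E; apply: le_trans (ler_normB _ _) _.
  rewrite (_ : e = e / 2 + e / 2); last by field.
  apply: lerD => //.
  have i3 := integrable_sub measurableT i1 i2.
  apply: le_trans (le_normr_Rintegral measurableT i3) _.
  rewrite -[X in _ <= X](prob_Rintegral_cst P); apply: le_Rintegral => //.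
  + exact: (integrable_norm i3).
  + by apply: (@prob_bounded_integrable _ _ _ P _ `|e / 2|).
  + move=> w _ /=; have [kap km Hk] := exit_index B X zeta A u (mesh m) lo hi m.+1 w.
    rewrite !(gainE _ km Hk).
    set y1 := clamp _ _ _; set y2 := clamp lo hi _.
    rewrite (_ : _ - _ = (f n y1 - S y1) - (f n y2 - S y2)); last by ring.
    apply: le_trans (ler_normB _ _) _; rewrite (_ : e / 2 = e / 4 + e / 4); last by field.
    by apply: lerD; apply: Sn; exact: clamp_in.
- have := ae_regular_path brownianB solutionX; apply: filterS => w regw eps eps0.
  have [act|nact] := pselect (active B X zeta A u (mesh 0) lo hi 0 w); last first.
    exists 0%N => n _; exists 0%N => m _; rewrite defect_inactive ?normr0 ?ltW //.
    by rewrite active0E -(active0E 0).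
  have /active0E [Aw lu yin] := act.
  have [c [uc lc Hc]] := horizon regw lo hi u0 lu l0.
  have c0 := le_trans u0 uc.
  rewrite live_differenceE // in yin.
  have eps20 : 0 < eps / 2 by lra.
  have cy := regular_continuous regw c0 lc.
  have ia := regular_integrable regw c0 lc; have xE := regular_integral regw lc.
  have cb := @regular_brownian _ _ _ _ _ _ _ _ _ _ _ regw c.
  have ig' n : mu.-integrable `[0, c] (EFin \o (fun r => generator D (f1 n) (f2 n) k (X r w - B r w))).
    by have [C2 fC2] := test_bound2 (tf n); exact: (integrable_generator c0 ia xE cb k (test_derive2 (tf n)) (test_continuous2 (tf n)) (fC1 n) fC2).
  have [N HN] := generator_vanishes (subspace_continuous_measurable_fun (measurable_itv _) cy) ia ig'
    (fun n r => dom n _) ptw eps20.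
  exists N => n Nn.
  have [M HM] := path_defect regw u0 lu sigma_gt0 (tf n) l0 uc lc eps20 Hc Aw yin.
  exists M => m Mm.
  have [kap km Hk] := exit_index B X zeta A u (mesh m) lo hi m.+1 w.
  have [/andP[ug gc] Hd Hy] := HM m Mm kap km Hk.
  have HI := HN n Nn u _ u0 ug gc (fun r rin => inK _ (Hy r rin)).
  rewrite -[defect _ _ _ _ _ _ _ _ _ _ _ _](subrK (\int[mu]_(r in `[0, grid u (mesh m) kap]) generator D (f1 n) (f2 n) k (X r w - B r w) -
    \int[mu]_(r in `[0, u]) generator D (f1 n) (f2 n) k (X r w - B r w))).
  apply: le_trans (ler_normD _ _) _; rewrite (_ : eps = eps / 2 + eps / 2); last by field.
  exact: lerD.
- by lra.
Qed.

(** Dynkin's estimate: the mean gain of f is at most 2 C0, while the generator contributes at least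
    c0 l on the paths that stay inside up to the horizon. The 1 absorbs the discretisation error. *)
Lemma exit_bound (f f1 f2 : R -> R) (C0 c0 : R) : test_function f f1 f2 ->
  (forall x, `|f x| <= C0) -> 0 < c0 ->
  (forall z, lo - 1 <= z <= hi + 1 -> c0 <= generator D f1 f2 (sigma ^+ 2 / 2) z) ->
  exists M, forall m, (M <= m)%N ->
    c0 * l * fine (P (active B X zeta A u (mesh m) lo hi m)) <= 2 * C0 + 1.
Proof.
move=> tf fC0 c00 gen_ge; set k := sigma ^+ 2 / 2.
have [C1 fC1] := test_bound1 tf.
pose De' m := defect sigma B X zeta A u (mesh m) lo hi f m.+1.
pose ac m : T -> R := \1_(active B X zeta A u (mesh m) lo hi m).
(* Along a path the defect is only estimated from below, so its shortfall is what tends to 0; being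
   bounded in L^2, it also tends to 0 in mean. *)
pose W m w := Num.min (De' m w - c0 * l * ac m w) 0.
have cl0 : 0 < c0 * l by rewrite mulr_gt0.
have ac01 m w : 0 <= ac m w <= 1 := a01 m m w.
have mac m : measurable_fun setT (ac m) by exact/measurable_indic/measurable_active.
have iac m : P.-integrable setT (EFin \o ac m) by exact/integrable_indic_prob/measurable_active.
have bD m : bounded_rv (De' m) := bounded_defect tf fC1 m.
have W_le m w : `|W m w| <= `|De' m w| + c0 * l.
  have /andP[h1 h2] := ac01 m w.
  have h3 : 0 <= c0 * l * ac m w <= c0 * l by rewrite mulr_ge0 ?(ltW cl0) //= ger_pMr.
  have := ler_norm (De' m w); have := ler_norm (- De' m w); rewrite normrN => h4 h5.
  have h6 := normr_ge0 (De' m w).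
  move: h3 h4 h5 h6; rewrite /W; set p := c0 * l * _; set q := `|De' m w|; set r := c0 * l.
  move=> /andP[h7 h8] h4 h5 h6; rewrite /Num.min; case: ifP => _; last by rewrite normr0; lra.
  by rewrite ler_norml; apply/andP; split; lra.
have bW m : bounded_rv (W m).
  have [mD [K DK]] := bD m; split.
    apply: measurable_minr => //; apply: measurable_funB => //.
    exact: measurable_funM.
  by exists (K + c0 * l) => w; apply: le_trans (W_le m w) _; rewrite lerD2r.
have bsq g := @bounded_rv_sqr _ _ _ P g.
have W2 m : \int[P]_w (W m w ^+ 2) <=
    2 * (2 * (C1 * (hi - lo + 2)) ^+ 2 + 2 * (C1 ^+ 2 * sigma ^+ 2 * l)) + 2 * (c0 * l) ^+ 2.
  apply: (@le_trans _ _ (\int[P]_w (2 * De' m w ^+ 2 + 2 * (c0 * l) ^+ 2))).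
    apply: le_Rintegral => //; first exact: bsq.
      apply: integrable_add => //; first exact: integrable_scale (bsq _ (bD m)).
      by apply: (@prob_bounded_integrable _ _ _ P _ `|2 * (c0 * l) ^+ 2|).
    move=> w _; rewrite -(real_normK (num_real (W m w))) -(real_normK (num_real (De' m w))).
    apply: (@le_trans _ _ ((`|De' m w| + c0 * l) ^+ 2)).
      by rewrite lerXn2r ?nnegrE // addr_ge0 // ltW.
    set p := `|_|; set q := c0 * l; have := sqr_ge0 (p - q); rewrite sqrrB sqrrD !mulr2n; lra.
  rewrite RintegralD //; last 2 first.
  - exact: integrable_scale (bsq _ (bD m)).
  - by apply: (@prob_bounded_integrable _ _ _ P _ `|2 * (c0 * l) ^+ 2|).
  rewrite prob_Rintegral_cst RintegralZl //; last exact: bsq.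
  by rewrite lerD2r ler_pM2l //; exact: (defect_sqr tf fC1 m).
have [||N HN] := @uniform_integrability _ _ _ P (fun _ => W) _ 1 (fun _ => bW) (fun _ => W2); last 1 first.
- have [M HM] := HN N (leqnn N); exists M => m /HM Wm.
  have iW := bounded_rv_integrable P (bW m); have iD := bounded_rv_integrable P (bD m).
  have iZ := integrable_scale measurableT (c0 * l) (iac m).
  have acE : \int[P]_w ac m w = fine (P (active B X zeta A u (mesh m) lo hi m)).
    by rewrite /Rintegral integral_indic ?setIT //; exact: measurable_active.
  have : \int[P]_w (W m w + c0 * l * ac m w) <= \int[P]_w De' m w.
    apply: le_Rintegral => //; first exact: integrable_add.
    by move=> w _; rewrite -lerBrDr /W ge_min lexx.
  rewrite RintegralD // RintegralZl // acE (defect_mean tf fC1).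
  have ge2 : \int[P]_w gain B X zeta A u (mesh m) lo hi f m.+1 w <= 2 * C0.
    rewrite -[X in _ <= X](prob_Rintegral_cst P); apply: le_Rintegral => //.
    + apply: (@prob_bounded_integrable _ _ _ P _ (C1 * (hi - lo + 2))); last exact: (gain_lipschitz tf fC1 m).
      exact: measurable_gain (is_derive_continuous (test_derive1 tf)).
    + by apply: (@prob_bounded_integrable _ _ _ P _ `|2 * C0|).
    + move=> w _; apply: le_trans (ler_norm _) _; apply: gain_le => x y _ _.
      by apply: le_trans (ler_normB _ _) _; rewrite mulr2n mulrDl !mul1r; apply: lerD.
  by move: Wm; rewrite ler_norml => /andP[w1 _] w2; lra.
- have := ae_regular_path brownianB solutionX; apply: filterS => w regw eps eps0.
  exists 0%N => n _.
  have [act|nact] := pselect (active B X zeta A u (mesh 0) lo hi 0 w); last first.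
    have na m : ~ active B X zeta A u (mesh m) lo hi 0 w by rewrite active0E -(active0E 0).
    exists 0%N => m _; rewrite /W /De' defect_inactive // /ac indicE memNset; last by move=> /(active_mono (leq0n m)); exact: na.
    by rewrite mulr0 subrr minxx normr0 ltW.
  have /active0E [Aw lu yin] := act.
  have [c [uc lc Hc]] := horizon regw lo hi u0 lu l0.
  have c_0 := le_trans u0 uc.
  rewrite live_differenceE // in yin.
  have ia := regular_integrable regw c_0 lc; have xE := regular_integral regw lc.
  have cb := @regular_brownian _ _ _ _ _ _ _ _ _ _ _ regw c.
  have [C2 fC2] := test_bound2 tf.
  have ig := integrable_generator c_0 ia xE cb k (test_derive2 tf) (test_continuous2 tf) fC1 fC2.
  have [M HM] := path_defect regw u0 lu sigma_gt0 tf l0 uc lc eps0 Hc Aw yin.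
  exists M => m Mm.
  have [kap km Hk] := exit_index B X zeta A u (mesh m) lo hi m.+1 w.
  have [/andP[ug gc] Hd Hy] := HM m Mm kap km Hk.
  set g := grid u (mesh m) kap in ug gc Hd Hy.
  have it : mu.-integrable `[0, g] (EFin \o (fun r => generator D f1 f2 k (X r w - B r w))).
    by apply: integrableS ig => //; apply: subset_itvl; rewrite bnd_simp.
  have HI : c0 * (g - u) <= \int[mu]_(r in `[0, g]) generator D f1 f2 k (X r w - B r w) -
      \int[mu]_(r in `[0, u]) generator D f1 f2 k (X r w - B r w).
    rewrite (Rintegral_itvB it); try by rewrite bnd_simp.
    rewrite -(Rintegral_itvoc_cst c0 ug); apply: le_Rintegral; first exact: measurable_itv.
    + suff i1 : mu.-integrable `[0, c] (EFin \o (fun=> c0)).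
        apply: integrableS i1 => //.
        by apply: subset_itv; rewrite bnd_simp.
      by apply: continuous_compact_integrable; [exact: segment_compact|apply: continuous_subspaceT => z; exact: cvg_cst].
    + by apply: integrableS ig => //; apply: subset_itv; rewrite bnd_simp.
    + by move=> r /=; rewrite in_itv /= => /andP[r1 r2]; apply: gen_ge; apply: Hy; rewrite ltW.
  have Hl : c0 * l * ac m w <= c0 * (g - u).
    rewrite /ac indicE; have [am|nam] := pselect (active B X zeta A u (mesh m) lo hi m w); last first.
      by rewrite memNset // mulr0 mulr_ge0 ?subr_ge0 // ltW.
    have /(Hk m (ltnSn m)) mk := am.
    have kE : kap = m.+1 by apply/eqP; rewrite eqn_leq km mk.
    rewrite mem_set // mulr1 /g kE /grid /mesh ler_pM2l // addrAC subrr add0r mulrC divfK ?pnatr_eq0 //.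
  have : - eps <= De' m w - c0 * l * ac m w.
    by move: Hd; rewrite ler_norml -/(De' m w) -/mu -/D -/k => /andP[h1 _]; move: h1 HI Hl; set i1 := Rintegral _ _ _; set i2 := Rintegral _ _ _; lra.
  rewrite /W ler_norml => h; rewrite le_min h /= oppr_le0 (ltW eps0) /=.
  by rewrite ge_min (ltW eps0) orbT.
- exact: ltr01.
Qed.

End Expectation.

(** * Probability of returning *)

Definition set_liminf (T : Type) (E : nat -> set T) := \bigcup_n \bigcap_k E (n + k)%N.

Lemma set_liminfP (T : Type) (E : nat -> set T) w :
  set_liminf E w <-> exists N, forall n, (N <= n)%N -> E n w.
Proof.
split=> [[N _ H]|[N H]]; exists N => //; first by move=> n Nn; rewrite -(subnKC Nn); exact: H.
by move=> k _; apply: H; exact: leq_addr.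
Qed.

Section Liminf.
Context d (T : measurableType d) (R : realType) (P : probability T R).

Lemma measurable_liminf (E : nat -> set T) : (forall n, measurable (E n)) ->
  measurable (set_liminf E).
Proof. by move=> mE; apply: bigcup_measurable => n _; exact: bigcap_measurable. Qed.

(** The intersections of the E k over k >= n increase to the liminf, and each is contained in E
    n. *)
Lemma prob_liminf_le (E : nat -> set T) (r : \bar R) N : (forall n, measurable (E n)) ->
  (forall n, (N <= n)%N -> (P (E n) <= r)%E) -> (P (set_liminf E) <= r)%E.
Proof.
move=> mE Er.
have mI n : measurable (\bigcap_k E (n + k)%N) by exact: bigcap_measurable.
have nd : nondecreasing_seq (fun n => \bigcap_k E (n + k)%N).
  move=> n m nm; apply/subsetPset => w H k _.
  by have := H (m - n + k)%N I; rewrite addnA subnKC.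
have cv : (P \o (fun n => \bigcap_k E (n + k)%N)) n @[n --> \oo] --> P (set_liminf E).
  exact: (nondecreasing_cvg_mu mI (bigcup_measurable (fun n _ => mI n)) nd).
rewrite -(cvg_lim (@ereal_hausdorff R) cv); apply: lime_le; first by apply/cvg_ex; exists (P (set_liminf E)).
exists N => // n /= Nn; apply: le_trans (Er n Nn).
apply: le_measure; rewrite ?inE //.
by move=> w /(_ 0%N I); rewrite addn0.
Qed.

End Liminf.

(** * Coming back after an exit, on either side *)

Section Return.
Context d (T : measurableType d) (R : realType).
Variables (P : probability T R) (F : R -> set (set T)).
Variables (sigma a1 a2 b1 b2 : R) (B X : R -> T -> R) (zeta : T -> \bar R).
Hypothesis sigma_gt0 : 0 < sigma.
Hypothesis a1_gt : -1 < a1.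
Hypothesis a2_gt : -1 < a2.
Hypothesis b1_lt0 : b1 < 0.
Hypothesis b2_gt0 : 0 < b2.
Hypothesis filtrationF : filtration F.
Hypothesis brownianB : brownian_motion P F sigma B.
Hypothesis solutionX : solution P F B a1 a2 b1 b2 X zeta.
Variable S : R -> R.
Hypothesis S0 : S 0 = 0.
Hypothesis dS : forall x : R, is_derive x 1 S (scale_density (sigma ^+ 2 / 2) a1 a2 b1 b2 x).
Let cS : continuous S. Proof. exact: is_derive_continuous dS. Qed.

(** The sign e, equal to 1 or -1, treats both sides at once. Vinf is an upper bound of e S, V1 an
    upper bound of e S at clamped bad points, and VK a lower bound on the starting event A; in the
    application bad is an open half-line. *)
Variables (e Vinf V1 VK : R) (bad : set R).
Hypothesis e1 : `|e| = 1.
Hypothesis V1inf : V1 < Vinf.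
Hypothesis VKinf : VK <= Vinf.
Hypothesis mbad : measurable bad.
Variables (A : set T) (u : R).
Hypothesis u0 : 0 <= u.
Hypothesis FA : F u A.
Hypothesis AK : forall w, A w -> [/\ alive zeta u w, ~ bad (live_difference B X zeta u w) &
  VK <= e * S (live_difference B X zeta u w)].

(** When bad is disjoint from [lo, hi], this is the event that the exit is seen by the grid and
    takes place in bad. *)
Definition hits lo hi l m : set T := [set w | exists2 n, (n <= m)%N &
  active B X zeta A u (l / m.+1%:R) lo hi n w /\
  bad (live_difference B X zeta (grid u (l / m.+1%:R) n.+1) w)].

Section Interval.
Variables (l lo hi : R).
Hypothesis l0 : 0 < l.
Hypothesis lohi : lo <= hi.

Lemma measurable_hits m : measurable (hits lo hi l m).
Proof.
rewrite (_ : hits lo hi l m = \bigcup_(n in [set n | (n <= m)%N])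
   (active B X zeta A u (l / m.+1%:R) lo hi n `&`
    live_difference B X zeta (grid u (l / m.+1%:R) n.+1) @^-1` bad)); last first.
  by apply/seteqP; split => w [n nm H]; exists n.
apply: bigcup_measurable => n _; apply: measurableI.
  exact: (measurable_active filtrationF brownianB solutionX lo hi u0 l0 FA m n).
rewrite -[X in measurable X]setTI.
exact: (measurable_live_difference filtrationF brownianB solutionX u0 l0 m n.+1 measurableT mbad).
Qed.

Lemma hits_exit m w kap : (forall y, lo <= y <= hi -> ~ bad y) -> (kap <= m.+1)%N ->
  (forall j, (j < m.+1)%N -> (active B X zeta A u (l / m.+1%:R) lo hi j w <-> (j < kap)%N)) ->
  hits lo hi l m w -> bad (live_difference B X zeta (grid u (l / m.+1%:R) kap) w).
Proof.
move=> nbad km Hk [n nm [an bn]].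
have nk : (n < kap)%N by apply/Hk.
suff -> : kap = n.+1 by [].
apply/eqP; rewrite eqn_leq nk andbT leqNgt; apply/negP => nk1.
have n1m : (n.+1 < m.+1)%N by exact: leq_trans km.
have /(Hk _ n1m) [_ /(_ n.+1 (leqnn _)) [_]] := nk1.
by move=> /nbad.
Qed.

(** Optional stopping for e S (Y), which starts at VK or more on A and ends at V1 or less on a hit,
    at Vinf or less otherwise; its mean gain is within dl of 0. *)
Lemma hitting_bound dl :
  (forall y, lo <= y <= hi -> ~ bad y) ->
  (forall y, lo - 1 <= y <= hi + 1 -> e * S y <= Vinf) ->
  (forall y, bad y -> e * S (clamp lo hi y) <= V1) ->
  0 < dl -> exists M, forall m, (M <= m)%N ->
    (Vinf - V1) * fine (P (hits lo hi l m)) <= (Vinf - VK) * fine (P A) + dl.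
Proof.
move=> nbad HS Hbad dl0.
have [M HM] := scale_gain sigma_gt0 filtrationF brownianB solutionX u0 l0 FA lohi a1_gt a2_gt b1_lt0 b2_gt0 S0 dS dl0.
exists M => m /HM {HM} HM.
have mA : measurable A by have [_ h _] := filtrationF; exact: h u0 _ FA.
have mH := measurable_hits m.
have i1 (E : set T) := @integrable_indic_prob _ _ _ P E.
have E1 (E : set T) : measurable E -> \int[P]_w (\1_E w : R) = fine (P E).
  by move=> mE; rewrite /Rintegral integral_indic // setIT.
pose g := gain B X zeta A u (l / m.+1%:R) lo hi S m.+1.
have ig : P.-integrable setT (EFin \o g).
  have [C _ HC] := compact_bounded_norm (continuous_subspaceT cS : {within `[lo - 1, hi + 1], continuous S}).
  apply: (@prob_bounded_integrable _ _ _ P _ (C + C)).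
    exact: (measurable_gain filtrationF brownianB solutionX lo hi u0 l0 FA m cS).
  move=> w; apply: gain_le => // x y xin yin.
  by apply: le_trans (ler_normB _ _) _; apply: lerD; exact: HC.
have le w : (Vinf - V1) * \1_(hits lo hi l m) w <= (Vinf - VK) * \1_A w - e * g w.
  have [act|nact] := pselect (active B X zeta A u (l / m.+1%:R) lo hi 0 w); last first.
    rewrite /g gain_inactive // mulr0 subr0 [X in X <= _](_ : _ = 0).
      by rewrite mulr_ge0 ?subr_ge0 // indicE ler0n.
    rewrite indicE memNset ?mulr0 // => -[n _ [an _]]; apply: nact.
    exact: active_mono an.
  have /active0E [Aw lu yin] := act.
  have [_ _ yK] := AK Aw.
  rewrite [X in _ <= _ * X - _](_ : _ = 1); last by rewrite indicE mem_set.
  have [kap km Hk] := exit_index B X zeta A u (l / m.+1%:R) lo hi m.+1 w.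
  have g0 : grid u (l / m.+1%:R) 0 = u by rewrite /grid mul0r addr0.
  have yu : clamp lo hi (live_difference B X zeta u w) = live_difference B X zeta u w.
    by apply: clamp_id; move: yin => /andP[y1 y2]; apply/andP; split; lra.
  rewrite /g (gainE S km Hk) g0 yu mulrBr mulr1.
  set yk := live_difference _ _ _ (grid _ _ _) w.
  have := HS _ (clamp_in lohi yk).
  have [hw|nhw] := pselect (hits lo hi l m w); last first.
    by rewrite indicE memNset // mulr0; lra.
  rewrite indicE mem_set // mulr1.
  by have := Hbad _ (hits_exit nbad km Hk hw); rewrite -/yk; lra.
have i1h := integrable_scale measurableT (Vinf - V1) (i1 _ mH).
have i1A := integrable_scale measurableT (Vinf - VK) (i1 _ mA).
have ieg := integrable_scale measurableT e ig.
have : \int[P]_w ((Vinf - V1) * \1_(hits lo hi l m) w) <= \int[P]_w ((Vinf - VK) * \1_A w - e * g w).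
  by apply: le_Rintegral => //; exact: integrable_sub.
rewrite RintegralB // !RintegralZl ?E1 //; try exact: i1.
have : `|e * \int[P]_w g w| <= dl by rewrite normrM e1 mul1r.
by rewrite ler_norml => /andP[h1 _] h2; lra.
Qed.

End Interval.

Variables (lo hi : nat -> R).
Hypothesis lohi : forall i, lo i <= hi i.
Hypothesis nbad : forall i y, lo i <= y <= hi i -> ~ bad y.
Hypothesis S_le : forall i y, lo i - 1 <= y <= hi i + 1 -> e * S y <= Vinf.
Hypothesis S_bad : forall i y, bad y -> e * S (clamp (lo i) (hi i) y) <= V1.
Hypothesis exhaust : forall C : R, exists i0, forall i, (i0 <= i)%N ->
  forall y, `|y| <= C -> ~ bad y -> lo i <= y <= hi i.
Hypothesis bad_open : forall y, bad y -> exists2 dl : R, 0 < dl & forall z, `|y - z| < dl -> bad z.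

Let hit i m := hits (lo i) (hi i) i.+1%:R m.

(** The path is bounded up to time t, so for i large every value it takes is in [lo i, hi i] or in
    bad. As bad is open, the path is bad on a whole time interval before t, which a fine grid meets;
    the first bad grid point is then the exit. *)
Lemma path_hits w t : regular_path a1 a2 b1 b2 B X zeta w -> A w -> u < t -> alive zeta t w ->
  bad (X t w - B t w) -> set_liminf (fun i => set_liminf (hit i)) w.
Proof.
move=> regw Aw ut lt bt; have [lu nbu _] := AK Aw.
have t0 : 0 <= t := le_trans u0 (ltW ut).
have cy := regular_continuous regw t0 lt.
have [C C0 HC] := compact_bounded_norm cy.
have [i0 Hi0] := exhaust C.
have [dl dl0 Hdl] := bad_open bt.
have [d1 d10 H1] := uniform_continuity cy dl0.
apply/set_liminfP; exists (i0 + Num.truncn t)%N => i ii.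
have i1 : (i0 <= i)%N by apply: leq_trans ii; exact: leq_addr.
have i2 : t <= i.+1%:R.
  apply/ltW/(lt_le_trans (truncnS_gt t)); rewrite ler_nat ltnS.
  by apply: leq_trans ii; exact: leq_addl.
apply/set_liminfP; have [M HM] := mesh_small (ler0n R i.+1) d10.
exists M => m /HM; set h : R := i.+1%:R / m.+1%:R => hd.
have h0 : 0 < h by rewrite divr_gt0.
have q0 : 0 <= (t - u) / h by rewrite divr_ge0 ?subr_ge0 // ltW.
pose j := Num.truncn ((t - u) / h).
have /andP[] := truncn_itv q0; rewrite -/j ler_pdivlMr // ltr_pdivrMr // => jt.
rewrite -natr1 mulrDl mul1r => tj.
have gj : grid u h j <= t by rewrite /grid; lra.
have jm : (j <= m.+1)%N.
  rewrite -(ler_nat R) -(ler_pM2r h0); apply: le_trans jt _.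
  rewrite /h mulrC divfK ?pnatr_eq0 //; have := u0; lra.
have gu k : u <= grid u h k by rewrite /grid lerDl mulr_ge0 // ltW.
have bj : bad (X (grid u h j) w - B (grid u h j) w).
  apply: Hdl; apply: H1; [by rewrite t0 lexx|by rewrite (le_trans u0 (gu j))|].
  by apply: le_lt_trans hd; rewrite ler_norml /grid; apply/andP; split; lra.
have exj : exists k, `[< bad (X (grid u h k) w - B (grid u h k) w) >] by exists j; apply/asboolP.
have ldE k : grid u h k <= t -> live_difference B X zeta (grid u h k) w = X (grid u h k) w - B (grid u h k) w.
  by move=> kt; apply: live_differenceE; exact: alive_le lt.
have [n /asboolP bn min] := ex_minnP exj.
have nj : (n <= j)%N by apply: min; apply/asboolP.
case: n bn min nj => [b0|n bn min nj].
  by exfalso; apply: nbu; rewrite live_differenceE //; move: b0; rewrite /grid mul0r addr0.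
have gn k : (k <= n.+1)%N -> grid u h k <= t.
  by move=> kn; apply: le_trans gj; apply: grid_le => //; exact: leq_trans nj.
exists n; first by rewrite -ltnS; exact: leq_trans jm.
split; last by rewrite ldE ?gn.
split=> // k kn; split; first by apply: alive_le lt; apply: gn; exact: leqW.
rewrite ldE ?gn 1?leqW //; apply: Hi0 => //.
  by apply: HC; rewrite (le_trans u0 (gu k)) gn // leqW.
by move=> bk; have := min k (asboolT bk); rewrite leqNgt ltnS kn.
Qed.

(** The hitting bound passes to the liminf over the mesh, where its error dl disappears, and then to
    the liminf over the intervals and horizons, on which its main term does not depend. *)
Lemma return_bound : exists Ret : set T, [/\ measurable Ret,
  fine (P Ret) <= (Vinf - VK) / (Vinf - V1) * fine (P A) &
  {ae P, forall w, A w -> ~ Ret w -> forall t, u < t -> alive zeta t w -> ~ bad (X t w - B t w)}].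
Proof.
have V0 : 0 < Vinf - V1 by rewrite subr_gt0.
have mh i m : measurable (hit i m) by exact: measurable_hits.
have mhi i : measurable (set_liminf (hit i)) by exact: measurable_liminf.
exists (set_liminf (fun i => set_liminf (hit i))); split; first exact: measurable_liminf.
  rewrite -lee_fin fineK ?fin_num_measure //; last exact: measurable_liminf.
  apply: (prob_liminf_le (N := 0%N)) => // i _.
  apply/lee_addgt0Pr => dl dl0.
  have Vdl : 0 < (Vinf - V1) * dl by rewrite mulr_gt0.
  have [M HM] := hitting_bound (ltr0Sn R i) (lohi i) (@nbad i) (@S_le i) (@S_bad i) Vdl.
  apply: (prob_liminf_le (N := M)) => // m /HM.
  rewrite -(fineK (fin_num_measure P _ (mh i m))) lee_fin.
  move=> h; rewrite -(ler_pM2l V0); apply: le_trans h _.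
  by rewrite mulrDr mulrA mulrCA divff ?gt_eqF // mulr1.
have := ae_regular_path brownianB solutionX; apply: filterS => w regw Aw nR t ut lt bt.
exact: nR (path_hits regw Aw ut lt bt).
Qed.

End Return.

(** * Probability of a bifurcation *)

Section RealProbability.
Context d (T : measurableType d) (R : realType) (P : probability T R).
Implicit Types (A B E : set T) (p r : R).

Definition prob A : R := fine (P A).

Lemma probE A : measurable A -> P A = (prob A)%:E.
Proof. by move=> mA; rewrite /prob fineK // fin_num_measure. Qed.

Lemma prob_ge0 A : 0 <= prob A.
Proof. by rewrite fine_ge0. Qed.

Lemma prob_le1 A : measurable A -> prob A <= 1.
Proof. by move=> mA; rewrite -lee_fin -probE //; exact: probability_le1. Qed.

Lemma prob_mono A B : measurable A -> measurable B -> A `<=` B -> prob A <= prob B.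
Proof. by move=> mA mB AB; rewrite -lee_fin -!probE //; apply: le_measure; rewrite ?inE. Qed.

Lemma probU A B : measurable A -> measurable B -> A `&` B = set0 ->
  prob (A `|` B) = prob A + prob B.
Proof. by move=> mA mB AB; rewrite /prob measureU // fineD ?fin_num_measure. Qed.

Lemma probC A : measurable A -> prob (~` A) = 1 - prob A.
Proof. by move=> mA; rewrite {1}/prob probability_setC // probE // fineB. Qed.

Lemma prob_ae0 A : measurable A -> {ae P, forall w, ~ A w} -> prob A = 0.
Proof.
move=> mA aeA; have nA : P.-negligible A.
  by apply: negligibleS aeA => w Aw /=; apply.
by move/(negligibleP P mA) : nA => PA; rewrite /prob [X in fine X](_ : _ = 0%E).
Qed.

Lemma integral_prob A : measurable A -> \int[P]_w (\1_A w : R) = prob A.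
Proof. by move=> mA; rewrite /Rintegral integral_indic // setIT. Qed.

(** Meant for the disjoint events of an exit at each grid index: the estimates, obtained separately
    at their own deterministic times, add up with the same relative loss r. *)
Lemma prob_union_ge (D : nat -> set T) r (Qp : T -> Prop) n : 0 <= r ->
  (forall j, measurable (D j)) -> (forall i j, (i < j)%N -> D i `&` D j = set0) ->
  (forall j, exists I, [/\ measurable I, I `<=` D j, (1 - r) * prob (D j) <= prob I &
     {ae P, forall w, I w -> Qp w}]) ->
  exists I, [/\ measurable I, I `<=` \bigcup_(j in [set j | (j < n)%N]) D j,
     (1 - r) * prob (\bigcup_(j in [set j | (j < n)%N]) D j) <= prob I &
     {ae P, forall w, I w -> Qp w}].
Proof.
move=> r0 mD dD H; elim: n => [|n [I [mI sI pI aI]]].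
  exists set0; split => //; last by apply: aeW.
  rewrite (_ : \bigcup_(_ in _) _ = set0) ?/prob ?measure0 ?mulr0 //.
  by apply/seteqP; split => w // [].
have [I' [mI' sI' pI' aI']] := H n.
have U : \bigcup_(j in [set j | (j < n.+1)%N]) D j = (\bigcup_(j in [set j | (j < n)%N]) D j) `|` D n.
  apply/seteqP; split => w.
    case=> j /=; rewrite ltnS leq_eqVlt => /predU1P[-> Dn|jn Dj]; first by right.
    by left; exists j.
  by case=> [[j /= jn Dj]|Dn]; [exists j => //=; exact: ltnW|exists n => /=].
have dU : (\bigcup_(j in [set j | (j < n)%N]) D j) `&` D n = set0.
  apply/seteqP; split => w // [[j /= jn Dj] Dn].
  by have : (D j `&` D n) w by []; rewrite dD.
have mU : measurable (\bigcup_(j in [set j | (j < n)%N]) D j) by exact: bigcup_measurable.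
exists (I `|` I'); split; first exact: measurableU.
- by rewrite U; exact: setUSS.
- rewrite U !probU //; first by rewrite mulrDr; exact: lerD.
  by apply/seteqP; split => w // [/sI h1 /sI' h2]; rewrite -dU; split.
- by apply: filterS2 aI aI' => w h1 h2 [/h1|/h2].
Qed.

(** The unions A and B of the inner approximations of E and of its complement meet in a null set,
    and their probabilities are at least p and 1 - p. Hence both bounds are equalities, A and B
    cover almost everything, and A differs from E by a negligible set. *)
Lemma has_probability_approx E p :
  (forall e, 0 < e -> exists I, [/\ measurable I, p - e <= prob I & {ae P, forall w, I w -> E w}]) ->
  (forall e, 0 < e -> exists J, [/\ measurable J, 1 - p - e <= prob J & {ae P, forall w, J w -> ~ E w}]) ->
  has_probability P E p.
Proof.
move=> HI HJ.
have e0 n : 0 < n.+1%:R^-1 :> R by rewrite invr_gt0 ltr0n.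
have [I HI'] := choice (fun n => HI _ (e0 n)).
have [J HJ'] := choice (fun n => HJ _ (e0 n)).
have mI n : measurable (I n) by have [] := HI' n.
have mJ n : measurable (J n) by have [] := HJ' n.
have mA : measurable (\bigcup_n I n) by exact: bigcupT_measurable.
have mB : measurable (\bigcup_n J n) by exact: bigcupT_measurable.
set A := \bigcup_n I n in mA *; set B := \bigcup_n J n in mB *.
have aA : {ae P, forall w, A w -> E w}.
  have : {ae P, forall w, forall n, I n w -> E w} by apply: ae_foralln => n; have [] := HI' n.
  by apply: filterS => w H [n _ /H].
have aB : {ae P, forall w, B w -> ~ E w}.
  have : {ae P, forall w, forall n, J n w -> ~ E w} by apply: ae_foralln => n; have [] := HJ' n.
  by apply: filterS => w H [n _ /H].
have lim (x y : R) : (forall n, x - n.+1%:R^-1 <= y) -> x <= y.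
  move=> H; apply/ler_addgt0Pr => e e1.
  have [M /(_ M (leqnn M))] := mesh_small (ler01) e1.
  by rewrite div1r; have := H M; set q := _^-1; lra.
have pA : p <= prob A.
  apply: lim => n; have [_ h _] := HI' n; apply: le_trans h _.
  by apply: prob_mono => //; exact: bigcup_sup.
have pB : 1 - p <= prob B.
  apply: lim => n; have [_ h _] := HJ' n; apply: le_trans h _.
  by apply: prob_mono => //; exact: bigcup_sup.
have AB0 : prob (A `&` B) = 0.
  apply: prob_ae0; first exact: measurableI.
  by apply: filterS2 aA aB => w h1 h2 [/h1 + /h2].
have AE : prob A = prob (A `\` B).
  have mAB : measurable (A `&` B) by exact: measurableI.
  have mDB : measurable (A `\` B) by exact: measurableD.
  have := @probU (A `\` B) (A `&` B) mDB mAB; rewrite setDE setIACA setICl setI0 => /(_ erefl).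
  by rewrite -setIUr setUC setUCr setIT AB0 addr0.
have ABU : prob (A `|` B) = prob A + prob B.
  have mDB : measurable (A `\` B) by exact: measurableD.
  rewrite AE -probU //; first by rewrite setDE setUIl setUCl setIT.
  by rewrite setDE -setIA setICl setI0.
have AB1 := prob_le1 (measurableU _ _ mA mB).
rewrite ABU in AB1.
exists A; split=> //; last by rewrite probE //; congr (_%:E); lra.
have mN : measurable (~` (A `|` B)) by apply: measurableC; exact: measurableU.
have N0 : {ae P, forall w, ~ (~` (A `|` B)) w}.
  exists (~` (A `|` B)); split => //; last by move=> w /=; apply: contra_notP.
  apply/eqP; rewrite probE // eqe probC ?ABU; last exact: measurableU.
  by apply/eqP; lra.
have : {ae P, forall w, ~ (A `+` E) w}.
  apply: filterS3 aA aB N0 => w h1 h2 h3 [[Aw nE]|[Ew nA]]; first exact: nE (h1 Aw).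
  by apply: h3 => -[//|/h2]; apply.
by apply: negligibleS => w h /=; apply.
Qed.

End RealProbability.

(** * Limits of the scale function and the constants lambda *)

Section Scale.
Context {R : realType}.
Variables (k a1 a2 b1 b2 : R).
Hypothesis k0 : 0 < k.
Hypothesis a1_gt : -1 < a1.
Hypothesis a2_gt : -1 < a2.
Hypothesis b1_lt0 : b1 < 0.
Hypothesis b2_gt0 : 0 < b2.
Variable S : R -> R.
Hypothesis S0 : S 0 = 0.
Hypothesis dS : forall x : R, is_derive x 1 S (scale_density k a1 a2 b1 b2 x).

Let p1_gt0 : 0 < a1 + 1. Proof. by have := a1_gt; lra. Qed.
Let p2_gt0 : 0 < a2 + 1. Proof. by have := a2_gt; lra. Qed.

(** Moves the negative half-line to the positive one: its limit at +oo is the opposite of the limit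
    of S at -oo. *)
Definition reflect_scale (y : R) : R := - S (- y).

Let kap1_gt0 : 0 < `|b1| / (k * (a1 + 1)).
Proof. by rewrite divr_gt0 ?mulr_gt0 // normr_gt0 lt_eqF. Qed.

Let kap2_gt0 : 0 < b2 / (k * (a2 + 1)).
Proof. by rewrite divr_gt0 ?mulr_gt0. Qed.

Let R0 : reflect_scale 0 = 0.
Proof. by rewrite /reflect_scale oppr0 S0 oppr0. Qed.

Let dR (x : R) : is_derive x 1 reflect_scale (scale_density k a1 a2 b1 b2 (- x)).
Proof.
have d1 := derivef_comp (f := S) (g := fun t => - t) (dS (- x)) (derive_neg x).
have d2 := derivef_comp (f := fun t => - t) (g := fun t => S (- t)) (derive_neg _) d1.
by apply: (derivef_eq d2) => //; ring.
Qed.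

Let limE1 := stretched_limitE p1_gt0 kap1_gt0 R0 dR
  (fun x => scale_density_opp b2 k0 a1_gt a2_gt b1_lt0 (y := x)).
Let limE2 := stretched_limitE p2_gt0 kap2_gt0 S0 dS
  (fun x => scale_density_ge0 b1 b2 k0 a1_gt a2_gt (y := x)).

Lemma Gamma_scale :
  Gamma (a1 + 1)^-1 = (a1 + 1) * (`|b1| / (k * (a1 + 1))) `^ (a1 + 1)^-1 * stretched_limit reflect_scale /\
  Gamma (a2 + 1)^-1 = (a2 + 1) * (b2 / (k * (a2 + 1))) `^ (a2 + 1)^-1 * stretched_limit S.
Proof. by split; [exact: limE1|exact: limE2]. Qed.

Lemma scale_mono x y : x <= y -> S x <= S y.
Proof.
move=> xy; have [c _ E] := mean_value dS x y.
rewrite -subr_ge0 E mulr_ge0 ?subr_ge0 //.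
by have /andP[/ltW] := scale_density_le1 k0 a1_gt a2_gt b1_lt0 b2_gt0 c.
Qed.

Lemma scale_lt y : S y < stretched_limit S.
Proof.
have H := stretched_lt_limit p2_gt0 kap2_gt0 S0 dS (fun x => scale_density_ge0 b1 b2 k0 a1_gt a2_gt (y := x)).
have [y0|y0] := leP 0 y; first exact: H.
by apply: le_lt_trans (H 0 (lexx _)); apply: scale_mono; exact: ltW.
Qed.

Lemma scale_gt y : - stretched_limit reflect_scale < S y.
Proof.
have H := stretched_lt_limit p1_gt0 kap1_gt0 R0 dR (fun x => scale_density_opp b2 k0 a1_gt a2_gt b1_lt0 (y := x)).
rewrite ltrNl.
have [y0|y0] := leP 0 (- y); first by have := H _ y0; rewrite /reflect_scale opprK.
apply: le_lt_trans (H 0 (lexx _)); rewrite /reflect_scale lerN2; apply: scale_mono.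
by rewrite oppr0 ltW // -oppr_lt0.
Qed.

Lemma scale_near e : 0 < e -> exists2 K0 : R, 0 <= K0 & forall K, K0 <= K ->
  stretched_limit S - e < S K /\ S (- K) < - stretched_limit reflect_scale + e.
Proof.
move=> e0.
have [x x0 Hx] := stretched_near_limit p2_gt0 kap2_gt0 S0 dS (fun x => scale_density_ge0 b1 b2 k0 a1_gt a2_gt (y := x)) e0.
have [z z0 Hz] := stretched_near_limit p1_gt0 kap1_gt0 R0 dR (fun x => scale_density_opp b2 k0 a1_gt a2_gt b1_lt0 (y := x)) e0.
exists (Num.max x z); first by rewrite le_max x0.
move=> K; rewrite ge_max => /andP[xK zK]; split; first exact: Hx.
by have := Hz K zK; rewrite /reflect_scale; lra.
Qed.

Lemma scale_limit_gt0 : 0 < stretched_limit S /\ 0 < stretched_limit reflect_scale.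
Proof. by have := scale_lt 0; have := scale_gt 0; rewrite S0 oppr_lt0. Qed.

End Scale.

(** The substitution formula for the Gamma integral, solved for 1 / L with k = sigma^2 / 2, is the
    expression of lambda once the powers are separated; the factor in a + 1 comes from a / (a + 1) =
    1 - 1 / (a + 1). *)
Lemma lambda_limit (R : realType) (sigma a b L : R) : 0 < sigma -> -1 < a -> 0 < b -> 0 < L ->
  Gamma (a + 1)^-1 = (a + 1) * (b / (sigma ^+ 2 / 2 * (a + 1))) `^ (a + 1)^-1 * L ->
  lambda sigma a b = L^-1.
Proof.
move=> s0 a_gt b0 L0 GE.
have p0 : 0 < a + 1 by lra.
rewrite /lambda GE (gtr0_norm b0); set p := a + 1 in p0 *.
have -> : b / (sigma ^+ 2 / 2 * p) = (2 * b) * (sigma ^+ 2 * p)^-1.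
  by field; rewrite !gt_eqF.
have s20 : 0 < sigma ^+ 2 by rewrite exprn_gt0.
have sp0 : 0 < sigma ^+ 2 * p by rewrite mulr_gt0.
rewrite powRM ?invr_ge0 ?(ltW sp0) ?mulr_ge0 ?(ltW b0) //.
have -> : (sigma ^+ 2 * p)^-1 `^ p^-1 = (sigma `^ (2 / p) * p `^ p^-1)^-1.
  have spr : (sigma ^+ 2 * p) `^ p^-1 != 0 by rewrite gt_eqF ?powR_gt0.
  transitivity ((sigma ^+ 2 * p) `^ p^-1)^-1.
    apply: (mulIf spr); rewrite -powRM ?invr_ge0 ?(ltW sp0) // !mulVf ?powR1 //.
    by rewrite gt_eqF.
  congr (_^-1); rewrite powRM ?(ltW s20) ?(ltW p0) // -powR_mulrn ?(ltW s0) // -powRrM //.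
have -> : p `^ (a / p) = p / p `^ p^-1.
  have -> : a / p = 1 - p^-1 by rewrite /p; field; rewrite gt_eqF.
  have pn0 : p != 0 by rewrite gt_eqF.
  have pp : p `^ p^-1 != 0 by rewrite gt_eqF ?powR_gt0.
  apply: (mulIf pp); rewrite divfK // -powRD; last by rewrite pn0 implybT.
  by rewrite subrK powRr1 // ltW.
have h1 : 0 < (2 * b) `^ p^-1 by rewrite powR_gt0 // mulr_gt0.
have h2 : 0 < p `^ p^-1 by rewrite powR_gt0.
have h3 : 0 < sigma `^ (2 / p) by rewrite powR_gt0.
by field; rewrite !gt_eqF.
Qed.

Section Bifurcation.
Context d (T : measurableType d) (R : realType).
Variables (P : probability T R) (F : R -> set (set T)).
Variables (sigma a1 a2 b1 b2 : R) (B X : R -> T -> R) (zeta : T -> \bar R).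
Hypothesis sigma_gt0 : 0 < sigma.
Hypothesis a1_gt : -1 < a1.
Hypothesis a2_gt : -1 < a2.
Hypothesis b1_lt0 : b1 < 0.
Hypothesis b2_gt0 : 0 < b2.
Hypothesis filtrationF : filtration F.
Hypothesis brownianB : brownian_motion P F sigma B.
Hypothesis solutionX : solution P F B a1 a2 b1 b2 X zeta.
Variable S : R -> R.
Hypothesis S0 : S 0 = 0.
Let k := sigma ^+ 2 / 2.
Hypothesis dS : forall x : R, is_derive x 1 S (scale_density k a1 a2 b1 b2 x).
Let k0 : 0 < k. Proof. by rewrite divr_gt0 // exprn_gt0. Qed.
Let cS : continuous S. Proof. exact: is_derive_continuous dS. Qed.

Let sF t : 0 <= t -> sigma_algebra [set: T] (F t).
Proof. by have [h _ _] := filtrationF; exact: h. Qed.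
Let subF t : 0 <= t -> F t `<=` measurable.
Proof. by have [_ h _] := filtrationF; exact: h. Qed.
Let monoF s t : 0 <= s -> s <= t -> F s `<=` F t.
Proof. by have [_ _ h] := filtrationF; exact: h. Qed.

Lemma live_difference_neq0 t w : live_difference B X zeta t w != 0 -> alive zeta t w.
Proof. by rewrite /live_difference; case: asboolP => //; rewrite eqxx. Qed.

Lemma measurable_lt (K : R) : measurable [set y : R | y < K].
Proof.
rewrite (_ : mkset _ = `]-oo, K[%classic); first exact: measurable_itv.
by apply/seteqP; split => y /=; rewrite in_itv.
Qed.

Lemma measurable_gt (K : R) : measurable [set y : R | K < y].
Proof.
rewrite (_ : mkset _ = `]K, +oo[%classic); first exact: measurable_itv.
by apply/seteqP; split => y /=; rewrite in_itv /= andbT.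
Qed.

(** Y starts at 0 only almost surely; as an event of F 0 of probability 1, this serves as the
    starting event at time 0. *)
Definition start : set T := [set w | alive zeta 0 w /\ live_difference B X zeta 0 w = 0].

Lemma adapted_start : F 0 start.
Proof.
have s0 := sF (lexx 0).
rewrite -(measurable_subalgebraE s0).
apply: measurableI.
  by rewrite measurable_subalgebraE //; exact: (adapted_alive solutionX (lexx 0)).
have := adapted_live_difference filtrationF brownianB solutionX (lexx 0) measurableT (measurable_set1 0).
by rewrite setTI.
Qed.

Lemma ae_start : {ae P, forall w, start w}.
Proof.
have := ae_regular_path brownianB solutionX; apply: filterS => w regw.
have [B0 _ z0 XE _] := regw.
split => //; rewrite live_differenceE // B0 subr0.
have [_ ->] := XE 0 (lexx 0) z0.
by rewrite set_itv1 /Rintegral integral_set1.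
Qed.

(** * Exit from a symmetric interval *)

Section Exit.
Variables (K : R).
Hypothesis K0 : 0 < K.

Let upper l m := hits B X zeta [set y : R | K < y] start 0 (- K) K l m.
Let lower l m := hits B X zeta [set y : R | y < - K] start 0 (- K) K l m.

(** A cut-off version of y^2 / 2, up to a constant: its generator is y D y + k >= k, because the
    drift has the sign of y. *)
Lemma quadratic_test : exists (f f1 f2 : R -> R) (C0 : R), [/\ test_function f f1 f2,
  forall x, `|f x| <= C0 &
  forall z, - K - 1 <= z <= K + 1 -> k <= generator (drift a1 a2 b1 b2) f1 f2 k z].
Proof.
have K10 : 0 <= K + 1 by have := K0; lra.
have [f [f1 [f2 [tf _ _ E]]]] := cutoff_test_function K10 (fun x : R => derivef_id x) (fun x => cvg_cst (1 : R)).
have [C0 HC0] := test_bound0 tf.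
exists f, f1, f2, C0; split => // z zK.
have [E1 E2] : f1 z = z /\ f2 z = 1.
  by apply: E; move: zK => /andP[z1 z2]; rewrite ler_norml; apply/andP; split; lra.
rewrite /generator E1 E2 mulr1 lerDr /drift; case: ifP => z0.
  by rewrite mulr_le0 // mulr_le0_ge0 ?powR_ge0 // ltW.
by rewrite mulr_ge0 ?mulr_ge0 ?powR_ge0 ?(ltW b2_gt0) // ltW // ltNge z0.
Qed.

Lemma hits_upper_lower l m w : upper l m w -> lower l m w -> False.
Proof.
move=> hu hl; have [kap km Hk] := exit_index B X zeta start 0 (l / m.+1%:R) (- K) K m.+1 w.
have u1 := hits_exit (fun y => _) km Hk hu; have l1 := hits_exit (fun y => _) km Hk hl.
have : K < live_difference B X zeta (grid 0 (l / m.+1%:R) kap) w.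
  by apply: u1 => y /andP[_ y2] /=; rewrite ltNge y2.
have : live_difference B X zeta (grid 0 (l / m.+1%:R) kap) w < - K.
  by apply: l1 => y /andP[y1 _] /=; rewrite ltNge y1.
by have := K0; lra.
Qed.

(** On a mesh fine enough for the path, it is still alive at the exit point; a dead path, whose
    conventional value is 0, would count neither as above K nor as below - K. *)
Lemma path_exit l w : 0 < l -> regular_path a1 a2 b1 b2 B X zeta w -> start w ->
  exists M, forall m, (M <= m)%N ->
    [\/ active B X zeta start 0 (l / m.+1%:R) (- K) K m w, upper l m w | lower l m w].
Proof.
move=> l0 regw sw; have [al y0] := sw.
have [c [c0 lc [M HM]]] := horizon regw (- K) K (lexx 0) al l0.
exists M => m /HM {}HM.
have [kap km Hk] := exit_index B X zeta start 0 (l / m.+1%:R) (- K) K m.+1 w.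
have [am|nam] := pselect (active B X zeta start 0 (l / m.+1%:R) (- K) K m w); first by constructor 1.
have act0 : active B X zeta start 0 (l / m.+1%:R) (- K) K 0 w.
  apply/active0E; split => //; rewrite y0; have := K0; rewrite oppr_le0 => h; by rewrite !ltW.
have kap0 : (0 < kap)%N by apply/Hk.
have {km} km : (kap <= m)%N by rewrite leqNgt; apply/negP => /(Hk m (ltnSn m)).
have ins j : (j < kap)%N -> inside B X zeta 0 (l / m.+1%:R) (- K) K j w.
  move=> jk; have /Hk : (j < kap)%N by []; case; last by move=> _ H; exact: H.
  by apply: ltn_trans jk _.
have gc := HM kap (leqW km) ins.
have an : active B X zeta start 0 (l / m.+1%:R) (- K) K kap.-1 w.
  by apply/Hk; rewrite prednK // leqW.
have nin : ~ inside B X zeta 0 (l / m.+1%:R) (- K) K kap w.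
  move=> ik; have /(Hk kap) : (kap < m.+1)%N by [].
  rewrite ltnn => -[h _]; suff : false by []; apply: h.
  split=> // j; rewrite leq_eqVlt => /predU1P[->//|]; exact: ins.
have lk : alive zeta (grid 0 (l / m.+1%:R) kap) w by exact: alive_le lc.
have km1 : (kap.-1 <= m)%N by apply: leq_trans km; exact: leq_pred.
have [up|up] := ltP K (live_difference B X zeta (grid 0 (l / m.+1%:R) kap) w).
  by constructor 2; exists kap.-1 => //; rewrite prednK.
have [lw|lw] := ltP (live_difference B X zeta (grid 0 (l / m.+1%:R) kap) w) (- K).
  by constructor 3; exists kap.-1 => //; rewrite prednK.
by exfalso; apply: nin; split => //; rewrite lw up.
Qed.

Let mU l m : 0 < l -> measurable (upper l m).
Proof. by move=> l0; exact: (measurable_hits filtrationF brownianB solutionX (measurable_gt K) (lexx 0) adapted_start). Qed.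

Let mL l m : 0 < l -> measurable (lower l m).
Proof. by move=> l0; exact: (measurable_hits filtrationF brownianB solutionX (measurable_lt (- K)) (lexx 0) adapted_start). Qed.

Lemma exit_eventually e : 0 < e -> exists2 l : R, 0 < l & exists M, forall m, (M <= m)%N ->
  1 - e <= prob P (upper l m) + prob P (lower l m).
Proof.
move=> e0.
have [f [f1 [f2 [C0 [tf fC0 gen]]]]] := quadratic_test.
have C00 : 0 <= C0 by apply: le_trans (fC0 0).
(* Then k * l = 2 * (2 * C0 + 1) / e, and the exit bound makes the probability of staying inside up
   to time l at most e / 2. *)
pose l := 2 * (2 * C0 + 1) / (k * e).
have ke0 : 0 < k * e by rewrite mulr_gt0.
have l0 : 0 < l by rewrite divr_gt0 //; lra.
have NKK : - K <= K by have := K0; lra.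
exists l => //.
have [M1 HM1] := exit_bound sigma_gt0 filtrationF brownianB solutionX (lexx 0) l0 adapted_start NKK tf fC0 k0 gen.
pose N m := active B X zeta start 0 (l / m.+1%:R) (- K) K m.
have mN m : measurable (N m) := measurable_active filtrationF brownianB solutionX (- K) K (lexx 0) l0 adapted_start m m.
pose W m := ~` (N m `|` (upper l m `|` lower l m)).
have mUL m : measurable (upper l m `|` lower l m) by apply: measurableU; [exact: mU|exact: mL].
have mW m : measurable (W m) by apply: measurableC; apply: measurableU.
have e20 : 0 < e / 2 by lra.
(* W gathers the paths for which the mesh is still too coarse; the first index of the double limit
   is a dummy here. *)
have [|M2 HM2] := @prob_double_limit _ _ _ P (fun _ => W) (e / 2) (fun _ => mW) _ e20.
  apply: filterS2 (ae_regular_path brownianB solutionX) ae_start => w regw sw.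
  exists 0%N => n _; have [M HM] := path_exit l0 regw sw; exists M => m /HM.
  by case=> h; apply; [left|right; left|right; right].
have [M3 HM3] := HM2 M2 (leqnn M2).
exists (M1 + M3)%N => m Mm.
have {HM1} := HM1 m (leq_trans (leq_addr _ _) Mm); rewrite -/(N m) -/(prob P (N m)) => HN.
have {HM3} := HM3 m (leq_trans (leq_addl _ _) Mm); rewrite probE // lee_fin => HW.
have PN : prob P (N m) <= e / 2.
  have kl : k * l = 2 * (2 * C0 + 1) / e by rewrite /l; field; rewrite !gt_eqF.
  move: HN; rewrite kl mulrAC ler_pdivrMr // => HN.
  have c0 : 0 < 2 * C0 + 1 by lra.
  by rewrite -(ler_pM2l c0); lra.
have disj : upper l m `&` lower l m = set0.
  by apply/seteqP; split => w // [h1 h2]; exact: (hits_upper_lower h1 h2).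
rewrite -probU //; [|exact: mU|exact: mL].
have : prob P (~` (upper l m `|` lower l m)) <= prob P (N m) + prob P (W m).
  have dNW : N m `&` W m = set0.
    by apply/seteqP; split => w // [h1 h2]; apply: h2; left.
  rewrite -probU //; apply: prob_mono; [exact: measurableC|exact: measurableU|].
  move=> w nUL; have [Nw|nN] := pselect (N m w); first by left.
  by right => -[].
rewrite probC //; lra.
Qed.

Let Lp := stretched_limit S.
Let Ln := stretched_limit (reflect_scale S).

(** S (Y) has mean nearly 0 at the end; it is within dl of Lp on [upper] and of - Ln on [lower], and
    lies between - Ln and Lp in all cases. The last term accounts for the paths without a seen
    exit. *)
Lemma exit_balance l dl : 0 < l -> 0 < dl -> Lp - dl <= S K -> S (- K) <= - Ln + dl ->
  exists M, forall m, (M <= m)%N ->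
    `|Lp * prob P (upper l m) - Ln * prob P (lower l m)| <=
     2 * dl + (Lp + Ln) * (1 - prob P (upper l m) - prob P (lower l m)).
Proof.
move=> l0 dl0 SK SNK.
have NKK : - K <= K by have := K0; lra.
have [Lp0 Ln0] := scale_limit_gt0 k0 a1_gt a2_gt b1_lt0 b2_gt0 S0 dS.
rewrite -/Lp -/Ln in Lp0 Ln0.
have [M HM] := scale_gain sigma_gt0 filtrationF brownianB solutionX (lexx 0) l0 adapted_start NKK a1_gt a2_gt b1_lt0 b2_gt0 S0 dS dl0.
exists M => m /HM {HM}.
set g := gain _ _ _ _ _ _ _ _ _ _ => Eg.
have mUm := mU m l0; have mLm := mL m l0.
set U := upper l m in mUm *; set L := lower l m in mLm *.
have disj : U `&` L = set0.
  by apply/seteqP; split => w // [h1 h2]; exact: (hits_upper_lower h1 h2).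
have i1 (E : set T) (c : R) : measurable E -> P.-integrable setT (EFin \o (fun w => c * \1_E w : R)).
  by move=> mE; apply: integrable_scale => //; exact: integrable_indic_prob.
have i2 (c : R) : P.-integrable setT (EFin \o (fun=> c)).
  exact: (@prob_bounded_integrable _ _ _ P _ `|c|).
have lo_hi y : - Ln <= S y <= Lp.
  by rewrite !ltW //; [exact: (scale_lt k0 a1_gt a2_gt b1_lt0 b2_gt0 S0 dS)|exact: (scale_gt k0 a1_gt a2_gt b1_lt0 b2_gt0 S0 dS)].
have ig : P.-integrable setT (EFin \o g).
  apply: (@prob_bounded_integrable _ _ _ P _ (Lp + Ln)).
    exact: (measurable_gain filtrationF brownianB solutionX (- K) K (lexx 0) l0 adapted_start m cS).
  move=> w; apply: gain_le => // x y _ _.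
  by have /andP[x1 x2] := lo_hi x; have /andP[y1 y2] := lo_hi y; rewrite ler_norml; apply/andP; split; lra.
have Sm := scale_mono k0 a1_gt a2_gt b1_lt0 b2_gt0 dS.
have key w : (U w -> Lp - dl <= g w <= Lp) /\ (L w -> - Ln <= g w <= - Ln + dl) /\ - Ln <= g w <= Lp.
  have [act|nact] := pselect (active B X zeta start 0 (l / m.+1%:R) (- K) K 0 w); last first.
    have g0 : g w = 0 by rewrite /g gain_inactive.
    split; [|split]; last by rewrite g0 oppr_le0 !ltW.
      by move=> [n _ [an _]]; exfalso; apply: nact; exact: active_mono an.
    by move=> [n _ [an _]]; exfalso; apply: nact; exact: active_mono an.
  have /active0E [[_ y0] _ _] := act.
  have [kap km Hk] := exit_index B X zeta start 0 (l / m.+1%:R) (- K) K m.+1 w.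
  have gE : g w = S (clamp (- K) K (live_difference B X zeta (grid 0 (l / m.+1%:R) kap) w)).
    rewrite /g (gainE S km Hk) (_ : grid 0 (l / m.+1%:R) 0 = 0); last by rewrite /grid mul0r addr0.
    rewrite y0 [X in _ - S X](_ : _ = 0) ?S0 ?subr0 //.
    by apply: clamp_id; apply/andP; have := K0; split; lra.
  have lh := lo_hi (clamp (- K) K (live_difference B X zeta (grid 0 (l / m.+1%:R) kap) w)).
  rewrite gE; split; [|split] => //.
    move=> hu; have hK : K < live_difference B X zeta (grid 0 (l / m.+1%:R) kap) w.
      by apply: (hits_exit _ km Hk hu) => y /andP[_ y2] /=; rewrite ltNge y2.
    have /andP[_ ->] := lh; rewrite andbT; apply: le_trans SK _; apply: Sm.
    by rewrite /clamp le_max le_min (ltW hK) lerDl ler01 orbT.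
  move=> hl; have hK : live_difference B X zeta (grid 0 (l / m.+1%:R) kap) w < - K.
    by apply: (hits_exit _ km Hk hl) => y /andP[y1 _] /=; rewrite ltNge y1.
  have /andP[-> _] := lh; apply: le_trans SNK; apply: Sm.
  by rewrite /clamp ge_max ge_min (ltW hK) gerDl lerN10.
have up : \int[P]_w g w <= \int[P]_w (Lp + (- (Lp + Ln) + dl) * \1_L w).
  apply: le_Rintegral => //; first by apply: integrable_add => //; exact: i1.
  move=> w _; have [_ [h2 /andP[_ h3]]] := key w.
  rewrite indicE; have [Lw|nLw] := pselect (L w); last by rewrite memNset // mulr0 addr0.
  by rewrite mem_set // mulr1; have /andP[_] := h2 Lw; lra.
have dn : \int[P]_w (- Ln + (Lp + Ln - dl) * \1_U w) <= \int[P]_w g w.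
  apply: le_Rintegral => //; first by apply: integrable_add => //; exact: i1.
  move=> w _; have [h2 [_ /andP[h3 _]]] := key w.
  rewrite indicE; have [Uw|nUw] := pselect (U w); last by rewrite memNset // mulr0 addr0.
  by rewrite mem_set // mulr1; have /andP[+ _] := h2 Uw; lra.
have i0 (E : set T) := @integrable_indic_prob _ _ _ P E.
rewrite RintegralD // in up; last exact: i1.
rewrite RintegralD // in dn; last exact: i1.
rewrite prob_Rintegral_cst RintegralZl // ?integral_prob // in up; last exact: i0.
rewrite prob_Rintegral_cst RintegralZl // ?integral_prob // in dn; last exact: i0.
have PU1 : prob P U <= 1 by exact: prob_le1.
have PL1 : prob P L <= 1 by exact: prob_le1.
have PU0 := prob_ge0 P U; have PL0 := prob_ge0 P L.
move: Eg; rewrite ler_norml => /andP[Eg1 Eg2].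
have d1 : dl * prob P L <= dl by rewrite ger_pMr.
have d2 : dl * prob P U <= dl by rewrite ger_pMr.
have UL1 : prob P U + prob P L <= 1.
  by rewrite -probU // prob_le1 //; exact: measurableU.
have s1 : 0 <= Ln * (1 - prob P U - prob P L) by rewrite mulr_ge0 ?(ltW Ln0) //; lra.
have s2 : 0 <= Lp * (1 - prob P U - prob P L) by rewrite mulr_ge0 ?(ltW Lp0) //; lra.
move: up dn d1 d2 s1 s2; rewrite ler_norml.
set a := prob P U; set b := prob P L; move=> up dn d1 d2 s1 s2.
by apply/andP; split; nra.
Qed.

End Exit.
(** The exit event is the disjoint union of the events D j of an exit at index j + 1, and D j is
    known at the deterministic time [grid 0 h j.+1], from which the return bound is applied. The
    total loss is at most the return ratio, the union having probability at most 1. *)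
Lemma stay_after_exit (e Vinf V1 VK K l : R) (bad ex : set R) (lo hi : nat -> R) (Qp : T -> Prop) m :
  0 < l -> `|e| = 1 -> V1 < Vinf -> VK <= Vinf -> measurable bad -> measurable ex ->
  (forall y, - K <= y <= K -> ~ ex y) ->
  (forall y, ex y -> [/\ y != 0, ~ bad y & VK <= e * S y]) ->
  (forall i, lo i <= hi i) ->
  (forall i y, lo i <= y <= hi i -> ~ bad y) ->
  (forall y, e * S y <= Vinf) ->
  (forall i y, bad y -> e * S (clamp (lo i) (hi i) y) <= V1) ->
  (forall C : R, exists i0, forall i, (i0 <= i)%N ->
    forall y, `|y| <= C -> ~ bad y -> lo i <= y <= hi i) ->
  (forall y, bad y -> exists2 dl : R, 0 < dl & forall z, `|y - z| < dl -> bad z) ->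
  (forall w s, 0 <= s -> alive zeta s w ->
    (forall t, s < t -> alive zeta t w -> ~ bad (X t w - B t w)) -> Qp w) ->
  exists I, [/\ measurable I,
    prob P (hits B X zeta ex start 0 (- K) K l m) - (Vinf - VK) / (Vinf - V1) <= prob P I &
    {ae P, forall w, I w -> Qp w}].
Proof.
move=> l0 e1 V1inf VKinf mbad mex nex exK lohi nbad SV Sbad exh op HQ.
set h := l / m.+1%:R; have h0 : 0 < h by rewrite divr_gt0.
pose D j := active B X zeta start 0 h (- K) K j `&` live_difference B X zeta (grid 0 h j.+1) @^-1` ex.
have g0 j : 0 <= grid 0 h j by exact: grid_ge0.
have FD j : F (grid 0 h j.+1) (D j).
  rewrite -(measurable_subalgebraE (sF (g0 j.+1))); apply: measurableI.
    rewrite measurable_subalgebraE; last exact: sF.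
    apply: (monoF (g0 j)); first by rewrite gridS lerDl ltW.
    exact: (adapted_active filtrationF brownianB solutionX (- K) K (lexx 0) h0 adapted_start).
  have := adapted_live_difference filtrationF brownianB solutionX (g0 j.+1) measurableT mex.
  by rewrite setTI.
have mD j : measurable (D j) by exact: subF (FD j).
have dD i j : (i < j)%N -> D i `&` D j = set0.
  move=> ij; apply/seteqP; split => w // [[_ ei] [[_ aj] _]].
  by have [_ /nex] := aj i.+1 ij.
set r := (Vinf - VK) / (Vinf - V1).
have r0 : 0 <= r by rewrite divr_ge0 ?subr_ge0 // ltW.
have [j|I [mI _ pI aI]] := @prob_union_ge _ _ _ P D r Qp m.+1 r0 mD dD.
  have DA w : D j w -> [/\ alive zeta (grid 0 h j.+1) w, ~ bad (live_difference B X zeta (grid 0 h j.+1) w) &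
      VK <= e * S (live_difference B X zeta (grid 0 h j.+1) w)].
    by move=> [_ /exK [y0 nb VS]]; split => //; exact: live_difference_neq0.
  have [Ret [mR pR aR]] := return_bound sigma_gt0 a1_gt a2_gt b1_lt0 b2_gt0 filtrationF brownianB solutionX S0 dS
    e1 V1inf VKinf mbad (g0 j.+1) (FD j) DA lohi nbad (fun i y _ => SV y) Sbad exh op.
  have mDR : measurable (D j `\` Ret) by exact: measurableD.
  exists (D j `\` Ret); split => //.
  - have : prob P (D j) <= prob P (D j `\` Ret) + prob P Ret.
      rewrite -lee_fin EFinD -!probE //; apply: le_trans (measureU2 _ mDR mR).
      apply: le_measure; rewrite ?inE //; first exact: measurableU.
      by move=> w Dw; have [Rw|nR] := pselect (Ret w); [right|left].
    by move: pR; rewrite -/r -/(prob P Ret) -/(prob P (D j)); lra.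
  - apply: filterS aR => w H [Dw nR]; have [al _ _] := DA w Dw.
    exact: (HQ w _ (g0 j.+1) al (H Dw nR)).
exists I; split => //; apply: le_trans pI.
rewrite (_ : hits _ _ _ _ _ _ _ _ _ _ = \bigcup_(j in [set j | (j < m.+1)%N]) D j); last first.
  by apply/seteqP; split => w [j jm [Dj1 Dj2]]; exists j.
have mU : measurable (\bigcup_(j in [set j | (j < m.+1)%N]) D j) by exact: bigcup_measurable.
have := ler_wpM2l r0 (prob_le1 P mU); rewrite mulr1 mulrBl mul1r; lra.
Qed.

Let Lp := stretched_limit S.
Let Ln := stretched_limit (reflect_scale S).

(** The probabilities a of an upper exit and b of a lower exit nearly satisfy a + b = 1 and Lp a =
    Ln b, a linear system whose solution is a = Ln / (Lp + Ln), b = Lp / (Lp + Ln). *)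
Lemma exit_probabilities e : 0 < e -> exists K0 : R, forall K, K0 <= K -> exists2 l : R, 0 < l & exists m,
  Lp / (Lp + Ln) - e <= prob P (hits B X zeta [set y : R | y < - K] start 0 (- K) K l m) /\
  Ln / (Lp + Ln) - e <= prob P (hits B X zeta [set y : R | K < y] start 0 (- K) K l m).
Proof.
move=> e0.
have [Lp0 Ln0] := scale_limit_gt0 k0 a1_gt a2_gt b1_lt0 b2_gt0 S0 dS.
rewrite -/Lp -/Ln in Lp0 Ln0.
set L := Lp + Ln; have L0 : 0 < L by rewrite /L; lra.
(* Four errors of this size add up to e * L: two come from the limits of S and two from the paths
   without a seen exit. *)
have dl0 : 0 < e * L / 4 by rewrite divr_gt0 // mulr_gt0.
have e'0 : 0 < e / 4 by rewrite divr_gt0.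
have [K0 K00 HK] := scale_near k0 a1_gt a2_gt b1_lt0 b2_gt0 S0 dS dl0.
exists (K0 + 1) => K KK; have K1 : 0 < K by lra.
have [l l0 [M1 HM1]] := exit_eventually K1 e'0.
have [|SK SNK] := HK K; first by lra.
have [M2 HM2] := exit_balance K1 l0 dl0 (ltW SK) (ltW SNK).
exists l => //; exists (M1 + M2)%N.
have := HM1 _ (leq_addr M2 M1); have := HM2 _ (leq_addl M1 M2).
set m := (M1 + M2)%N.
set U := hits B X zeta [set y | K < y] _ _ _ _ _ _; set W := hits B X zeta [set y | y < - K] _ _ _ _ _ _.
have := prob_ge0 P U; have := prob_ge0 P W.
rewrite -/Lp -/Ln -/L ler_norml; set a := prob P U; set b := prob P W.
move=> b0 a0 /andP[h1 h2] h3.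
have h4 : L * (1 - a - b) <= e * L / 4 by rewrite mulrC mulrAC ler_pM2r //; lra.
have E1 : Lp / L * L = Lp by rewrite divfK // gt_eqF.
have E2 : Ln / L * L = Ln by rewrite divfK // gt_eqF.
have LE : L = Lp + Ln by [].
have q1 : Lp * (1 - a - b) <= e * L / 4.
  have [s|s] := leP 0 (1 - a - b); last by apply: le_trans (ltW dl0); rewrite mulr_ge0_le0 ?ltW.
  by apply: le_trans h4; rewrite ler_wpM2r //; lra.
have q2 : Ln * (1 - a - b) <= e * L / 4.
  have [s|s] := leP 0 (1 - a - b); last by apply: le_trans (ltW dl0); rewrite mulr_ge0_le0 ?ltW.
  by apply: le_trans h4; rewrite ler_wpM2r //; lra.
split; rewrite -(ler_pM2r L0) mulrBl ?E1 ?E2.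
  have -> : b * L = Lp - Lp * (1 - a - b) - (Lp * a - Ln * b) by rewrite LE; ring.
  lra.
have -> : a * L = Ln - Ln * (1 - a - b) + (Lp * a - Ln * b) by rewrite LE; ring.
lra.
Qed.

(** Staying above 1 and a negative bifurcation are statements about late times; they contradict each
    other at a time past both thresholds where the path is still alive. *)
Lemma alive_later s t w : alive zeta s w -> alive zeta t w -> exists2 r : R, s < r /\ t < r & alive zeta r w.
Proof.
wlog st : s t / s <= t.
  move=> H ls lt; have [st|/ltW ts] := leP s t; first exact: H.
  by have [r [r1 r2] lr] := H t s ts lt ls; exists r.
move=> _; rewrite /alive /=; case: (zeta w) => [z| |//].
  rewrite lte_fin => tz; exists ((t + z) / 2); first by split; lra.
  by rewrite lte_fin; lra.
by move=> _; exists (t + 1); [split; lra|exact: ltry].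
Qed.

(** From inside: exit below - K, and no return above -1. From outside: exit above K, and no return
    below 1, which excludes a negative bifurcation. K is so large that the exit probabilities and
    the return ratio each cost at most e / 2. *)
Lemma probability_negative :
  has_probability P (negative_bifurcation B X zeta) (Lp / (Lp + Ln)).
Proof.
have [Lp0 Ln0] := scale_limit_gt0 k0 a1_gt a2_gt b1_lt0 b2_gt0 S0 dS.
rewrite -/Lp -/Ln in Lp0 Ln0.
have lt_p y := scale_lt k0 a1_gt a2_gt b1_lt0 b2_gt0 S0 dS y.
have gt_n y := scale_gt k0 a1_gt a2_gt b1_lt0 b2_gt0 S0 dS y.
have Sm := scale_mono k0 a1_gt a2_gt b1_lt0 b2_gt0 dS.
have exh (C : R) i : (Num.truncn C <= i)%N -> forall y, `|y| <= C -> - i.+1%:R <= y <= i.+1%:R.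
  move=> Ci y yC; rewrite -ler_norml; apply: le_trans yC _.
  by apply/ltW/(lt_le_trans (truncnS_gt C)); rewrite ler_nat.
have i1 i : 1 <= i.+1%:R :> R by rewrite ler1n.
apply: has_probability_approx => e e0.
- have e20 : 0 < e / 2 by lra.
  have V : 0 < Ln + S (- 1) by have := gt_n (- 1); rewrite -/Ln; lra.
  have dl0 : 0 < e / 2 * (Ln + S (- 1)) by rewrite mulr_gt0.
  have [K1 HK1] := exit_probabilities e20.
  have [K2 K20 HK2] := scale_near k0 a1_gt a2_gt b1_lt0 b2_gt0 S0 dS dl0.
  pose K := Num.max (Num.max K1 K2) 1.
  have [l l0 [m [PW _]]] := HK1 K ltac:(by rewrite !le_max lexx).
  have [_ SK] := HK2 K ltac:(by rewrite !le_max lexx orbT).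
  have K_ge1 : 1 <= K by rewrite le_max lexx orbT.
  have [//|||||||||||||||I [mI pI aI]] := @stay_after_exit (- 1) Ln (- S (- 1)) (- S (- K)) K l
    [set y | - 1 < y] [set y | y < - K] (fun i => - i.+1%:R) (fun=> - 1) (negative_bifurcation B X zeta) m.
  + by rewrite normrN1.
  + by have := gt_n (- 1); rewrite -/Ln; lra.
  + by have := gt_n (- K); rewrite -/Ln; lra.
  + exact: measurable_gt.
  + exact: measurable_lt.
  + by move=> y /andP[y1 _] /=; rewrite ltNge y1.
  + move=> y /= yK; split; [by apply/eqP => y0; lra|by lra|].
    by rewrite mulN1r lerN2; apply: Sm; exact: ltW.
  + by move=> i; rewrite lerN2.
  + by move=> i y /andP[_ y2] /=; rewrite ltNge y2.
  + by move=> y; have := gt_n y; rewrite -/Ln; lra.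
  + move=> i y /= y1; rewrite mulN1r lerN2; apply: Sm.
    by rewrite /clamp le_max le_min (ltW y1) lerDl ler01 orbT.
  + move=> C; exists (Num.truncn C) => i Ci y yC /negP; rewrite -leNgt => ->.
    by have /andP[-> _] := exh C i Ci y yC.
  + move=> y /= y1; exists (y + 1); first by lra.
    by move=> z; rewrite ltr_norml => /andP[z1 z2]; lra.
  + move=> w s s0 al H; exists s; split => // t st lt.
    by have /negP := H t st lt; rewrite -leNgt => h; rewrite -subr_lt0; lra.
  exists I; split => //; apply: le_trans pI.
  have : (Ln - - S (- K)) / (Ln - - S (- 1)) <= e / 2.
    by rewrite ler_pdivrMr !opprK //; move: SK; rewrite -/Ln; lra.
  lra.
- have e20 : 0 < e / 2 by lra.
  have V : 0 < Lp - S 1 by have := lt_p 1; rewrite -/Lp; lra.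
  have dl0 : 0 < e / 2 * (Lp - S 1) by rewrite mulr_gt0.
  have [K1 HK1] := exit_probabilities e20.
  have [K2 K20 HK2] := scale_near k0 a1_gt a2_gt b1_lt0 b2_gt0 S0 dS dl0.
  pose K := Num.max (Num.max K1 K2) 1.
  have [l l0 [m [_ PU]]] := HK1 K ltac:(by rewrite !le_max lexx).
  have [SK _] := HK2 K ltac:(by rewrite !le_max lexx orbT).
  have K_ge1 : 1 <= K by rewrite le_max lexx orbT.
  have [//|||||||||||||||J [mJ pJ aJ]] := @stay_after_exit 1 Lp (S 1) (S K) K l
    [set y | y < 1] [set y | K < y] (fun=> 1) (fun i => i.+1%:R) (fun w => ~ negative_bifurcation B X zeta w) m.
  + by rewrite normr1.
  + exact: lt_p.
  + exact/ltW/lt_p.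
  + exact: measurable_lt.
  + exact: measurable_gt.
  + by move=> y /andP[_ y2] /=; rewrite ltNge y2.
  + move=> y /= yK; split; [by apply/eqP => y0; lra|by lra|].
    by rewrite mul1r; apply: Sm; exact: ltW.
  + exact: i1.
  + by move=> i y /andP[y1 _] /=; rewrite ltNge y1.
  + by move=> y; rewrite mul1r; exact/ltW/lt_p.
  + move=> i y /= y1; rewrite mul1r; apply: Sm.
    by rewrite /clamp ge_max ge_min (ltW y1) gerDl lerN10.
  + move=> C; exists (Num.truncn C) => i Ci y yC /negP; rewrite -leNgt => ->.
    by have /andP[_ ->] := exh C i Ci y yC.
  + move=> y /= y1; exists (1 - y); first by lra.
    by move=> z; rewrite ltr_norml => /andP[z1 z2]; lra.
  + move=> w s s0 al H [t1 [t10 al1 neg]].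
    have [r [sr t1r] lr] := alive_later al al1.
    by have /negP := H r sr lr; rewrite -leNgt; have := neg r t1r lr; lra.
  exists J; split => //; apply: le_trans pJ.
  have -> : 1 - Lp / (Lp + Ln) = Ln / (Lp + Ln) by field; rewrite gt_eqF //; lra.
  have : (Lp - S K) / (Lp - S 1) <= e / 2.
    by rewrite ler_pdivrMr //; move: SK; rewrite -/Lp; lra.
  lra.
Qed.

Lemma lambda_limits : lambda sigma a1 b1 = Ln^-1 /\ lambda sigma a2 b2 = Lp^-1.
Proof.
have [Lp0 Ln0] := scale_limit_gt0 k0 a1_gt a2_gt b1_lt0 b2_gt0 S0 dS.
have [E1 E2] := Gamma_scale k0 a1_gt a2_gt b1_lt0 b2_gt0 S0 dS.
split; last exact: lambda_limit.
(* [lambda] depends on its last argument through the absolute value only, so the negative b1 may be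
   replaced by |b1|. *)
rewrite /lambda -(normr_id b1) -/(lambda sigma a1 `|b1|); apply: lambda_limit => //.
by rewrite normr_gt0 lt_eqF.
Qed.

End Bifurcation.

Theorem theorem4p1 (R : realType) (d : measure_display) (T : measurableType d)
    (P : probability T R) (F : R -> set (set T))
    (sigma a1 a2 b1 b2 : R)
    (B X : R -> T -> R) (zeta : T -> \bar R)
    (sigma_gt0 : 0 < sigma)
    (a1_gt : -1 < a1) (a2_gt : -1 < a2) (b1_lt0 : b1 < 0) (b2_gt0 : 0 < b2)
    (filtrationF : filtration F)
    (brownianB : brownian_motion P F sigma B)
    (solutionX : solution P F B a1 a2 b1 b2 X zeta) :
  let l1 := lambda sigma a1 b1 in
  let l2 := lambda sigma a2 b2 in
  has_probability P (negative_bifurcation B X zeta) (l1 / (l1 + l2)) /\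
  (a1 = 0 -> a2 = 0 -> l1 / (l1 + l2) = `|b1| / (`|b1| + `|b2|)).
Proof.
have k0 : 0 < sigma ^+ 2 / 2 by rewrite divr_gt0 // exprn_gt0.
have [S S0 dS] := scale_exists (sigma ^+ 2 / 2) b1 b2 a1_gt a2_gt.
have [Lp0 Ln0] := scale_limit_gt0 k0 a1_gt a2_gt b1_lt0 b2_gt0 S0 dS.
have [E1 E2] := lambda_limits sigma_gt0 a1_gt a2_gt b1_lt0 b2_gt0 S0 dS.
move=> l1 l2; split.
  (* As l1 and l2 are the inverses of the limits on the negative and positive sides, the two sides
     are exchanged in the ratio. *)
  have -> : l1 / (l1 + l2) = stretched_limit S / (stretched_limit S + stretched_limit (reflect_scale S)).
    by rewrite /l1 /l2 E1 E2; field; rewrite !gt_eqF // addr_gt0.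
  exact: (probability_negative sigma_gt0 a1_gt a2_gt b1_lt0 b2_gt0 filtrationF brownianB solutionX S0 dS).
move=> a10 a20.
have l10 : l1 != 0 by rewrite /l1 E1 invr_eq0 gt_eqF.
move: l10; rewrite /l1 /l2 /lambda a10 a20 !add0r !invr1 !powRr1 ?mulr_ge0 // !mul0r !powRr0 !mulr1.
(* This common factor cancels without being evaluated. It is nonzero because division by 0 yields 0,
   whereas l1 is nonzero. *)
set D := sigma `^ 2 * Gamma 1 => h.
have D0 : D != 0 by apply: contraNneq h => ->; rewrite invr0 mulr0.
have b0 : 0 < `|b1| + `|b2| by rewrite ltr_pwDl // normr_gt0 lt_eqF.
by field; rewrite D0 -mulrDr mulf_eq0 (gt_eqF b0) pnatr_eq0.
Qed.
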